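(* Let $\Sigma$ be a connected minimal Lagrangian surface in $\mathbb{H}^2\times\mathbb{H}^2$. If $\Sigma$ has constant Gaussian curvature, then the immersion is totally geodesic. Hence, it is a product of geodesics or holomorphically or anti-holomorphically congruent to an open part of the diagonal surface. In particular, the constant Gaussian curvature can only be $0$ or $-1/2$.
   Context: All manifolds, maps and curves are smooth. $\mathbb{R}^3_1$ is $\mathbb{R}^3$ with the metric $\langle a,b\rangle=-a_1b_1+a_2b_2+a_3b_3$, and $a\boxtimes b=(a_3b_2-a_2b_3,\ a_3b_1-a_1b_3,\ a_1b_2-a_2b_1)$ is the Lorentzian cross product. For $c<0$, $\mathbb{H}^2(c)=\{x\in\mathbb{R}^3_1\mid\langle x,x\rangle=1/c,\ x_1>0\}$ with the induced Riemannian metric (of constant Gaussian curvature $c$) and complex structure $(J_{\mathbb{H}^2(c)})_xv=\sqrt{-c}\,x\boxtimes v$. Write $\mathbb{H}^2=\mathbb{H}^2(-1)$. The product $\mathbb{H}^2\times\mathbb{H}^2\subset\mathbb{R}^3_1\times\mathbb{R}^3_1$ carries the Riemannian product metric and the complex structure $J=(J_{\mathbb{H}^2},-J_{\mathbb{H}^2})$. Two surfaces are holomorphically (respectively, anti-holomorphically) congruent if one is mapped to the other by an isometry of $\mathbb{H}^2\times\mathbb{H}^2$ whose differential preserves $J$ (respectively, takes $J$ to $-J$). A Lagrangian surface is a surface $\Sigma$ with an immersion $\Phi:\Sigma\to\mathbb{H}^2\times\mathbb{H}^2$ such that $J$ maps each tangent plane of the surface to its orthogonal complement; $\Sigma$ carries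 the induced metric. It is minimal if its mean curvature vector field vanishes, and totally geodesic if its second fundamental form vanishes identically. A product of geodesics is the surface given by an immersion $I_1\times I_2\subseteq\mathbb{R}^2\to\mathbb{H}^2\times\mathbb{H}^2:(s_1,s_2)\mapsto(\beta_1(s_1),\beta_2(s_2))$, where $I_1,I_2\subseteq\mathbb{R}$ are open intervals and $\beta_1:I_1\to\mathbb{H}^2$, $\beta_2:I_2\to\mathbb{H}^2$ are geodesics parametrized by arc length. The diagonal surface is the image of the immersion $\mathbb{H}^2(-1/2)\to\mathbb{H}^2\times\mathbb{H}^2:x\mapsto\tfrac{1}{\sqrt2}(x,x)$.
   Formalization: ''It is a product of geodesics'' is read as ''an (immersed) open part of a product of geodesics'': a flat disc inside such a product meets all hypotheses but is not itself the image of a rectangle I₁×I₂. The surface is also assumed nonempty. *)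

(* Defs.v *)
From mathcomp Require Import all_boot all_order all_algebra.
From mathcomp Require Import all_classical all_reals all_analysis.

Set Implicit Arguments.
Unset Strict Implicit.
Unset Printing Implicit Defensive.

Import Order.TTheory GRing.Theory Num.Theory.
Import numFieldNormedType.Exports.

Local Open Scope classical_set_scope.
Local Open Scope ring_scope.

Section Smooth.
Context (R : realType).

(* Meaningful for U open: f is C^k on U. *)
Fixpoint Ck_on (k : nat) (V W : normedModType R) (U : set V) (f : V -> W) :
    Prop :=
  match k with
  | 0%N => forall x, U x -> {for x, continuous f}
  | k'.+1 => (forall x, U x -> differentiable f x) /\
             (forall v : V, Ck_on k' U (fun x => 'D_v f x))
  end.

Definition smooth_on (V W : normedModType R) (U : set V) (f : V -> W) : Prop :=
  forall k, Ck_on k U f.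

End Smooth.

Section Surface.
Context (R : realType).

(* The inverse of a chart: a homeomorphism [param] from the open set [dom] of
   the plane onto the open set [img] of S, with inverse [coords].  Values of
   [param] outside [dom] and of [coords] outside [img] are irrelevant. *)
Record local_param (S : topologicalType) := LocalParam {
  dom : set 'rV[R]_2;
  img : set S;
  param : 'rV[R]_2 -> S;
  coords : S -> 'rV[R]_2;
  open_dom : open dom;
  open_img : open img;
  param_img : forall u, dom u -> img (param u);
  coords_dom : forall p, img p -> dom (coords p);
  paramK : forall u, dom u -> coords (param u) = u;
  coordsK : forall p, img p -> param (coords p) = p;
  param_continuous : forall u, dom u -> {for u, continuous param};
  coords_continuous : forall p, img p -> {for p, continuous coords}
}.

(* Smooth 2-manifolds without boundary; the atlas need not be maximal. *)
Record surface := Surface {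
  surface_space :> topologicalType;
  atlas : set (local_param surface_space);
  surface_hausdorff : hausdorff_space surface_space;
  surface_second_countable : @second_countable surface_space;
  atlas_cover : forall p : surface_space, exists2 c, atlas c & img c p;
  atlas_compatible : forall c d, atlas c -> atlas d ->
    smooth_on (dom c `&` (param c @^-1` img d)) (coords d \o param c)
}.

Definition immersion (S : surface) (W : normedModType R) (f : S -> W) : Prop :=
  forall c, atlas c ->
    smooth_on (dom c) (f \o param c) /\
    forall u, dom c u -> injective ('d (f \o param c) u : 'rV[R]_2 -> W).

End Surface.

Section HxH.
Context (R : realType).

Definition lor (a b : 'rV[R]_3) : R :=
  - (a 0 0 * b 0 0) + a 0 1 * b 0 1 + a 0 2 * b 0 2.

Definition lcross (a b : 'rV[R]_3) : 'rV[R]_3 :=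
  \row_(i < 3) [:: a 0 2 * b 0 1 - a 0 1 * b 0 2;
                   a 0 2 * b 0 0 - a 0 0 * b 0 2;
                   a 0 0 * b 0 1 - a 0 1 * b 0 0]`_i.

Definition H2 (c : R) : set 'rV[R]_3 :=
  [set x | lor x x = c^-1 /\ 0 < x 0 0].

Definition JH2 (c : R) (x v : 'rV[R]_3) : 'rV[R]_3 :=
  Num.sqrt (- c) *: lcross x v.

(* The orthogonal projection of R^3_1 onto the tangent plane of H2 c at x. *)
Definition projH2 (c : R) (x w : 'rV[R]_3) : 'rV[R]_3 :=
  w - (c * lor w x) *: x.

Definition ambient := ('rV[R]_3 * 'rV[R]_3)%type.

Definition HH : set ambient := [set x | H2 (-1) x.1 /\ H2 (-1) x.2].

Definition tangentHH (x : ambient) : set ambient :=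
  [set v | lor v.1 x.1 = 0 /\ lor v.2 x.2 = 0].

Definition dot (v w : ambient) : R := lor v.1 w.1 + lor v.2 w.2.

Definition J (x v : ambient) : ambient :=
  (JH2 (-1) x.1 v.1, - JH2 (-1) x.2 v.2).

Definition projHH (x w : ambient) : ambient :=
  (projH2 (-1) x.1 w.1, projH2 (-1) x.2 w.2).

(* Smooth maps HH -> HH, given as restrictions of maps of the ambient space
   that are smooth near HH; since HH is a closed submanifold every smooth map
   arises so, and ['d F x] restricted to [tangentHH x] depends only on the
   restriction of F to HH. *)
Definition smooth_self_map (F : ambient -> ambient) : Prop :=
  (forall x, HH x -> HH (F x)) /\
  exists U : set ambient, [/\ open U, HH `<=` U & smooth_on U F].

Definition isometryHH (F : ambient -> ambient) : Prop :=
  [/\ smooth_self_map F,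
      exists G, [/\ smooth_self_map G, forall x, HH x -> G (F x) = x
                  & forall x, HH x -> F (G x) = x]
    & forall x, HH x -> forall v w, tangentHH x v -> tangentHH x w ->
        dot ('d F x v) ('d F x w) = dot v w].

Definition holomorphically_congruent (A B : set ambient) : Prop :=
  exists F, [/\ isometryHH F,
    forall x, HH x -> forall v, tangentHH x v ->
      'd F x (J x v) = J (F x) ('d F x v)
    & F @` A = B].

Definition antiholomorphically_congruent (A B : set ambient) : Prop :=
  exists F, [/\ isometryHH F,
    forall x, HH x -> forall v, tangentHH x v ->
      'd F x (J x v) = - J (F x) ('d F x v)
    & F @` A = B].

End HxH.

(* Local geometry of f = (parametrization of a surface followed by its
   immersion), in the coordinates of the parametrization. *)
Section LocalGeometry.
Context (R : realType) (f : 'rV[R]_2 -> ambient R).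
Implicit Types (i j k l m : 'I_2) (u : 'rV[R]_2).

Definition partial (W : normedModType R) i (h : 'rV[R]_2 -> W) u : W :=
  'D_(delta_mx 0 i) h u.

Definition first_form u : 'M[R]_2 :=
  \matrix_(i, j) dot (partial i f u) (partial j f u).

(* The Levi-Civita connection of the induced metric:
   nabla_(d_i) d_j = \sum_k christoffel k i j d_k. *)
Definition christoffel k i j u : R :=
  2^-1 * \sum_l invmx (first_form u) k l *
    (partial i (fun x => first_form x j l : R^o) u +
     partial j (fun x => first_form x i l : R^o) u -
     partial l (fun x => first_form x i j : R^o) u).

(* Rm(d_i, d_j) d_k = \sum_l riemann l k i j d_l with
   Rm(X, Y) = [nabla_X, nabla_Y] - nabla_[X, Y]. *)
Definition riemann l k i j u : R :=
  partial i (christoffel l j k : _ -> R^o) u -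
  partial j (christoffel l i k : _ -> R^o) u +
  \sum_m (christoffel l i m u * christoffel m j k u -
          christoffel l j m u * christoffel m i k u).

Definition gauss_curvature u : R :=
  (\sum_l first_form u 0 l * riemann l 1 0 1 u) / \det (first_form u).

(* Gauss formula: the Levi-Civita connection of HH is the tangential part of
   the flat derivative, and the second fundamental form is the difference
   between it and the Levi-Civita connection of the induced metric. *)
Definition second_form i j u : ambient R :=
  projHH (f u) (partial i (partial j f) u) -
  \sum_k christoffel k i j u *: partial k f u.

Definition mean_curvature u : ambient R :=
  2^-1 *: \sum_i \sum_j invmx (first_form u) i j *: second_form i j u.

End LocalGeometry.

Section Surfaces.
Context (R : realType) (S : surface R) (Phi : S -> ambient R).

Definition lagrangian_surface : Prop :=
  [/\ forall p, HH (Phi p), immersion Phi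
    & forall c, atlas c -> forall u, dom c u -> forall v w : 'rV[R]_2,
        dot (J (Phi (param c u)) ('d (Phi \o param c) u v))
            ('d (Phi \o param c) u w) = 0].

Definition minimal : Prop :=
  forall c, atlas c -> forall u, dom c u ->
    mean_curvature (Phi \o param c) u = 0.

Definition totally_geodesic : Prop :=
  forall c, atlas c -> forall u, dom c u ->
    forall i j, second_form (Phi \o param c) i j u = 0.

Definition has_constant_curvature (K : R) : Prop :=
  forall c, atlas c -> forall u, dom c u ->
    gauss_curvature (Phi \o param c) u = K.

End Surfaces.

Section Models.
Context (R : realType).

Definition unit_speed_geodesic (I : set R) (b : R -> 'rV[R]_3) : Prop :=
  [/\ smooth_on (I : set R^o) (b : R^o -> 'rV[R]_3),
      forall s, I s -> H2 (-1) (b s),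
      forall s, I s -> lor (derive1 b s) (derive1 b s) = 1
    & forall s, I s -> projH2 (-1) (b s) (derive1 (derive1 b) s) = 0].

Definition open_interval (I : set R) : Prop :=
  [/\ open I, is_interval I & I !=set0].

(* Phi is an immersed open part of a product of geodesics: it factors through
   (s1, s2) |-> (b1 s1, b2 s2) by a local diffeomorphism S -> I1 * I2 (an
   immersion between manifolds of the same dimension 2).  The domain S itself
   need not be a rectangle, as open parts of such a product show. *)
Definition product_of_geodesics (S : surface R) (Phi : S -> ambient R) : Prop :=
  exists (I1 I2 : set R) (b1 b2 : R -> 'rV[R]_3) (s : S -> 'rV[R]_2),
    [/\ open_interval I1 /\ open_interval I2,
        unit_speed_geodesic I1 b1, unit_speed_geodesic I2 b2,
        immersion s
      & forall p, [/\ I1 (s p 0 0), I2 (s p 0 1)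
                    & Phi p = (b1 (s p 0 0), b2 (s p 0 1))]].

Definition diagonal_immersion (x : 'rV[R]_3) : ambient R :=
  ((Num.sqrt 2)^-1 *: x, (Num.sqrt 2)^-1 *: x).

Definition open_part_of_diagonal (A : set (ambient R)) : Prop :=
  exists V : set ('rV[R]_3),
    open V /\ A = diagonal_immersion @` (H2 (- 2^-1) `&` V).

End Models.

(* Main.v *)
From HB Require Import structures.
Require Import Defs.
From mathcomp Require Import all_boot all_order all_algebra.
From mathcomp Require Import all_classical all_reals all_analysis.
From mathcomp Require Import ring lra.

(** Write the immersion as a pair (phi, psi) of maps into the hyperbolic plane.

    Minimality makes both components harmonic for the induced metric.  The
    Lagrangian condition says that phi and psi have the same Jacobian c
    ([jacobian_eq]); since the pulled back metrics add up to the induced one,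
    their Gram matrices in an orthonormal frame are G and 1 - G with equal
    determinants, so tr G = 1: both components have energy density 1
    ([energy]).  Split d phi into its complex linear and antilinear parts, of
    squared norms 1 + 2c and 1 - 2c.  The Bochner formula for each part gives
    the Laplacian of c, the derivative of each norm gives its gradient, and
    eliminating the Hessian leaves ([jacobian_gradient], [jacobian_laplacian],
    [hessian_norm])
<<
      2 |grad c|^2 = - (1 - 4 c^2) (K + 2 c^2),
      Lap c = c (1 + 4 K + 4 c^2),
      |Hess phi|^2 = - (K + 2 c^2).
>>
    So c is isoparametric.  The Hessian of c is then determined by c in the
    gradient direction and by the trace in the orthogonal one, and the Bochner
    formula for |grad c|^2 becomes |grad c|^2 p(c) = 0 for a polynomial p of
    degree 4 whose coefficients cannot all vanish for the same K; thus
    grad c = 0 ([isoparametric_gradient0]).  Back in the identities above,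
    K = - 2 c^2 and c (1 - 4 c^2) = 0 ([jacobian_rigid]): the Hessians of phi
    and psi vanish, which is total geodesy ([second_form0]), and K is 0 or
    - 1/2.

    For K = - 1/2 one has 4 c^2 = 1, so phi and psi are homotheties onto their
    images.  The matrix which carries the position and the image of a tangent
    frame under phi to those under psi is parallel, hence locally constant and
    by connectedness one Lorentz matrix A of determinant 1 with phi A = psi
    ([global_isometry]).  The map (x, y) |-> (x A, y) is a holomorphic isometry
    taking the surface to the points (psi, psi), and these fill an open part of
    the diagonal because psi is a local diffeomorphism ([local_surjection],
    [congruent_to_diagonal]).

    For K = 0 one has c = 0, so each component has rank at most one, and the
    normals to its image are all multiples of a vector n: the component stays
    in the plane orthogonal to n, that is, on one geodesic
    ([global_geodesic]).  The two arc lengths along these geodesics are the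
    coordinates of a product of geodesics ([flat_product_of_geodesics]).

    All local computations take place in the commutative ring of smooth
    functions on an open set of the plane, with the derivations d_0 and d_1;
    each of the identities above is then a polynomial identity modulo the
    relations already known. *)

Set Implicit Arguments.
Unset Strict Implicit.
Unset Printing Implicit Defensive.

Import Order.TTheory GRing.Theory Num.Theory.
Import numFieldNormedType.Exports.

Local Open Scope classical_set_scope.
Local Open Scope ring_scope.

(** * Small sums, determinants and index sets *)

Lemma sum2E (A : nmodType) (F : 'I_2 -> A) : \sum_i F i = F 0 + F 1.
Proof.
rewrite big_ord_recl big_ord_recl big_ord0 addr0; congr (_ + F _).
exact: val_inj.
Qed.

Lemma sum3E (A : nmodType) (F : 'I_3 -> A) : \sum_i F i = F 0 + F 1 + F 2.
Proof.
rewrite !big_ord_recl big_ord0 addr0 addrA.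
by congr (_ + F _ + F _); exact: val_inj.
Qed.

Lemma det2E (A : comNzRingType) (M : 'M[A]_2) : \det M = M 0 0 * M 1 1 - M 0 1 * M 1 0.
Proof.
rewrite (expand_det_row _ 0) sum2E /cofactor !det_mx11 !mxE /=.
rewrite (_ : lift 0 0 = 1); last exact: val_inj.
rewrite (_ : lift 1 0 = 0); last exact: val_inj.
by rewrite expr0 expr1; ring.
Qed.

Lemma ord2_cases (j : 'I_2) : j = 0 \/ j = 1.
Proof. by case: j => -[|[|//]] lt; [left|right]; exact: val_inj. Qed.

Lemma ord3_cases (j : 'I_3) : [\/ j = 0, j = 1 | j = 2].
Proof. by case: j => -[|[|[|//]]] lt; [apply: Or31|apply: Or32|apply: Or33]; exact: val_inj. Qed.

(** Closes an equation that is a consequence of x = y up to ring identities: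
    the second premise is left to [ring]. *)
Lemma eq_sub (A : zmodType) (a b x y : A) : x = y -> a - b = x - y -> a = b.
Proof. by move=> ->; rewrite subrr => /eqP; rewrite subr_eq0 => /eqP. Qed.

(** * Harmonic maps and isoparametric functions in an orthonormal frame *)

Definition derivation (A : comPzRingType) (d : A -> A) : Prop :=
  (forall x y, d (x + y) = d x + d y) /\
  (forall x y, d (x * y) = d x * y + x * d y).

Section Derivations.
Context (A : comPzRingType) (d : A -> A) (hd : derivation d).

Lemma derD x y : d (x + y) = d x + d y. Proof. exact: hd.1. Qed.
Lemma derM x y : d (x * y) = d x * y + x * d y. Proof. exact: hd.2. Qed.
Lemma der0 : d 0 = 0.
Proof. by apply: (addrI (d 0)); rewrite -derD !addr0. Qed.
Lemma derN x : d (- x) = - d x.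
Proof. by apply: (addrI (d x)); rewrite -derD !subrr der0. Qed.
Lemma der1 : d 1 = 0.
Proof. by apply: (addrI (d 1)); rewrite addr0 -[RHS](congr1 d (mulr1 1)) derM mulr1 mul1r. Qed.
Lemma der_nat n : d n%:R = 0.
Proof. by elim: n => [|n IH]; rewrite ?der0 // -natr1 derD IH der1 addr0. Qed.
Lemma derX2 x : d (x ^+ 2) = 2 * x * d x.
Proof. by rewrite expr2 derM; ring. Qed.
Lemma derX3 x : d (x ^+ 3) = 3 * x ^+ 2 * d x.
Proof. by rewrite exprS derM derX2; ring. Qed.
Lemma derX4 x : d (x ^+ 4) = 4 * x ^+ 3 * d x.
Proof. by rewrite exprS derM derX3; ring. Qed.
Definition derE := (derD, derN, derM, derX2, derX3, derX4, der_nat, der0, der1).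
End Derivations.

Section Frame.
Context (A : comPzRingType) (E1 E2 : A -> A) (w1 w2 K : A).

(** The algebraic shadow of an orthonormal frame E1, E2: w1 and w2 are the
    values on E1 and E2 of its connection form, so that the third clause is
    [E1, E2] = - w1 E1 - w2 E2 and the last one says that the curvature is K. *)
Definition orthonormal_frame : Prop :=
  [/\ derivation E1, derivation E2,
      forall x, E1 (E2 x) - E2 (E1 x) = - w1 * E1 x - w2 * E2 x
    & E1 w2 - E2 w1 + w1 ^+ 2 + w2 ^+ 2 = - K].

Definition laplacian (x : A) : A :=
  E1 (E1 x) + E2 (E2 x) - w1 * E2 x + w2 * E1 x.

Hypothesis F : orthonormal_frame.
Let d1 : derivation E1. Proof. by case: F. Qed.
Let d2 : derivation E2. Proof. by case: F. Qed.
Let br x : E1 (E2 x) = E2 (E1 x) - w1 * E1 x - w2 * E2 x.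
Proof. by case: F => _ _ /(_ x) h _; apply: (eq_sub h); ring. Qed.
Let cu : E1 w2 = E2 w1 - w1 ^+ 2 - w2 ^+ 2 - K.
Proof. by case: F => _ _ _ h; apply: (eq_sub h); ring. Qed.

(** P_a and Q_a are the components of d phi (E_a) along an orthonormal frame of
    the hyperbolic plane whose connection form is - Q.  The eight equations say that the Hessian of phi is symmetric and trace free, with
    P-components (MP, NP; NP, - MP) and Q-components (MQ, NQ; NQ, - MQ): phi is
    harmonic. *)
Definition frame_hessian (P1 P2 Q1 Q2 MP MQ NP NQ : A) : Prop :=
  [/\ [/\ E1 P1 = MP - Q1 ^+ 2 + w1 * P2, E2 P1 = NP - Q1 * Q2 + w2 * P2,
      E1 P2 = NP - Q1 * Q2 - w1 * P1 & E2 P2 = - MP - Q2 ^+ 2 - w2 * P1],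
      E1 Q1 = MQ + Q1 * P1 + w1 * Q2, E2 Q1 = NQ + Q2 * P1 + w2 * Q2,
      E1 Q2 = NQ + Q1 * P2 - w1 * Q1 & E2 Q2 = - MQ + Q2 * P2 - w2 * Q1].

(** The four hypotheses are torsion freeness for P and Q and the vanishing of the
    two traces. *)
Lemma frame_hessian_intro P1 P2 Q1 Q2 :
  E1 P2 + w1 * P1 = E2 P1 - w2 * P2 ->
  E1 Q2 + w1 * Q1 = E2 Q1 - w2 * Q2 + Q1 * P2 - Q2 * P1 ->
  (E1 P1 - w1 * P2) + (E2 P2 + w2 * P1) + (Q1 * Q1 + Q2 * Q2) = 0 ->
  (E1 Q1 - w1 * Q2) + (E2 Q2 + w2 * Q1) - (Q1 * P1 + Q2 * P2) = 0 ->
  frame_hessian P1 P2 Q1 Q2 (E1 P1 + Q1 ^+ 2 - w1 * P2) (E1 Q1 - Q1 * P1 - w1 * Q2)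
    (E1 P2 + Q1 * Q2 + w1 * P1) (E1 Q2 - Q1 * P2 + w1 * Q1).
Proof.
move=> cP cQ hP hQ; split; [split|..].
- by ring.
- by apply: (eq_sub (esym cP)); ring.
- by ring.
- by apply: (eq_sub hP); ring.
- by ring.
- by apply: (eq_sub (esym cQ)); ring.
- by ring.
- by apply: (eq_sub hQ); ring.
Qed.

Lemma frame_hessian0 P1 P2 Q1 Q2 : frame_hessian P1 P2 Q1 Q2 0 0 0 0 ->
  [/\ E1 P1 - w1 * P2 = - 1 * (Q1 * Q1), E1 P2 + w1 * P1 = - 1 * (Q1 * Q2),
      E2 P1 - w2 * P2 = - 1 * (Q2 * Q1) & E2 P2 + w2 * P1 = - 1 * (Q2 * Q2)] /\
  [/\ E1 Q1 - w1 * Q2 = - - 1 * (Q1 * P1), E1 Q2 + w1 * Q1 = - - 1 * (Q1 * P2),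
      E2 Q1 - w2 * Q2 = - - 1 * (Q2 * P1) & E2 Q2 + w2 * Q1 = - - 1 * (Q2 * P2)].
Proof.
by case=> -[-> -> -> ->] -> -> -> ->; do !split; ring.
Qed.

Section Parallel.
Context (P1 P2 Q1 Q2 m1 m2 x : A).
Hypothesis H : frame_hessian P1 P2 Q1 Q2 0 0 0 0.
Hypothesis E1m1 : E1 m1 = - Q1 * m2 + P1 * x.
Hypothesis E2m1 : E2 m1 = - Q2 * m2 + P2 * x.
Hypothesis E1m2 : E1 m2 = Q1 * (m1 + x).
Hypothesis E2m2 : E2 m2 = Q2 * (m1 + x).

Let D : (E1 P1 = 0 - Q1 ^+ 2 + w1 * P2) * (E2 P1 = 0 - Q1 * Q2 + w2 * P2) *
  (E1 P2 = 0 - Q1 * Q2 - w1 * P1) * (E2 P2 = - 0 - Q2 ^+ 2 - w2 * P1) *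
  (E1 Q1 = 0 + Q1 * P1 + w1 * Q2) * (E2 Q1 = 0 + Q2 * P1 + w2 * Q2) *
  (E1 Q2 = 0 + Q1 * P2 - w1 * Q1) * (E2 Q2 = - 0 + Q2 * P2 - w2 * Q1) *
  (E1 m1 = - Q1 * m2 + P1 * x) * (E2 m1 = - Q2 * m2 + P2 * x) *
  (E1 m2 = Q1 * (m1 + x)) * (E2 m2 = Q2 * (m1 + x)).
Proof. by case: H => -[]. Qed.

Let E := (derE d1, derE d2, D).

(** The Hessian vanishes, so the images of the frame vectors rotate with the frame,
    up to the normal component given by the hyperboloid. *)
Lemma parallel_tangents :
  (E1 (P1 * m1 + Q1 * m2) = w1 * (P2 * m1 + Q2 * m2) + (P1 ^+ 2 + Q1 ^+ 2) * x) *
  (E2 (P1 * m1 + Q1 * m2) = w2 * (P2 * m1 + Q2 * m2) + (P1 * P2 + Q1 * Q2) * x) *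
  (E1 (P2 * m1 + Q2 * m2) = - w1 * (P1 * m1 + Q1 * m2) + (P1 * P2 + Q1 * Q2) * x) *
  (E2 (P2 * m1 + Q2 * m2) = - w2 * (P1 * m1 + Q1 * m2) + (P2 ^+ 2 + Q2 ^+ 2) * x).
Proof. by rewrite !E; do !split; ring. Qed.

(** For c = 0 the images of the frame vectors are proportional, and the normals
    rotate with the frame without any component along the position vector. *)
Lemma parallel_normals : P1 * Q2 - P2 * Q1 = 0 ->
  (E1 (P1 * m2 - Q1 * m1) = w1 * (P2 * m2 - Q2 * m1)) *
  (E2 (P1 * m2 - Q1 * m1) = w2 * (P2 * m2 - Q2 * m1)) *
  (E1 (P2 * m2 - Q2 * m1) = - w1 * (P1 * m2 - Q1 * m1)) *
  (E2 (P2 * m2 - Q2 * m1) = - w2 * (P1 * m2 - Q1 * m1)).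
Proof.
move=> j; rewrite !E; split; [split; [split|]|].
- by ring.
- by apply: (eq_sub (congr1 (fun z => z * x) j)); ring.
- by apply: (eq_sub (congr1 (fun z => - z * x) j)); ring.
by ring.
Qed.

End Parallel.

Section Harmonic.
Context (P1 P2 Q1 Q2 MP MQ NP NQ : A).
Hypothesis H : frame_hessian P1 P2 Q1 Q2 MP MQ NP NQ.
Let c := P1 * Q2 - P2 * Q1.
Let U1 := P1 + Q2.
Let U2 := Q1 - P2.
Let V1 := P1 - Q2.
Let V2 := Q1 + P2.
Let Z1 := MP + NQ.
Let Z2 := MQ - NP.
Let Y1 := MP - NQ.
Let Y2 := MQ + NP.

Let D1 : (E1 P1 = MP - Q1 ^+ 2 + w1 * P2) * (E2 P1 = NP - Q1 * Q2 + w2 * P2) *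
  (E1 P2 = NP - Q1 * Q2 - w1 * P1) * (E2 P2 = - MP - Q2 ^+ 2 - w2 * P1) *
  (E1 Q1 = MQ + Q1 * P1 + w1 * Q2) * (E2 Q1 = NQ + Q2 * P1 + w2 * Q2) *
  (E1 Q2 = NQ + Q1 * P2 - w1 * Q1) * (E2 Q2 = - MQ + Q2 * P2 - w2 * Q1).
Proof. by case: H => -[]. Qed.

Let E := (derE d1, derE d2, D1).

Let codazzi_MP : E1 MP = - E2 NP + E2 (Q1 * Q2 + w1 * P1) - E1 (Q2 ^+ 2)
  - E1 w2 * P1 - w2 * E1 P1 + w1 * E1 P2 + w2 * E2 P2.
Proof.
by have := br P2; rewrite !E => h; apply: (eq_sub (esym h)); ring.
Qed.

Let codazzi_NP : E1 NP = E2 MP - E2 (Q1 ^+ 2 - w1 * P2) + E1 (Q1 * Q2)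
  - E1 w2 * P2 - w2 * E1 P2 - w1 * E1 P1 - w2 * E2 P1.
Proof.
by have := br P1; rewrite !E => h; apply: (eq_sub h); ring.
Qed.

Let codazzi_NQ : E1 NQ = E2 MQ + E2 (Q1 * P1 + w1 * Q2) - E1 (Q2 * P1)
  - E1 w2 * Q2 - w2 * E1 Q2 - w1 * E1 Q1 - w2 * E2 Q1.
Proof.
by have := br Q1; rewrite !E => h; apply: (eq_sub h); ring.
Qed.

Let codazzi_MQ : E1 MQ = - E2 NQ - E2 (Q1 * P2 - w1 * Q1) + E1 (Q2 * P2)
  - E1 w2 * Q1 - w2 * E1 Q1 + w1 * E1 Q2 + w2 * E2 Q2.
Proof.
by have := br Q2; rewrite !E => h; apply: (eq_sub (esym h)); ring.
Qed.

(** Bochner formula for the complex linear part (U1, U2) of the differential of a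
    harmonic map; Z is its covariant derivative, K the curvature of the domain
    and c the contribution of the curvature of the target. *)
Lemma laplacian_holomorphic_part :
  laplacian (U1 ^+ 2 + U2 ^+ 2) =
  4 * (Z1 ^+ 2 + Z2 ^+ 2) + 2 * (K + c) * (U1 ^+ 2 + U2 ^+ 2).
Proof.
rewrite /laplacian /U1 /U2 /Z1 /Z2 /c !E codazzi_MP codazzi_NP codazzi_MQ codazzi_NQ !E !cu.
ring.
Qed.

(** Same Bochner formula with the orientation of the target reversed, which
    changes the sign of c. *)
Lemma laplacian_antiholomorphic_part :
  laplacian (V1 ^+ 2 + V2 ^+ 2) =
  4 * (Y1 ^+ 2 + Y2 ^+ 2) + 2 * (K - c) * (V1 ^+ 2 + V2 ^+ 2).
Proof.
rewrite /laplacian /V1 /V2 /Y1 /Y2 /c !E codazzi_MP codazzi_NP codazzi_MQ codazzi_NQ !E !cu.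
ring.
Qed.

Section UnitEnergy.
Hypothesis reg : forall (n : nat) (x : A), n.+1%:R * x = 0 -> x = 0.
Hypothesis energy : P1 ^+ 2 + P2 ^+ 2 + Q1 ^+ 2 + Q2 ^+ 2 = 1.
Let S1 := Z1 ^+ 2 + Z2 ^+ 2.
Let S2 := Y1 ^+ 2 + Y2 ^+ 2.

Let U_sq : U1 ^+ 2 + U2 ^+ 2 = 1 + 2 * c.
Proof. by rewrite /U1 /U2 /c; apply: (eq_sub energy); ring. Qed.

Let V_sq : V1 ^+ 2 + V2 ^+ 2 = 1 - 2 * c.
Proof. by rewrite /V1 /V2 /c; apply: (eq_sub energy); ring. Qed.

Let cancel n (x y : A) : n.+1%:R * x = n.+1%:R * y -> x = y.
Proof.
by move=> h; apply/eqP; rewrite -subr_eq0; apply/eqP; apply: (@reg n); rewrite mulrBr h subrr.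
Qed.

Let lap_Z : laplacian c = 2 * S1 + (K + c) * (1 + 2 * c).
Proof.
apply: (@cancel 1); have := laplacian_holomorphic_part; rewrite U_sq -/S1.
rewrite /laplacian !(derE d1, derE d2) => h; apply: (eq_sub h); ring.
Qed.

Let lap_Y : - laplacian c = 2 * S2 + (K - c) * (1 - 2 * c).
Proof.
apply: (@cancel 1); have := laplacian_antiholomorphic_part; rewrite V_sq -/S2.
rewrite /laplacian !(derE d1, derE d2) => h; apply: (eq_sub h); ring.
Qed.

Let sum_ZY : S1 + S2 = - (K + 2 * c ^+ 2).
Proof.
apply: (@cancel 1); have h := congr2 +%R lap_Z lap_Y.
by rewrite subrr in h; apply: (eq_sub (esym h)); ring.
Qed.

Let grad_c : (E1 c = U1 * Z1 + U2 * Z2) * (E2 c = U2 * Z1 - U1 * Z2) *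
  (E1 c = - (V1 * Y1 + V2 * Y2)) * (E2 c = V2 * Y1 - V1 * Y2).
Proof.
have e1 := congr1 E1 energy; have e2 := congr1 E2 energy.
rewrite !E in e1 e2.
have {}e1 : P1 * MP + P2 * NP + Q1 * MQ + Q2 * NQ = 0.
  by apply: (@cancel 1); apply: (eq_sub e1); ring.
have {}e2 : P1 * NP - P2 * MP + Q1 * NQ - Q2 * MQ = 0.
  by apply: (@cancel 1); apply: (eq_sub e2); ring.
split; [split; [split|]|]; rewrite /c /U1 /U2 /V1 /V2 /Z1 /Z2 /Y1 /Y2 !E.
- by apply: (eq_sub (esym e1)); ring.
- by apply: (eq_sub (esym e2)); ring.
- by apply: (eq_sub e1); ring.
by apply: (eq_sub e2); ring.
Qed.

Let G := E1 c ^+ 2 + E2 c ^+ 2.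

Let grad_Z : G = (1 + 2 * c) * S1.
Proof. by rewrite /G !grad_c.1 -U_sq /S1; ring. Qed.

Let grad_Y : G = (1 - 2 * c) * S2.
Proof. by rewrite /G (grad_c.1.2) (grad_c.2) -V_sq /S2; ring. Qed.

(** The linear and antilinear parts have squared norms 1 + 2c and 1 - 2c, so
    |grad c|^2 is (1 + 2c)|Z|^2 and also (1 - 2c)|Y|^2; the sum |Z|^2 + |Y|^2 is
    given by adding the two Bochner formulas. *)
Lemma jacobian_gradient : 2 * G = - ((1 - 4 * c ^+ 2) * (K + 2 * c ^+ 2)).
Proof.
rewrite -mulrN -sum_ZY.
have -> : (1 - 4 * c ^+ 2) * (S1 + S2) =
  (1 - 2 * c) * ((1 + 2 * c) * S1) + (1 + 2 * c) * ((1 - 2 * c) * S2) by ring.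
by rewrite -grad_Z -grad_Y; ring.
Qed.

(** Subtract the two Bochner formulas; |Z|^2 - |Y|^2 is known from the two
    expressions of the gradient of c. *)
Lemma jacobian_laplacian : laplacian c = c * (1 + 4 * K + 4 * c ^+ 2).
Proof.
have h1 : S1 - S2 = 2 * c * (K + 2 * c ^+ 2).
  have h := grad_Z; rewrite grad_Y in h.
  have -> : K + 2 * c ^+ 2 = - (S1 + S2) by rewrite sum_ZY opprK.
  by apply: (eq_sub (esym h)); ring.
apply: (@cancel 1).
have -> : 2 * laplacian c = laplacian c - - laplacian c by ring.
rewrite [in X in X - _]lap_Z lap_Y.
have -> : S1 = S2 + 2 * c * (K + 2 * c ^+ 2) by rewrite -h1; ring.
ring.
Qed.

(** The covariant derivatives of the two parts together make up the Hessian; each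
    of MP, NP and MQ, NQ occurs twice in it, hence the factor 2. *)
Lemma hessian_norm : 2 * (MP ^+ 2 + MQ ^+ 2 + NP ^+ 2 + NQ ^+ 2) = - (K + 2 * c ^+ 2).
Proof. by rewrite -sum_ZY /S1 /S2 /Z1 /Z2 /Y1 /Y2; ring. Qed.

End UnitEnergy.
End Harmonic.

Section Isoparametric.
Context (c : A).
Hypothesis reg : forall (n : nat) (x : A), n.+1%:R * x = 0 -> x = 0.
Hypothesis K1 : E1 K = 0.
Hypothesis K2 : E2 K = 0.
Let G := E1 c ^+ 2 + E2 c ^+ 2.
Hypothesis hG : 2 * G = - ((1 - 4 * c ^+ 2) * (K + 2 * c ^+ 2)).
Hypothesis hL : laplacian c = c * (1 + 4 * K + 4 * c ^+ 2).

Let cancel n (x y : A) : n.+1%:R * x = n.+1%:R * y -> x = y.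
Proof.
by move=> h; apply/eqP; rewrite -subr_eq0; apply/eqP; apply: (@reg n); rewrite mulrBr h subrr.
Qed.

Let E := (derE d1, derE d2, K1, K2).
Let a := E1 (E1 c) - w1 * E2 c.
Let b := E2 (E1 c) - w2 * E2 c.
Let d := E2 (E2 c) + w2 * E1 c.
(* Differentiating hG, the derivative of |grad c|^2 / 2 as a function of c:
   grad c is an eigenvector of the Hessian for this eigenvalue. *)
Let n := - c + 2 * K * c + 8 * c ^+ 3.

Let bochner : laplacian G = 2 * (a ^+ 2 + 2 * b ^+ 2 + d ^+ 2)
  + 2 * (E1 c * E1 (laplacian c) + E2 c * E2 (laplacian c)) + 2 * K * G.
Proof.
rewrite /G /laplacian /a /b /d !(br, E) !cu.
ring.
Qed.

Let hess1 : (a - n) * E1 c + b * E2 c = 0.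
Proof.
have := congr1 E1 hG; rewrite /G /a /b /n !E; rewrite br => h.
by apply: (@cancel 3); apply: (eq_sub h); ring.
Qed.

Let hess2 : b * E1 c + (d - n) * E2 c = 0.
Proof.
have := congr1 E2 hG; rewrite /G /b /d /n !E => h.
by apply: (@cancel 3); apply: (eq_sub h); ring.
Qed.

Let det0 : ((a - n) * (d - n) - b ^+ 2) * G = 0.
Proof.
have h1 : ((a - n) * (d - n) - b ^+ 2) * E1 c = 0.
  transitivity ((d - n) * ((a - n) * E1 c + b * E2 c)
                - b * (b * E1 c + (d - n) * E2 c)); first by ring.
  by rewrite hess1 hess2; ring.
have h2 : ((a - n) * (d - n) - b ^+ 2) * E2 c = 0.
  transitivity ((a - n) * (b * E1 c + (d - n) * E2 c)
                - b * ((a - n) * E1 c + b * E2 c)); first by ring.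
  by rewrite hess1 hess2; ring.
by rewrite /G mulrDr !expr2 !mulrA h1 h2 !mul0r addr0.
Qed.

(** Comparing the Laplacian of |grad c|^2 computed from its expression in c with
    the Bochner formula, in which the Hessian of c is known: grad c is an
    eigenvector, and the trace gives the other eigenvalue. *)
Lemma isoparametric_relation :
  G * ((32 + 72 * K) * c ^+ 4 - (8 + 26 * K + 12 * K ^+ 2) * c ^+ 2 + 2 * K + 3 * K ^+ 2) = 0.
Proof.
(* The Laplacian of |grad c|^2 as a function of c. *)
have hl : 2 * laplacian G = 4 * n * (laplacian c) + (2 * 2 * (2 * K - 1) + 96 * c ^+ 2) * G.
  have -> : 2 * laplacian G = laplacian (2 * G) by rewrite /laplacian !E; ring.
  by rewrite hG /laplacian /n /G !E; ring.
have b' : E1 c * E1 (laplacian c) + E2 c * E2 (laplacian c) = (1 + 4 * K + 12 * c ^+ 2) * G.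
  by rewrite hL /G !E; ring.
have hB := bochner; rewrite b' in hB.
(* With n, the trace determines the second eigenvalue of the Hessian. *)
have tr : d = laplacian c - a by rewrite /d /a /laplacian; ring.
have D := det0; rewrite tr in D hB.
set L := laplacian c in hl hB D.
set q := (X in G * X = _).
have hq : G * (8 * n * L + 2 * G * (4 * (2 * K - 1) + 96 * c ^+ 2 - 4 * (1 + 4 * K + 12 * c ^+ 2) - 4 * K)
   - 8 * (L ^+ 2 - 2 * n * L + 2 * n ^+ 2)) = 0.
  have h1 := congr1 (fun z => 2 * G * z) (etrans (esym hl) (congr1 (fun z => 2 * z) hB)).
  have h2 := congr2 +%R (esym h1) (congr1 (fun z => 16 * z) D).
  by apply: (eq_sub (esym h2)); ring.
apply: (@reg 3); rewrite -[RHS]hq /L hL hG /q /n; ring.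
Qed.

Hypothesis reduced : forall x : A, x * x = 0 -> x = 0.

(** In a reduced ring the annihilator of G is stable under derivations.  Applying
    the derivative along grad c repeatedly to G p(c) = 0 therefore gives
    G p'(c) = 0, and so on, down to G times the leading coefficient of p. *)
Lemma isoparametric_gradient0 : G = 0.
Proof.
have ann D x : derivation D -> G * x = 0 -> G * D x = 0.
  move=> hd Gx; apply: reduced.
  have h := congr1 D Gx; rewrite (derM hd) (der0 hd) in h.
  transitivity (D x * G * (D G * x + G * D x) - D x * D G * (G * x)); first by ring.
  by rewrite h Gx; ring.
have step x y : E1 x * E1 c + E2 x * E2 c = G * y -> G * x = 0 -> G * y = 0.
  move=> xy Gx; apply: reduced; transitivity (y * G * (G * y)); first by ring.
  rewrite -xy; transitivity (y * ((G * E1 x) * E1 c + (G * E2 x) * E2 c)); first by ring.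
  by rewrite !ann //; ring.
(* Differentiating p(c) G = 0 four times isolates its leading coefficient. *)
have h0 := isoparametric_relation.
set p4 := 32 + _ in h0; set p2 := 8 + _ + _ in h0.
have h1 : G * (4 * p4 * c ^+ 3 - 2 * p2 * c) = 0.
  by apply: step h0; rewrite /G /p4 /p2 !E; ring.
have h2 : G * (12 * p4 * c ^+ 2 - 2 * p2) = 0.
  by apply: step h1; rewrite /G /p4 /p2 !E; ring.
have h3 : G * (24 * p4 * c) = 0.
  by apply: step h2; rewrite /G /p4 /p2 !E; ring.
have h4 : G * (24 * p4) = 0.
  by apply: step h3; rewrite /G /p4 /p2 !E; ring.
have {}h4 : G * p4 = 0 by apply: (@reg 23); rewrite -[RHS]h4; ring.
have {}h2 : G * p2 = 0.
  apply: (@reg 1); apply: (eq_sub (congr2 (fun a b => a - b) (congr1 (fun z => 12 * c ^+ 2 * z) h4) h2)); ring.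
have {}h0 : G * (2 * K + 3 * K ^+ 2) = 0.
  transitivity (G * (p4 * c ^+ 4 - p2 * c ^+ 2 + 2 * K + 3 * K ^+ 2) - c ^+ 4 * (G * p4) + c ^+ 2 * (G * p2)); first by ring.
  by rewrite h0 h4 h2; ring.
(* 4 + 9 K and 2 K + 3 K^2 generate the unit ideal over the rationals. *)
have k4 : G * (4 + 9 * K) = 0 by apply: (@reg 7); rewrite -[RHS]h4 /p4; ring.
apply: (@reg 7); transitivity (G * (4 + 9 * K) * (9 * K + 2) - 27 * (G * (2 * K + 3 * K ^+ 2))); first by ring.
by rewrite h0 k4; ring.
Qed.

End Isoparametric.
End Frame.

(** * Closure properties of functions of class C^k *)

Section CkClosure.
Context (R : realType).
Implicit Types V W : normedModType R.

(** Differentiability depends only on the germ of a function. *)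
Lemma near_eq_differentiable V W (f g : V -> W) x :
  (\near x, f x = g x) -> differentiable f x -> differentiable g x.
Proof.
move=> fg df.
have fgx : f x = g x := nbhs_singleton fg.
have hd : g \o shift x = cst (g x) + ('d f x : V -> W) +o_ 0 id.
  rewrite -fgx; apply/eqaddoP => _/posnumP[e].
  have /eqaddoP/(_ e%:num) := diff_locally df.
  move=> /(_ [gt0 of e%:num]).
  apply: filter_app.
  have : \forall h \near (0 : V), f (h + x) = g (h + x).
    by move: (fg); rewrite (near_shift (0 : V) x) subr0.
  apply: filter_app; near=> h => fgh.
  by rewrite /= !fctE /= fgh.
apply/diff_locallyP; rewrite (diff_unique _ hd); last exact: diff_continuous.
by split => //; exact: diff_continuous.
Unshelve. all: by end_near. Qed.

Lemma open_near V (U : set V) x : open U -> U x -> \near x, U x.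
Proof. by move=> oU Ux; exact: open_nbhs_nbhs. Qed.

Lemma near_open_eq (T : Type) V (U : set V) (f g : V -> T) x : open U -> (forall x, U x -> f x = g x) ->
  U x -> \near x, f x = g x.
Proof. by move=> oU fg Ux; apply: filterS (open_near oU Ux) => y /fg. Qed.

(** Openness of U is what allows a C^k function to be changed outside U. *)
Lemma Ck_on_eq k V W (U : set V) (f g : V -> W) : open U ->
  (forall x, U x -> f x = g x) -> Ck_on k U f -> Ck_on k U g.
Proof.
move=> oU; elim: k f g => [|k IH] f g fg /=.
  move=> cf x Ux; have nfg := near_open_eq oU fg Ux.
  have h : f @ x --> f x := cf _ Ux.
  rewrite (fg _ Ux) in h.
  by apply: cvg_trans h; exact: near_eq_cvg.
case=> df Df; split=> [x Ux|v].
  exact: near_eq_differentiable (near_open_eq oU fg Ux) (df _ Ux).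
apply: IH (Df v) => x Ux; apply: near_eq_derive.
exact: near_open_eq oU fg Ux.
Qed.

Lemma Ck_on_le k V W (U : set V) (f : V -> W) : Ck_on k.+1 U f -> Ck_on k U f.
Proof.
elim: k f => [|k IH] f /= [df Df].
  by move=> x Ux; exact: differentiable_continuous (df _ Ux).
by split=> // v; apply: IH; exact: Df.
Qed.

Lemma Ck_on_sub k V W (U U' : set V) (f : V -> W) : U' `<=` U -> Ck_on k U f -> Ck_on k U' f.
Proof.
move=> UU; elim: k f => [|k IH] f /=; first by move=> h x /UU; exact: h.
by case=> df Df; split=> [x /UU/df//|v]; apply: IH.
Qed.

Lemma Ck_on_cst k V W (U : set V) (w : W) : Ck_on k U (fun _ : V => w).
Proof.
elim: k w => [|k IH] w /=; first by move=> x _; exact: cvg_cst.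
split=> [x _|v]; first exact: differentiable_cst.
have -> : (fun x : V => 'D_v (fun _ : V => w) x) = (fun _ => 0).
  by apply/funext => x; exact: derive_cst.
exact: IH.
Qed.

Lemma Ck_onD k V W (U : set V) (f g : V -> W) : open U ->
  Ck_on k U f -> Ck_on k U g -> Ck_on k U (fun x => f x + g x).
Proof.
move=> oU; elim: k f g => [|k IH] f g /=.
  by move=> cf cg x Ux; apply: cvgD; [exact: cf|exact: cg].
case=> df Df [dg Dg]; split=> [x Ux|v].
  by apply: differentiableD; [exact: df|exact: dg].
apply: Ck_on_eq (IH _ _ (Df v) (Dg v)) => // x Ux.
by rewrite deriveD //; apply: diff_derivable; [exact: df|exact: dg].
Qed.

Lemma derive_linear V W W' (L : {linear W -> W'}) (f : V -> W) x v :
  continuous L -> differentiable f x -> 'D_v (L \o f) x = L ('D_v f x).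
Proof.
move=> cL df; have dL : differentiable L (f x) by exact: linear_differentiable.
rewrite !deriveE //; last exact: differentiable_comp.
by rewrite diff_comp //= diff_lin.
Qed.

Lemma Ck_on_linear k V W W' (L : {linear W -> W'}) (U : set V) (f : V -> W) :
  continuous L -> open U -> Ck_on k U f -> Ck_on k U (L \o f).
Proof.
move=> cL oU; elim: k f => [|k IH] f /=.
  by move=> cf x Ux; apply: continuous_comp; [exact: cf|exact: cL].
case=> df Df; split=> [x Ux|v].
  by apply: differentiable_comp; [exact: df|exact: linear_differentiable].
apply: Ck_on_eq (IH _ (Df v)) => // x Ux /=.
by rewrite derive_linear //; exact: df.
Qed.

Lemma Ck_onM k V (U : set V) (f g : V -> R^o) : open U ->
  Ck_on k U f -> Ck_on k U g -> Ck_on k U (fun x => f x * g x : R^o).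
Proof.
move=> oU; elim: k f g => [|k IH] f g.
  by move=> cf cg x Ux; apply: cvgM; [exact: cf|exact: cg].
move=> cf cg; case: (cf) (cg) => df Df [dg Dg]; split=> [x Ux|v].
  by apply: differentiableM; [exact: df|exact: dg].
have h := Ck_onD oU (IH _ _ (Ck_on_le cf) (Dg v)) (IH _ _ (Df v) (Ck_on_le cg)).
apply: Ck_on_eq h => // x Ux.
rewrite (deriveM (diff_derivable (df _ Ux)) (diff_derivable (dg _ Ux))).
by congr (_ + _); exact: mulrC.
Qed.

Lemma derive_comp1 V (F : R -> R) (dF : R) (f : V -> R^o) x v :
  is_derive (f x) 1 F dF -> differentiable f x ->
  differentiable (F \o f : V -> R^o) x /\ 'D_v (F \o f : V -> R^o) x = dF * 'D_v f x.
Proof.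
move=> [ex dFE] df; have dF' : differentiable F (f x) by apply/derivable1_diffP.
split; first exact: differentiable_comp.
rewrite !deriveE //; last exact: differentiable_comp.
rewrite diff_comp //= diff1E // derive1E dFE.
by rewrite mulrC.
Qed.

(** The hypothesis on dF is only required one order lower, so that F = exp, sqrt
    or the inverse can be treated by induction on k. *)
Lemma Ck_on_comp1 k V (U : set V) (F dF : R -> R) (f : V -> R^o) : open U ->
  (forall x, U x -> is_derive (f x) 1 F (dF (f x))) -> Ck_on k U f ->
  (forall j, j.+1 = k -> Ck_on j U (dF \o f : V -> R^o)) ->
  Ck_on k U (F \o f : V -> R^o).
Proof.
move=> oU dFf; case: k => [|k] cf cdF.
  move=> x Ux; apply: continuous_comp; first exact: cf.
  have [ex _] := dFf _ Ux.
  by apply: differentiable_continuous; apply/derivable1_diffP.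
have [df Df] := cf; split=> [x Ux|v].
  by have [] := derive_comp1 0 (dFf _ Ux) (df _ Ux).
have h := Ck_onM oU (cdF _ erefl) (Df v).
apply: Ck_on_eq h => // x Ux.
by have [_ ->] := derive_comp1 v (dFf _ Ux) (df _ Ux).
Qed.

Lemma is_derive1_inv (x : R) : x != 0 -> is_derive x 1 (fun y => y^-1) (- (x^-1 * x^-1)).
Proof.
move=> x0; split; first by apply: (@derivableV _ _ id) => //; exact: derivable_id.
have -> := @deriveV _ _ id x 1 x0 (@derivable_id _ _ x 1).
by rewrite derive_id /= [LHS]mulr1 expr2 invfM.
Qed.

Lemma Ck_onV k V (U : set V) (f : V -> R^o) : open U ->
  (forall x, U x -> f x != 0) -> Ck_on k U f -> Ck_on k U (fun x => (f x)^-1 : R^o).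
Proof.
move=> oU f0.
have hd x : U x -> is_derive (f x) 1 (fun y => y^-1) (- ((f x)^-1 * (f x)^-1)).
  by move=> Ux; apply: is_derive1_inv; exact: f0.
elim: k => [|k IH] cf;
  apply: (@Ck_on_comp1 _ _ _ _ (fun x => - (x^-1 * x^-1)) _ oU hd cf) => // j [->].
have h := Ck_onM oU (Ck_on_cst k U (-1 : R^o)) (Ck_onM oU (IH (Ck_on_le cf)) (IH (Ck_on_le cf))).
by apply: Ck_on_eq h => // x Ux /=; rewrite mulN1r.
Qed.

Lemma Ck_on_sqrt k V (U : set V) (f : V -> R^o) : open U ->
  (forall x, U x -> 0 < f x) -> Ck_on k U f ->
  Ck_on k U (fun x => Num.sqrt (f x) : R^o).
Proof.
move=> oU f0.
have hd x : U x -> is_derive (f x) 1 Num.sqrt (2 * Num.sqrt (f x))^-1.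
  by move=> Ux; apply: is_derive1_sqrt; exact: f0.
elim: k => [|k IH] cf;
  apply: (@Ck_on_comp1 _ _ _ _ (fun x => (2 * Num.sqrt x)^-1) _ oU hd cf) => // j [->].
apply: Ck_onV => // [x Ux|].
  by rewrite /= mulf_neq0 // sqrtr_eq0 -ltNge f0.
exact: (Ck_onM oU (Ck_on_cst k U (2 : R^o)) (IH (Ck_on_le cf))).
Qed.

Lemma Ck_on_ln k V (U : set V) (f : V -> R^o) : open U ->
  (forall x, U x -> 0 < f x) -> Ck_on k U f ->
  Ck_on k U (fun x => ln (f x) : R^o).
Proof.
move=> oU f0 cf.
apply: (@Ck_on_comp1 _ _ _ _ (fun x => x^-1)) => // [x Ux|j jk].
  by apply: is_derive1_ln; exact: f0.
apply: Ck_onV => // [x Ux|]; first by rewrite gt_eqF // f0.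
by rewrite -jk in cf; exact: Ck_on_le cf.
Qed.

Lemma Ck_on_exp k V (U : set V) (f : V -> R^o) : open U ->
  Ck_on k U f -> Ck_on k U (fun x => expR (f x) : R^o).
Proof.
move=> oU; elim: k => [|k IH] cf;
  apply: (@Ck_on_comp1 _ _ _ _ expR) => // j [->].
exact: IH (Ck_on_le cf).
Qed.

Lemma Ck_on_sum k V W (U : set V) (I : Type) (r : seq I) (g : I -> V -> W) : open U ->
  (forall i, Ck_on k U (g i)) -> Ck_on k U (fun x => \sum_(i <- r) g i x).
Proof.
move=> oU cg; elim: r => [|i r IH].
  by apply: (Ck_on_eq oU _ (Ck_on_cst k U 0)) => x _; rewrite big_nil.
by apply: (Ck_on_eq oU _ (Ck_onD oU (cg i) IH)) => x _; rewrite big_cons.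
Qed.

Lemma Ck_on_scalel k V W (U : set V) (f : V -> R^o) (w : W) : open U ->
  Ck_on k U f -> Ck_on k U (fun x => f x *: w).
Proof.
move=> oU cf.
have lin : linear (fun a : R^o => a *: w).
  by move=> a x y; rewrite scalerDl scalerA.
pose L : {linear R^o -> W} :=
  HB.pack (fun a : R^o => a *: w) (GRing.isLinear.Build _ _ _ _ _ lin).
apply: (@Ck_on_linear k _ _ _ L U f) => //.
exact: scalel_continuous.
Qed.

(** A matrix-valued map is the sum of its entries times the elementary matrices. *)
Lemma Ck_on_mx k V m n (U : set V) (f : V -> 'M[R]_(m.+1, n.+1)) : open U ->
  (forall i j, Ck_on k U (fun x => f x i j : R^o)) -> Ck_on k U f.
Proof.
move=> oU cf.
have h : Ck_on k U (fun x => \sum_i \sum_j f x i j *: (delta_mx i j : 'M[R]_(m.+1, n.+1))).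
  apply: Ck_on_sum => // i; apply: Ck_on_sum => // j.
  exact: Ck_on_scalel.
by apply: Ck_on_eq h => // x _; rewrite -matrix_sum_delta.
Qed.

Lemma Ck_on_pair k V W W' (U : set V) (f : V -> W) (g : V -> W') : open U ->
  Ck_on k U f -> Ck_on k U g -> Ck_on k U (fun x => (f x, g x)).
Proof.
move=> oU; elim: k f g => [|k IH] f g /=.
  by move=> cf cg x Ux; apply: cvg_pair; [exact: cf|exact: cg].
case=> df Df [dg Dg]; split=> [x Ux|v].
  by apply: differentiable_pair; [exact: df|exact: dg].
apply: Ck_on_eq (IH _ _ (Df v) (Dg v)) => // x Ux.
have hf := df _ Ux; have hg := dg _ Ux.
by rewrite !deriveE //; [rewrite diff_pair|exact: differentiable_pair].
Qed.

Lemma Ck_on_fst k V W W' (U : set V) (f : V -> (W * W')%type) : open U ->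
  Ck_on k U f -> Ck_on k U (fun x => (f x).1).
Proof.
move=> oU cf; apply: (@Ck_on_linear k _ _ _ (fst : {linear (W * W')%type -> W}) U f) => //.
by move=> x; exact: cvg_fst.
Qed.

Lemma Ck_on_snd k V W W' (U : set V) (f : V -> (W * W')%type) : open U ->
  Ck_on k U f -> Ck_on k U (fun x => (f x).2).
Proof.
move=> oU cf; apply: (@Ck_on_linear k _ _ _ (snd : {linear (W * W')%type -> W'}) U f) => //.
by move=> x; exact: cvg_snd.
Qed.

Lemma Ck_on_coord k V m n (U : set V) (f : V -> 'M[R]_(m.+1, n.+1)) i j : open U ->
  Ck_on k U f -> Ck_on k U (fun x => f x i j : R^o).
Proof.
move=> oU cf.
have lin : linear (fun M : 'M[R]_(m.+1, n.+1) => M i j : R^o).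
  by move=> a x y; rewrite !mxE.
pose L : {linear 'M[R]_(m.+1, n.+1) -> R^o} :=
  HB.pack (fun M : 'M[R]_(m.+1, n.+1) => M i j : R^o) (GRing.isLinear.Build _ _ _ _ _ lin).
apply: (@Ck_on_linear k _ _ _ L U f) => //.
exact: coord_continuous.
Qed.

Lemma Ck_on_id k V (U : set V) : Ck_on k U (fun x => x).
Proof.
case: k => [|k] /=; first by move=> x _; exact: cvg_id.
split=> [x _|v]; first by apply: (@linear_differentiable _ _ _ (idfun : {linear V -> V})) => y; exact: cvg_id.
by rewrite (_ : (fun x => _) = fun _ => v); [exact: Ck_on_cst|apply/funext => x; exact: derive_id].
Qed.

End CkClosure.

(** * Mean values, locally constant functions and symmetric second derivatives *)

Lemma close_close (R : realFieldType) (x y z e : R) :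
  `|x - z| < e / 2 -> `|y - z| < e / 2 -> `|x - y| <= e.
Proof.
rewrite (distrC y) => xz yz; rewrite -(subrKA z) [e]splitr.
by apply: (le_trans (ler_normD _ _)); apply: lerD; apply: ltW.
Qed.

Section MeanValue.
Context (R : realType).
Implicit Types V : normedModType R.

Lemma is_derive_line V (f : V -> R^o) (u v : V) (t : R) :
  differentiable f (u + t *: v) ->
  is_derive t 1 (fun s : R => f (u + s *: v) : R) ('D_v f (u + t *: v)).
Proof.
move=> df.
have E : (fun h : R => h^-1 *: (f (u + (h *: 1 + t) *: v) - f (u + t *: v))) =
         (fun h : R => h^-1 *: (f (h *: v + (u + t *: v)) - f (u + t *: v))).
  by apply/funext => h; rewrite scalerDl addrCA addrA [h *: 1]mulr1 addrA.
have hd := diff_derivable (v := v) df.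
split; first by rewrite /derivable /= E.
by rewrite /derive /= E.
Qed.

(** The mean value theorem for t |-> f (u + t v). *)
Lemma mean_value_line V (f : V -> R^o) (u v : V) (h : R) : 0 < h ->
  (forall t, 0 <= t <= h -> differentiable f (u + t *: v)) ->
  exists2 t, 0 < t < h & f (u + h *: v) - f u = h * 'D_v f (u + t *: v).
Proof.
move=> h0 df.
have hd (t : R) : 0 <= t <= h -> is_derive t 1 (fun s : R => f (u + s *: v) : R) ('D_v f (u + t *: v)).
  by move=> /df; exact: is_derive_line.
have hd' t : t \in `]0, h[%R ->
    is_derive t 1 (fun s : R => f (u + s *: v) : R) ('D_v f (u + t *: v)).
  by rewrite in_itv /= => /andP[t0 th]; apply: hd; rewrite !ltW.
have hc : {within `[0, h], continuous (fun s : R => f (u + s *: v) : R)}.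
  by apply: derivable_within_continuous => t; rewrite in_itv /= => /hd [].
have [t] := MVT h0 hd' hc.
rewrite in_itv /= scale0r addr0 subr0 mulrC => th ft; by exists t.
Qed.

(** On a ball the segment from u to x stays inside U, and the mean value theorem
    applies along it. *)
Lemma derive0_locally_cst V (U : set V) (f : V -> R^o) u : open U -> U u ->
  (forall x, U x -> differentiable f x /\ forall v, 'D_v f x = 0) ->
  \forall x \near u, f x = f u.
Proof.
move=> oU Uu df.
have [e /= e0 eU] := (nbhs_ballP _ _).1 (open_near oU Uu).
apply/nbhs_ballP; exists e => //= x; rewrite -ball_normE /= => xe.
have inU t : 0 <= t <= 1 -> U (u + t *: (x - u)).
  move=> /andP[t0 t1]; apply: eU; rewrite -ball_normE /= opprD addrA subrr sub0r normrN normrZ.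
  apply: le_lt_trans xe; rewrite distrC ger0_norm //.
  by rewrite -[leRHS]mul1r ler_wpM2r.
have [|t /andP[t0 t1]] := @mean_value_line V f u (x - u) 1 ltr01.
  by move=> t /inU /df [].
rewrite scale1r (addrC u) subrK mul1r => /eqP.
rewrite (df _ (inU _ _)).2 ?subr_eq0; last by rewrite !ltW.
by move=> /eqP.
Qed.

Section Clairaut.
Context (V : normedModType R) (U : set V) (f : V -> R^o) (u : V).
Hypothesis oU : open U.
Hypothesis Uu : U u.
Hypothesis cf : Ck_on 2 U f.

Let df x : U x -> differentiable f x. Proof. by case: cf => + _; apply. Qed.
Let ddf v x : U x -> differentiable ('D_v f : V -> R^o) x.
Proof. by case: cf => _ /(_ v) [+ _]; apply. Qed.

(** The second difference of f over a parallelogram, evaluated by two applications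
    of the mean value theorem, first in the direction v and then in w. *)
Lemma second_difference (v w : V) (h : R) : 0 < h ->
  (forall a b, 0 <= a <= h -> 0 <= b <= h -> U (u + a *: v + b *: w)) ->
  exists a b, [/\ 0 < a < h, 0 < b < h &
   (f (u + h *: v + h *: w) - f (u + h *: v)) - (f (u + h *: w) - f u) =
   h * (h * 'D_w ('D_v f : V -> R^o) (u + a *: v + b *: w))].
Proof.
move=> h0 inU.
have hh : 0 <= h <= h by rewrite lexx (ltW h0).
have h00 : (0 : R) <= (0 : R) <= h by rewrite lexx (ltW h0).
have dshift x : U (x + h *: w) -> differentiable (fun x => f (x + h *: w) : R^o) x.
  move=> Ux; apply: (@differentiable_comp _ _ _ _ (fun x => x + h *: w) f); last exact: df.
  by apply: differentiableD => //; exact: differentiable_cst.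
have Dshift x : U (x + h *: w) -> 'D_v (fun x => f (x + h *: w) : R^o) x = 'D_v f (x + h *: w).
  move=> Ux; apply: (congr1 (fun phi : R -> R^o => lim (phi @ 0^'))).
  by apply/funext => k /=; rewrite addrA.
have [|a /andP[a0 ah] E] := @mean_value_line V (fun x => f (x + h *: w) - f x) u v h h0.
  move=> t ht; apply: differentiableB; first exact: dshift (inU t h ht hh).
  by apply: df; rewrite -[X in U X]addr0 -(scale0r w); exact: (inU t 0 ht h00).
have aU : 0 <= a <= h by rewrite !ltW.
have [|b hb E2] := @mean_value_line V ('D_v f) (u + a *: v) w h h0.
  by move=> t ht; apply: ddf; exact: (inU a t aU ht).
exists a, b; split=> //; first by rewrite a0.
rewrite -E2 E; congr (_ * _).
have U1 := inU a h aU hh.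
have U2 : U (u + a *: v) by rewrite -[X in U X]addr0 -(scale0r w); exact: (inU a 0 aU h00).
rewrite (@deriveB _ _ _ (fun x => f (x + h *: w) : R^o) f).
- by rewrite Dshift.
- exact/diff_derivable/dshift.
- exact/diff_derivable/df.
Qed.

End Clairaut.

(** The second difference is symmetric in v and w; let the parallelogram shrink to
    the point u and use continuity of the second derivatives. *)
Lemma clairaut V (U : set V) (f : V -> R^o) u (v w : V) : open U -> U u ->
  Ck_on 2 U f ->
  'D_w ('D_v f : V -> R^o) u = 'D_v ('D_w f : V -> R^o) u.
Proof.
move=> oU Uu cf; apply/eqP; rewrite -subr_eq0 -normr_le0; apply/ler_addgt0Pl => e e0.
rewrite addr0.
have ccont v' w' : {for u, continuous ('D_w' ('D_v' f : V -> R^o) : V -> R^o)}.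
  by case: cf => _ /(_ v') [_ /(_ w')]; apply.
have e20 : 0 < e / 2 by rewrite divr_gt0.
have [d1 /= d10 h1] := (nbhs_ballP _ _).1 ((cvgrPdist_lt _ _).1 (ccont v w) _ e20).
have [d2 /= d20 h2] := (nbhs_ballP _ _).1 ((cvgrPdist_lt _ _).1 (ccont w v) _ e20).
have [d3 /= d30 h3] := (nbhs_ballP _ _).1 (open_near oU Uu).
pose d := Num.min d1 (Num.min d2 d3).
have d0 : 0 < d by rewrite !lt_min d10 d20.
pose N := `|v| + `|w| + 1.
have N0 : 0 < N by rewrite ltr_wpDl // addr_ge0.
pose h := d / N / 2.
have h0 : 0 < h by rewrite !divr_gt0.
have hN : h * (`|v| + `|w|) < d.
  have : h * N < d by rewrite /h mulrAC divfK ?gt_eqF // ltr_pdivrMr // mulr_natr mulr2n ltrDl.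
  apply: le_lt_trans; rewrite ler_wpM2l ?(ltW h0) // lerDl //.
have near a b : 0 <= a <= h -> 0 <= b <= h -> `|u - (u + a *: v + b *: w)| < d.
  move=> /andP[a0 ah] /andP[b0 bh]; apply: le_lt_trans hN.
  rewrite -addrA opprD addrA subrr sub0r normrN.
  apply: (le_trans (ler_normD _ _)); rewrite !normrZ !ger0_norm // mulrDr.
  by rewrite lerD // ler_wpM2r.
have near' a b : 0 <= a <= h -> 0 <= b <= h -> `|u - (u + a *: w + b *: v)| < d.
  by move=> ha hb; rewrite addrAC; exact: near.
have inU a b : 0 <= a <= h -> 0 <= b <= h -> U (u + a *: v + b *: w).
  move=> /near H /H {}H; apply: h3; rewrite -ball_normE /=.
  by apply: lt_le_trans H _; rewrite /d !ge_min lexx !orbT.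
have inU' a b : 0 <= a <= h -> 0 <= b <= h -> U (u + a *: w + b *: v).
  by move=> ha hb; rewrite addrAC; exact: inU.
have [a [b [ha hb E]]] := second_difference cf h0 inU.
have [a' [b' [ha' hb' E']]] := second_difference cf h0 inU'.
have {E E'} EE : 'D_w ('D_v f : V -> R^o) (u + a *: v + b *: w) = 'D_v ('D_w f : V -> R^o) (u + a' *: w + b' *: v).
  have hn0 : h != 0 by rewrite gt_eqF.
  have sw (p q r s : R) : p - q - (r - s) = p - r - (q - s) by ring.
  rewrite [in LHS](addrAC u) sw in E.
  by move: (etrans (esym E) E') => /(mulfI hn0)/(mulfI hn0).
have cl x : 0 < x < h -> 0 <= x <= h by move=> /andP[? ?]; rewrite !ltW.
have A : `|'D_w ('D_v f : V -> R^o) u - 'D_w ('D_v f : V -> R^o) (u + a *: v + b *: w)| < e / 2.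
  apply: h1; rewrite -ball_normE /=; apply: lt_le_trans (near _ _ (cl _ ha) (cl _ hb)) _.
  by rewrite ge_min lexx.
have B : `|'D_v ('D_w f : V -> R^o) u - 'D_v ('D_w f : V -> R^o) (u + a' *: w + b' *: v)| < e / 2.
  apply: h2; rewrite -ball_normE /=; apply: lt_le_trans (near' _ _ (cl _ ha') (cl _ hb')) _.
  by rewrite !ge_min lexx !orbT.
rewrite EE in A.
exact: close_close A B.
Qed.
End MeanValue.

(** * The differential ring of smooth functions on an open set of the plane *)

(** Open sets are bundled so that they can parametrize a type with a ring structure. *)
Record plane_open (R : realType) := PlaneOpen {
  plane_set : set 'rV[R]_2;
  plane_open_open : open plane_set
}.

Section SmoothRing.
Context (R : realType) (U : plane_open R).
Local Notation V := (plane_set U).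
Let oU : open V := @plane_open_open R U.

(** Smooth functions on U are extended by 0, so that extensional equality on U
    becomes equality and the ring axioms hold without quotients. *)
Definition smooth_fun : {pred 'rV[R]_2 -> R} :=
  fun g => `[< smooth_on V (g : 'rV[R]_2 -> R^o) /\ forall u, ~ V u -> g u = 0 >].

Fact smooth_fun_zmod : zmod_closed smooth_fun.
Proof.
split=> [|f g /asboolP[sf f0] /asboolP[sg g0]]; apply/asboolP; split.
- by move=> k; exact: Ck_on_cst.
- by [].
- move=> k; have h := Ck_onD oU (sf k) (Ck_onM oU (Ck_on_cst k V (-1 : R^o)) (sg k)).
  by apply: Ck_on_eq h => // u _; rewrite mulN1r.
by move=> u Uu; rewrite /GRing.opp /GRing.add /= f0 // g0 // subr0.
Qed.
HB.instance Definition _ := GRing.isZmodClosed.Build _ smooth_fun smooth_fun_zmod.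

Record sm := Sm { sm_val :> 'rV[R]_2 -> R; sm_valP : sm_val \in smooth_fun }.
HB.instance Definition _ := [isSub for sm_val].
HB.instance Definition _ := [Choice of sm by <:].
HB.instance Definition _ := [SubChoice_isSubZmodule of sm by <:].

Lemma sm_smooth (g : sm) : smooth_on V (g : 'rV[R]_2 -> R^o).
Proof. by have /asboolP[] := sm_valP g. Qed.

Lemma sm_out (g : sm) u : ~ V u -> g u = 0.
Proof. by have /asboolP[_] := sm_valP g; apply. Qed.

Lemma smP (f g : sm) : (forall u, V u -> f u = g u) -> f = g.
Proof.
move=> fg; apply/val_inj/funext => u.
change (f u = g u).
by have [/fg//|nU] := pselect (V u); rewrite !sm_out.
Qed.

Definition mask (g : 'rV[R]_2 -> R) : 'rV[R]_2 -> R := fun u => if `[< V u >] then g u else 0.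

Lemma maskE g u : V u -> mask g u = g u.
Proof. by move=> Uu; rewrite /mask asboolT. Qed.

Fact mask_smooth g : smooth_on V (g : 'rV[R]_2 -> R^o) -> mask g \in smooth_fun.
Proof.
move=> sg; apply/asboolP; split=> [k|u nU]; last by rewrite /mask asboolF.
by apply: Ck_on_eq (sg k) => // u Uu; rewrite maskE.
Qed.

Definition mk g (sg : smooth_on V (g : 'rV[R]_2 -> R^o)) : sm := Sm (mask_smooth sg).

Lemma mkE g sg u : V u -> @mk g sg u = g u.
Proof. exact: maskE. Qed.

Fact smooth_cst (a : R) : smooth_on V (fun _ : 'rV[R]_2 => a : R^o).
Proof. by move=> k; exact: Ck_on_cst. Qed.

Definition sm_cst (a : R) : sm := mk (smooth_cst a).

Fact smoothM (f g : sm) : smooth_on V (fun u => f u * g u : R^o).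
Proof. by move=> k; apply: Ck_onM => //; exact: sm_smooth. Qed.

Definition sm_mul (f g : sm) : sm := mk (smoothM f g).

Lemma sm_mulE f g u : sm_mul f g u = f u * g u.
Proof.
have [Uu|nU] := pselect (V u); first by rewrite mkE.
by rewrite !sm_out // mulr0.
Qed.

Lemma evD (f g : sm) u : (f + g) u = f u + g u. Proof. by []. Qed.
Lemma evN (f : sm) u : (- f) u = - f u. Proof. by []. Qed.

Fact sm_mulA : associative sm_mul.
Proof. by move=> f g h; apply: smP => u _; rewrite !sm_mulE mulrA. Qed.
Fact sm_mulC : commutative sm_mul.
Proof. by move=> f g; apply: smP => u _; rewrite !sm_mulE mulrC. Qed.
Fact sm_mul1 : left_id (sm_cst 1) sm_mul.
Proof. by move=> f; apply: smP => u Uu; rewrite !sm_mulE mkE // mul1r. Qed.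
Fact sm_mulDl : left_distributive sm_mul +%R.
Proof. by move=> f g h; apply: smP => u Uu; rewrite evD !sm_mulE evD mulrDl. Qed.
HB.instance Definition _ :=
  GRing.Zmodule_isComPzRing.Build sm sm_mulA sm_mulC sm_mul1 sm_mulDl.

Lemma evM (f g : sm) u : (f * g) u = f u * g u. Proof. exact: sm_mulE. Qed.
Lemma ev0 u : (0 : sm) u = 0. Proof. by []. Qed.
Lemma ev_cst a u : V u -> sm_cst a u = a. Proof. exact: mkE. Qed.
Lemma ev1 u : V u -> (1 : sm) u = 1. Proof. exact: ev_cst. Qed.
Lemma ev_nat n u : V u -> (n%:R : sm) u = n%:R.
Proof. by move=> Uu; elim: n => [|n IH] //; rewrite -natr1 evD IH ev1 // natr1. Qed.
Lemma evX (f : sm) n u : V u -> (f ^+ n) u = f u ^+ n.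
Proof. by move=> Uu; elim: n => [|n IH]; rewrite ?ev1 // !exprS evM IH. Qed.

(** Allows integer factors to be cancelled in ring identities. *)
Lemma sm_torsion_free n (f : sm) : n.+1%:R * f = 0 -> f = 0.
Proof.
move=> nf; apply: smP => u Uu; have := congr1 (fun g : sm => g u) nf.
by rewrite evM ev_nat // ev0 => /eqP; rewrite mulf_eq0 pnatr_eq0 /= => /eqP.
Qed.

Lemma sm_inv (f : sm) : (forall u, V u -> f u != 0) -> exists g : sm, f * g = 1.
Proof.
move=> f0.
have sg : smooth_on V (fun u => (f u)^-1 : R^o).
  by move=> k; apply: Ck_onV => //; exact: sm_smooth.
exists (mk sg); apply: smP => u Uu.
by rewrite evM mkE // ev1 // divff // f0.
Qed.

Lemma sm_sqrt (f : sm) : (forall u, V u -> 0 < f u) ->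
  exists g : sm, g ^+ 2 = f /\ forall u, V u -> 0 < g u.
Proof.
move=> f0.
have sg : smooth_on V (fun u => Num.sqrt (f u) : R^o).
  by move=> k; apply: Ck_on_sqrt => //; exact: sm_smooth.
exists (mk sg); split=> [|u Uu]; last by rewrite mkE // sqrtr_gt0 f0.
by apply: smP => u Uu; rewrite evX // mkE // sqr_sqrtr // ltW // f0.
Qed.

(** One derivative is lost, which smoothness of all orders absorbs. *)
Fact smooth_partial i (g : 'rV[R]_2 -> R^o) : smooth_on V g ->
  smooth_on V (partial i g : _ -> R^o).
Proof. by move=> sg k; case: (sg k.+1) => _; apply. Qed.

Lemma smooth_differentiable (W : normedModType R) (g : 'rV[R]_2 -> W) u :
  smooth_on V g -> V u -> differentiable g u.
Proof. by move=> /(_ 1%N)[+ _]; apply. Qed.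

Definition pd i (g : sm) : sm := mk (smooth_partial i (sm_smooth g)).

Lemma pdE i (g : sm) u : V u -> pd i g u = partial i (g : _ -> R^o) u.
Proof. by move=> Uu; rewrite mkE. Qed.

Lemma eq_partial (W : normedModType R) i (f g : 'rV[R]_2 -> W) u :
  (forall u, V u -> f u = g u) -> V u -> partial i f u = partial i g u.
Proof. by move=> fg Uu; apply: near_eq_derive; exact: near_open_eq oU fg Uu. Qed.

Lemma pd_mk i g sg u : V u -> pd i (@mk g sg) u = partial i (g : _ -> R^o) u.
Proof. by move=> Uu; rewrite pdE //; apply: eq_partial => // v Uv; rewrite mkE. Qed.

Lemma pd_derivation i : derivation (pd i).
Proof.
split=> f g; apply: smP => u Uu; rewrite ?(evD, evM) !pdE // /partial.
  rewrite -deriveD //; apply: diff_derivable; exact: smooth_differentiable (sm_smooth _) _.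
have [df dg] : differentiable (f : _ -> R^o) u /\ differentiable (g : _ -> R^o) u.
  by split; exact: smooth_differentiable (sm_smooth _) _.
have -> : 'D_(delta_mx 0 i) (f * g : sm) u = 'D_(delta_mx 0 i) ((f : _ -> R) * (g : _ -> R)) u.
  apply: (congr1 (fun h : _ -> R^o => 'D_(delta_mx 0 i) h u)).
  by apply/funext => v; rewrite evM.
rewrite deriveM; [|exact: diff_derivable|exact: diff_derivable].
by rewrite addrC; congr (_ + _); rewrite /GRing.scale /= mulrC.
Qed.

(** The reason for building the ring: two commuting derivations. *)
Lemma pdC i j (g : sm) : pd i (pd j g) = pd j (pd i g).
Proof.
have h k l u : V u -> pd k (pd l g) u = partial k (partial l (g : _ -> R^o) : _ -> R^o) u.
  by move=> Uu; rewrite pd_mk.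
apply: smP => u Uu; rewrite (h i j u Uu) (h j i u Uu).
exact: (@clairaut R _ V (g : _ -> R^o) u (delta_mx 0 j) (delta_mx 0 i) oU Uu (sm_smooth g 2)).
Qed.

Lemma pd_cst i a : pd i (sm_cst a) = 0.
Proof. by apply: smP => u Uu; rewrite pd_mk // /partial derive_cst. Qed.

Lemma pd0_locally_cst (g : sm) u : V u -> (forall i, pd i g = 0) ->
  \forall v \near u, g v = g u.
Proof.
move=> Uu g0; apply: (@derive0_locally_cst _ _ V (g : _ -> R^o)) => // v Uv.
have dg : differentiable (g : _ -> R^o) v by exact: smooth_differentiable (sm_smooth _) _.
split=> // w; rewrite deriveE // [w]row_sum_delta linear_sum big1 // => i _.
rewrite linearZ /= -deriveE //.
have := congr1 (fun g : sm => g v) (g0 i); rewrite pdE // /partial ev0 => ->.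
by rewrite scaler0.
Qed.

End SmoothRing.

(** Replaces the values of smooth functions by variables, so that [ring] and
    [field] see atoms. *)
Ltac gen_ev := repeat match goal with |- context [@sm_val ?R ?V ?f ?u] => generalize (@sm_val R V f u) end.

(** Evaluation at a point of U is a ring morphism.  The rules are selected by
    syntactic matching because unification up to conversion would unfold the ring
    operations. *)
Ltac push_ev := repeat match goal with
  | |- context [@sm_val ?R ?V (?f * ?g) ?u] => rewrite (@evM R V f g u)
  | |- context [@sm_val ?R ?V (?f + ?g) ?u] => rewrite (@evD R V f g u)
  | |- context [@sm_val ?R ?V (- ?f) ?u] => rewrite (@evN R V f u)
  | H : plane_set ?V ?u |- context [@sm_val ?R ?V (?f ^+ ?n) ?u] => rewrite (@evX R V f n u H)
  | H : plane_set ?V ?u |- context [@sm_val ?R ?V (?n %:R) ?u] => rewrite (@ev_nat R V n u H)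
  | H : plane_set ?V ?u |- context [@sm_val ?R ?V 1 ?u] => rewrite (@ev1 R V u H)
  | H : plane_set ?V ?u |- context [@sm_val ?R ?V 0 ?u] => rewrite (@ev0 R V u)
  | H : plane_set ?V ?u |- context [@sm_val ?R ?V (sm_cst ?V ?a) ?u] => rewrite (@ev_cst R V a u H)
  end.

(** * The horospherical frame of the hyperbolic plane *)

Section Hyperbolic.
Context (A : comPzRingType) (I : Type) (d : I -> A -> A).
Hypothesis hd : forall i, derivation (d i).
Hypothesis dC : forall i j x, d i (d j x) = d j (d i x).
Context (x : 'I_3 -> A) (Y : A).
Hypothesis xH : - (x 0 * x 0) + x 1 * x 1 + x 2 * x 2 = -1.
Hypothesis k_inv : (x 0 - x 1) * Y = 1.

Let k := x 0 - x 1.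
Let kY : k * Y = 1. Proof. exact: k_inv. Qed.
Let X := x 2 * Y.
Definition hyp_P i : A := d i Y * k.
Definition hyp_Q i : A := d i X * k.
Definition hyp_M1 (m : 'I_3) : A := nth 0 [:: Y - x 0; Y - x 1; - x 2] m.
Definition hyp_M2 (m : 'I_3) : A := nth 0 [:: X; X; 1] m.

Let dk i : d i k = - k * hyp_P i.
Proof.
have h := congr1 (d i) kY; rewrite -/k (derM (hd i)) (der1 (hd i)) in h.
transitivity (d i k * (k * Y)); first by rewrite kY mulr1.
transitivity (k * (d i k * Y + k * d i Y) - k * (d i Y * k)); first by ring.
by rewrite h /hyp_P; ring.
Qed.

Let dY i : d i Y = Y * hyp_P i.
Proof.
by transitivity (d i Y * (k * Y)); [rewrite kY mulr1|rewrite /hyp_P; ring].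
Qed.

Let dX i : d i X = Y * hyp_Q i.
Proof. by transitivity (d i X * (k * Y)); [rewrite kY mulr1|rewrite /hyp_Q; ring]. Qed.

Let x2 : x 2 = X * k.
Proof. by rewrite /X -mulrA (mulrC Y) kY mulr1. Qed.

Let x01 : x 0 + x 1 = Y + X * X * k.
Proof.
transitivity ((x 0 + x 1) * (k * Y)); first by rewrite kY mulr1.
have -> : X * X * k = x 2 * x 2 * Y.
  by transitivity (x 2 * x 2 * Y * (k * Y)); [rewrite /X|rewrite kY]; ring.
have e : x 2 * x 2 = -1 + x 0 * x 0 - x 1 * x 1 by apply: (eq_sub xH); ring.
by rewrite e /k; ring.
Qed.

Hypothesis reg2 : forall a : A, 2%:R * a = 0 -> a = 0.
Let cancel2 (a b : A) : 2%:R * a = 2%:R * b -> a = b.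
Proof. by move=> h; apply/eqP; rewrite -subr_eq0; apply/eqP/reg2; rewrite mulrBr h subrr. Qed.

(** In terms of the height Y = 1 / (x_0 - x_1) and the horizontal coordinate X =
    x_2 Y of the upper half plane, M1 and M2 are the unit tangent vectors Y d/dY
    and Y d/dX at x, and P = dY / Y, Q = dX / Y. *)
Lemma hyp_dx i m : d i (x m) = hyp_P i * hyp_M1 m + hyp_Q i * hyp_M2 m.
Proof.
have h2 : d i (x 2) = hyp_Q i - x 2 * hyp_P i.
  have h := congr1 (d i) x2; rewrite (derM (hd i) X k) dk (dX i) in h.
  rewrite h [in RHS]x2.
  by transitivity ((k * Y) * hyp_Q i - X * k * hyp_P i); [ring|rewrite kY; ring].
have hs : d i (x 0) + d i (x 1) = Y * hyp_P i + 2 * X * hyp_Q i - X * X * k * hyp_P i.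
  rewrite -(derD (hd i)) x01 (derD (hd i)) (derM (hd i) (X * X) k) (derM (hd i) X X) dk (dX i) dY.
  by transitivity (Y * hyp_P i + 2 * X * hyp_Q i * (k * Y) - X * X * k * hyp_P i); [ring|rewrite kY; ring].
have hb : d i (x 0) - d i (x 1) = - k * hyp_P i by rewrite -dk /k (derD (hd i)) (derN (hd i)).
have e : X * X * k = x 0 + x 1 - Y by rewrite x01; ring.
rewrite e in hs.
case: m => -[|[|[|//]]] lt; rewrite /hyp_M1 /hyp_M2 /=.
- rewrite (_ : Ordinal lt = 0); last exact: val_inj.
  by apply: cancel2; apply: (eq_sub (congr2 +%R hs hb)); rewrite /k; ring.
- rewrite (_ : Ordinal lt = 1); last exact: val_inj.
  by apply: cancel2; apply: (eq_sub (congr2 (fun a b => a - b) hs hb)); rewrite /k; ring.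
- rewrite (_ : Ordinal lt = 2); last exact: val_inj.
  by rewrite h2; ring.
Qed.

(** The connection form of the frame (M1, M2) is - Q; the component along the
    position vector x is the second fundamental form of the hyperboloid. *)
Lemma hyp_dM1 i m : d i (hyp_M1 m) = - hyp_Q i * hyp_M2 m + hyp_P i * x m.
Proof.
have h := hyp_dx i m; move: h.
case: m => -[|[|[|//]]] lt; rewrite /hyp_M1 /hyp_M2 /=;
  rewrite ?(derD (hd i)) (derN (hd i)) ?dY.
- by rewrite (_ : Ordinal lt = 0); [move=> ->; ring|exact: val_inj].
- by rewrite (_ : Ordinal lt = 1); [move=> ->; ring|exact: val_inj].
- by rewrite (_ : Ordinal lt = 2); [move=> ->; ring|exact: val_inj].
Qed.

Lemma hyp_dM2 i m : d i (hyp_M2 m) = hyp_Q i * (hyp_M1 m + x m).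
Proof.
case: m => -[|[|[|//]]] lt; rewrite /hyp_M1 /hyp_M2 /=.
- by rewrite (_ : Ordinal lt = 0); [rewrite (dX i); ring|exact: val_inj].
- by rewrite (_ : Ordinal lt = 1); [rewrite (dX i); ring|exact: val_inj].
- by rewrite (_ : Ordinal lt = 2); [rewrite (der1 (hd i)); ring|exact: val_inj].
Qed.

(** P = d (log Y) is closed. *)
Lemma hyp_dP i j : d i (hyp_P j) = d j (hyp_P i).
Proof.
rewrite {1 2}/hyp_P (derM (hd i) (d j Y) k) (derM (hd j) (d i Y) k) (dk i) (dk j) (dC i j Y) (dY i) (dY j); ring.
Qed.

(** Structure equation for Q = dX / Y. *)
Lemma hyp_dQ i j : d i (hyp_Q j) = d j (hyp_Q i) - hyp_Q j * hyp_P i + hyp_Q i * hyp_P j.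
Proof.
rewrite {1 2}/hyp_Q (derM (hd i) (d j X) k) (derM (hd j) (d i X) k) (dk i) (dk j) (dC i j X) (dX i) (dX j).
have -> : Y * hyp_Q j * (- k * hyp_P i) = - (hyp_Q j * hyp_P i).
  by transitivity (- (k * Y) * hyp_Q j * hyp_P i); [|rewrite kY]; ring.
have -> : Y * hyp_Q i * (- k * hyp_P j) = - (hyp_Q i * hyp_P j).
  by transitivity (- (k * Y) * hyp_Q i * hyp_P j); [|rewrite kY]; ring.
ring.
Qed.

Definition lorA (a b : 'I_3 -> A) : A := - (a 0 * b 0) + a 1 * b 1 + a 2 * b 2.

Lemma hyp_gram : [/\ lorA hyp_M1 hyp_M1 = 1, lorA hyp_M1 hyp_M2 = 0, lorA hyp_M2 hyp_M2 = 1,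
  lorA hyp_M1 x = 0 & lorA hyp_M2 x = 0].
Proof.
rewrite /lorA /hyp_M1 /hyp_M2 /=; split.
- by apply: (eq_sub (congr2 +%R xH (congr1 (fun z => 2 * z) kY))); rewrite /k; ring.
- by apply: (eq_sub (esym x2)); rewrite /k; ring.
- by ring.
- by apply: (eq_sub (congr2 (fun a b => - (a + b)) xH kY)); rewrite /k; ring.
- by apply: (eq_sub x2); rewrite /k; ring.
Qed.

Definition crossA (a b : 'I_3 -> A) (m : 'I_3) : A :=
  nth 0 [:: a 2 * b 1 - a 1 * b 2; a 2 * b 0 - a 0 * b 2; a 0 * b 1 - a 1 * b 0] m.

(** M2 is the rotation of M1 by the complex structure. *)
Lemma hyp_cross1 m : crossA x hyp_M1 m = hyp_M2 m.
Proof.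
case: m => -[|[|[|//]]] lt; rewrite /crossA /hyp_M1 /hyp_M2 /X /=; try by ring.
by apply: (eq_sub kY); rewrite /k; ring.
Qed.

Lemma hyp_cross2 m : crossA x hyp_M2 m = - hyp_M1 m.
Proof.
have e : X * x 2 = x 0 + x 1 - Y by rewrite x01 [in LHS]x2; ring.
case: m => -[|[|[|//]]] lt; rewrite /crossA /hyp_M1 /hyp_M2 /=.
- by apply: (eq_sub e); ring.
- by apply: (eq_sub e); ring.
- by apply: (eq_sub (esym x2)); rewrite /k; ring.
Qed.

Lemma hyp_gram_d i j :
  lorA (fun m => d i (x m)) (fun m => d j (x m)) = hyp_P i * hyp_P j + hyp_Q i * hyp_Q j.
Proof.
have [g11 g12 g22 _ _] := hyp_gram.
transitivity (hyp_P i * hyp_P j * lorA hyp_M1 hyp_M1 +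
  (hyp_P i * hyp_Q j + hyp_Q i * hyp_P j) * lorA hyp_M1 hyp_M2 +
  hyp_Q i * hyp_Q j * lorA hyp_M2 hyp_M2).
  by rewrite /lorA !hyp_dx; ring.
by rewrite g11 g12 g22; ring.
Qed.

Lemma hyp_cross_d i j :
  lorA (crossA x (fun m => d i (x m))) (fun m => d j (x m)) = hyp_P i * hyp_Q j - hyp_Q i * hyp_P j.
Proof.
have [g11 g12 g22 _ _] := hyp_gram.
have cr m : crossA x (fun m => d i (x m)) m = hyp_P i * hyp_M2 m - hyp_Q i * hyp_M1 m.
  transitivity (hyp_P i * crossA x hyp_M1 m + hyp_Q i * crossA x hyp_M2 m).
    by case: m => -[|[|[|//]]] lt; rewrite /crossA !hyp_dx /=; ring.
  by rewrite hyp_cross1 hyp_cross2; ring.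
rewrite /lorA !cr !hyp_dx.
transitivity (hyp_P i * hyp_Q j * lorA hyp_M2 hyp_M2 - hyp_Q i * hyp_P j * lorA hyp_M1 hyp_M1
   + (hyp_P i * hyp_P j - hyp_Q i * hyp_Q j) * lorA hyp_M1 hyp_M2); first by rewrite /lorA; ring.
by rewrite g11 g12 g22; ring.
Qed.

End Hyperbolic.

(** * Connection and curvature of a metric given by a coframe *)

Section CoframeAlgebra.
Context (A : comPzRingType) (e s t ie it : A).
Hypothesis eie : e * ie = 1.
Hypothesis tit : t * it = 1.

Let cancel_e x : ie ^+ 2 * x = 0 -> x = 0.
Proof.
by move=> h; transitivity ((e * ie) ^+ 2 * x); [rewrite eie; ring|rewrite exprMn -mulrA h mulr0].
Qed.
Let cancel_t x : it ^+ 2 * x = 0 -> x = 0.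
Proof.
by move=> h; transitivity ((t * it) ^+ 2 * x); [rewrite tit; ring|rewrite exprMn -mulrA h mulr0].
Qed.
Let cancel_et x : ie * it * x = 0 -> x = 0.
Proof.
by move=> h; transitivity (e * t * (ie * it * x)); [transitivity ((e * ie) * (t * it) * x); [rewrite eie tit|]; ring|rewrite h mulr0].
Qed.

(** The coframe diagonalizes the metric, here written as a sum of four squares of
    one-forms. *)
Lemma coframe_gram (a b c d : 'I_2 -> A) :
  let fr1 (z : 'I_2 -> A) := ie * z 0 in let fr2 (z : 'I_2 -> A) := it * (z 1 - s * ie * z 0) in
  a 0 * a 0 + b 0 * b 0 + (c 0 * c 0 + d 0 * d 0) = e ^+ 2 ->
  a 0 * a 1 + b 0 * b 1 + (c 0 * c 1 + d 0 * d 1) = e * s ->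
  a 1 * a 1 + b 1 * b 1 + (c 1 * c 1 + d 1 * d 1) = s ^+ 2 + t ^+ 2 ->
  [/\ fr1 a ^+ 2 + fr1 b ^+ 2 + (fr1 c ^+ 2 + fr1 d ^+ 2) = 1,
      fr1 a * fr2 a + fr1 b * fr2 b + (fr1 c * fr2 c + fr1 d * fr2 d) = 0
    & fr2 a ^+ 2 + fr2 b ^+ 2 + (fr2 c ^+ 2 + fr2 d ^+ 2) = 1].
Proof.
move=> fr1 fr2; rewrite /fr1 /fr2 => h00 h01 h11.
pose g i j := a i * a j + b i * b j + (c i * c j + d i * d j).
rewrite -/(g 0 0) in h00; rewrite -/(g 0 1) in h01; rewrite -/(g 1 1) in h11.
split.
- transitivity (ie ^+ 2 * g 0 0); first by rewrite /g; ring.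
  by rewrite h00; transitivity ((e * ie) ^+ 2); [|rewrite eie]; ring.
- transitivity (ie * it * (g 0 1 - s * ie * g 0 0)); first by rewrite /g; ring.
  by rewrite h00 h01; transitivity (ie * it * e * s * (1 - e * ie)); [|rewrite eie]; ring.
transitivity (it ^+ 2 * (g 1 1 - 2 * s * ie * g 0 1 + s ^+ 2 * ie ^+ 2 * g 0 0)).
  by rewrite /g; ring.
rewrite h00 h01 h11.
transitivity ((t * it) ^+ 2 + it ^+ 2 * s ^+ 2 * (1 - e * ie) ^+ 2); first by ring.
by rewrite eie tit; ring.
Qed.

(** A tensor that vanishes on the frame vectors vanishes in coordinates.  The
    tensor is a covariant derivative c plus a quadratic term: with c = nabla P,
    h = k = Q or c = nabla Q, h = Q, k = P it is a component of the Hessian. *)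
Lemma coframe_tensor_eq0 (T c : 'I_2 -> 'I_2 -> A) (h k : 'I_2 -> A) (sg : A) :
  let fr1 (z : 'I_2 -> A) := ie * z 0 in let fr2 (z : 'I_2 -> A) := it * (z 1 - s * ie * z 0) in
  (forall i j, T i j = c i j + sg * (h i * k j)) ->
  ie ^+ 2 * c 0 0 = - sg * (fr1 h * fr1 k) ->
  ie * it * (c 0 1 - s * ie * c 0 0) = - sg * (fr1 h * fr2 k) ->
  ie * it * (c 1 0 - s * ie * c 0 0) = - sg * (fr2 h * fr1 k) ->
  it ^+ 2 * (c 1 1 - s * ie * (c 0 1 + c 1 0) + s ^+ 2 * ie ^+ 2 * c 0 0) = - sg * (fr2 h * fr2 k) ->
  forall i j, T i j = 0.
Proof.
move=> fr1 fr2; rewrite /fr1 /fr2 => TE h1 h2 h3 h4.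
have T00 : T 0 0 = 0 by apply: cancel_e; rewrite TE; apply: (eq_sub h1); ring.
have c00 : c 0 0 = - sg * (h 0 * k 0) by have := TE 0 0; rewrite T00 => h0; apply: (eq_sub (esym h0)); ring.
rewrite c00 in h2 h3 h4.
have T01 : T 0 1 = 0 by apply: cancel_et; rewrite TE; apply: (eq_sub h2); ring.
have T10 : T 1 0 = 0 by apply: cancel_et; rewrite TE; apply: (eq_sub h3); ring.
have c01 : c 0 1 = - sg * (h 0 * k 1) by have := TE 0 1; rewrite T01 => h0; apply: (eq_sub (esym h0)); ring.
have c10 : c 1 0 = - sg * (h 1 * k 0) by have := TE 1 0; rewrite T10 => h0; apply: (eq_sub (esym h0)); ring.
rewrite c01 c10 in h4.
have T11 : T 1 1 = 0 by apply: cancel_t; rewrite TE; apply: (eq_sub h4); ring.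
by move=> i j; have [-> | ->] := ord2_cases i; have [-> | ->] := ord2_cases j.
Qed.

End CoframeAlgebra.

Section Metric.
Context (R : realType) (V : plane_open R).
Context (e s t ie it : sm V).
Hypothesis eie : e * ie = 1.
Hypothesis tit : t * it = 1.
Local Notation half := (sm_cst V 2^-1).
Local Notation d0 := (pd 0).
Local Notation d1 := (pd 1).

(** The metric for which e dx + s dy and t dy form an orthonormal coframe; ie and
    it stand for the inverses of e and t. *)
Definition coframe_metric (i j : 'I_2) : sm V :=
  if i == 0 then (if j == 0 then e ^+ 2 else e * s)
  else (if j == 0 then e * s else s ^+ 2 + t ^+ 2).
Local Notation met := coframe_metric.
Definition coframe_cometric (i j : 'I_2) : sm V :=
  if i == 0 then (if j == 0 then (s ^+ 2 + t ^+ 2) * ie ^+ 2 * it ^+ 2 else - s * ie * it ^+ 2)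
  else (if j == 0 then - s * ie * it ^+ 2 else it ^+ 2).
Local Notation imet := coframe_cometric.
Definition coframe_christoffel (k i j : 'I_2) : sm V :=
  half * \sum_l imet k l * (pd i (met j l) + pd j (met i l) - pd l (met i j)).
Local Notation gam := coframe_christoffel.
(** The covariant derivative of a one-form a in coordinates. *)
Definition covariant (a : 'I_2 -> sm V) (i j : 'I_2) : sm V :=
  pd i (a j) - \sum_k gam k i j * a k.
Local Notation cov := covariant.

(** Value of a one-form on the first vector (1/e) d_0 of the dual frame. *)
Definition frame_coef1 (a : 'I_2 -> sm V) : sm V := ie * a 0.
Local Notation fr1 := frame_coef1.
(** Value of a one-form on the second vector (1/t) (d_1 - (s/e) d_0). *)
Definition frame_coef2 (a : 'I_2 -> sm V) : sm V := it * (a 1 - s * ie * a 0).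
Local Notation fr2 := frame_coef2.
Definition frame_d1 (h : sm V) : sm V := fr1 (fun i => pd i h).
Local Notation E1 := frame_d1.
Definition frame_d2 (h : sm V) : sm V := fr2 (fun i => pd i h).
Local Notation E2 := frame_d2.
(** Connection form of the frame, evaluated on its two vectors; it is read off
    from the bracket of the frame vectors. *)
Definition frame_w1 : sm V := (d0 s - d1 e) * ie * it.
Local Notation w1 := frame_w1.
Definition frame_w2 : sm V := d0 t * ie * it.
Local Notation w2 := frame_w2.

Let D0 := derE (@pd_derivation R V 0).
Let D1 := derE (@pd_derivation R V 1).

Let d_ie i : pd i ie = - ie ^+ 2 * pd i e.
Proof.
have h := congr1 (pd i) eie; rewrite (derM (pd_derivation V i)) (der1 (pd_derivation V i)) in h.
transitivity (pd i ie * (e * ie)); first by rewrite eie mulr1.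
by apply: (eq_sub (congr1 (fun z => ie * z) h)); ring.
Qed.

Let d_it i : pd i it = - it ^+ 2 * pd i t.
Proof.
have h := congr1 (pd i) tit; rewrite (derM (pd_derivation V i)) (der1 (pd_derivation V i)) in h.
transitivity (pd i it * (t * it)); first by rewrite tit mulr1.
by apply: (eq_sub (congr1 (fun z => it * z) h)); ring.
Qed.

Let ieE u : plane_set V u -> e u != 0 /\ ie u = (e u)^-1.
Proof.
move=> Vu; have := congr1 (fun h : sm V => h u) eie; rewrite evM ev1 // => h.
have e0 : e u != 0 by apply/eqP => e0; move/eqP: h; rewrite e0 mul0r eq_sym oner_eq0.
by split=> //; apply: (mulfI e0); rewrite h divff.
Qed.

Let itE u : plane_set V u -> t u != 0 /\ it u = (t u)^-1.
Proof.
move=> Vu; have := congr1 (fun h : sm V => h u) tit; rewrite evM ev1 // => h.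
have e0 : t u != 0 by apply/eqP => e0; move/eqP: h; rewrite e0 mul0r eq_sym oner_eq0.
by split=> //; apply: (mulfI e0); rewrite h divff.
Qed.

Lemma frame_d1_derivation : derivation E1.
Proof. by split=> f g; rewrite /E1 /fr1 !D0; ring. Qed.
Lemma frame_d2_derivation : derivation E2.
Proof. by split=> f g; rewrite /E2 /fr2 !D0 !D1; ring. Qed.

Let dh i : pd i half = 0. Proof. exact: pd_cst. Qed.

Lemma coframe_metricE : (met 0 0 = e ^+ 2) * (met 0 1 = e * s) * (met 1 0 = e * s) *
  (met 1 1 = s ^+ 2 + t ^+ 2).
Proof. by []. Qed.
Lemma coframe_cometricE : (imet 0 0 = (s ^+ 2 + t ^+ 2) * ie ^+ 2 * it ^+ 2) * (imet 0 1 = - s * ie * it ^+ 2) *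
  (imet 1 0 = - s * ie * it ^+ 2) * (imet 1 1 = it ^+ 2).
Proof. by []. Qed.

Ltac push_d := repeat match goal with
  | |- context [@pd ?R ?V ?i (?f * ?g)] => rewrite (derM (pd_derivation V i) f g)
  | |- context [@pd ?R ?V ?i (?f + ?g)] => rewrite (derD (pd_derivation V i) f g)
  | |- context [@pd ?R ?V ?i (- ?f)] => rewrite (derN (pd_derivation V i) f)
  | |- context [@pd ?R ?V ?i (?f ^+ 2)] => rewrite (derX2 (pd_derivation V i) f)
  | |- context [@pd ?R ?V ?i ie] => rewrite (d_ie i)
  | |- context [@pd ?R ?V ?i it] => rewrite (d_it i)
  | |- context [@pd ?R ?V ?i (sm_cst ?V ?a)] => rewrite (pd_cst V i a)
  | |- context [@pd ?R ?V 1 (pd 0 ?g)] => rewrite (pdC 1 0 g)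
  end.

(** Equality in the ring is checked pointwise, where e and t are nonzero numbers
    and [field] applies. *)
Ltac field_at_point :=
  apply smP;
  let u := fresh "u" in let Vu := fresh "Vu" in
  let e0 := fresh "e0" in let t0 := fresh "t0" in
  let h1 := fresh "h1" in let h2 := fresh "h2" in
  intros u Vu; destruct (ieE Vu) as [e0 h1]; destruct (itE Vu) as [t0 h2];
  push_ev; rewrite ?h1 ?h2; clear h1 h2; revert e0 t0; gen_ev; intros; field;
  rewrite ?e0 ?t0 //.

(** The four lemmas [covariant11] to [covariant22] translate covariant derivatives
    from coordinates to the frame: the frame rotates with angular velocity w. *)
Lemma covariant11 a : ie ^+ 2 * cov a 0 0 = E1 (fr1 a) - w1 * fr2 a.
Proof.
rewrite /cov /gam /E1 /fr1 /fr2 /w1 !sum2E !coframe_metricE !coframe_cometricE.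
push_d.
field_at_point.
Qed.

Lemma covariant12 a : ie * it * (cov a 0 1 - s * ie * cov a 0 0) = E1 (fr2 a) + w1 * fr1 a.
Proof.
rewrite /cov /gam /E1 /fr1 /fr2 /w1 !sum2E !coframe_metricE !coframe_cometricE.
push_d.
field_at_point.
Qed.

Lemma covariant21 a : ie * it * (cov a 1 0 - s * ie * cov a 0 0) = E2 (fr1 a) - w2 * fr2 a.
Proof.
rewrite /cov /gam /E2 /fr1 /fr2 /w2 !sum2E !coframe_metricE !coframe_cometricE.
push_d.
field_at_point.
Qed.

Lemma covariant22 a : it ^+ 2 * (cov a 1 1 - s * ie * (cov a 0 1 + cov a 1 0) + s ^+ 2 * ie ^+ 2 * cov a 0 0)
  = E2 (fr2 a) + w2 * fr1 a.
Proof.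
rewrite /cov /gam /E2 /fr1 /fr2 /w2 !sum2E !coframe_metricE !coframe_cometricE.
push_d.
field_at_point.
Qed.

Lemma covariant_trace a : \sum_i \sum_j imet i j * cov a i j =
  (E1 (fr1 a) - w1 * fr2 a) + (E2 (fr2 a) + w2 * fr1 a).
Proof.
rewrite -covariant11 -covariant22 !sum2E !coframe_cometricE.
field_at_point.
Qed.

Lemma frame_bracket h : E1 (E2 h) - E2 (E1 h) = - w1 * E1 h - w2 * E2 h.
Proof.
rewrite /E1 /E2 /fr1 /fr2 /w1 /w2.
push_d.
field_at_point.
Qed.

Definition coframe_riemann (l k i j : 'I_2) : sm V :=
  pd i (gam l j k) - pd j (gam l i k) +
  \sum_m (gam l i m * gam m j k - gam l j m * gam m i k).
Local Notation riem := coframe_riemann.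

Let om0 := w1 * e.
Let om1 := w1 * s + w2 * t.

Let gam_explicit :
  [/\ (gam 1 0 0 = it * (om0 * e)) * (gam 1 0 1 = it * (d0 t + om0 * s)),
      (gam 1 1 0 = it * (om1 * e)) * (gam 1 1 1 = it * (d1 t + om1 * s)),
      (gam 0 0 0 = ie * (d0 e - s * gam 1 0 0)) * (gam 0 0 1 = ie * (d0 s - om0 * t - s * gam 1 0 1))
    & (gam 0 1 0 = ie * (d1 e - s * gam 1 1 0)) * (gam 0 1 1 = ie * (d1 s - om1 * t - s * gam 1 1 1))].
Proof.
do ![split]; rewrite /om0 /om1 /gam /w1 /w2 !sum2E !coframe_metricE !coframe_cometricE; push_d; field_at_point.
Qed.

(** Cartan's second structure equation: the curvature is the exterior derivative
    of the connection form.  Differentiating the derivatives of e and s crosswise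
    and comparing them expresses the coordinate curvature through the forms
    om0, om1. *)
Lemma frame_curvature : \sum_l met 0 l * riem l 1 0 1 =
  - (E1 w2 - E2 w1 + w1 ^+ 2 + w2 ^+ 2) * (e ^+ 2 * t ^+ 2).
Proof.
have [[g100 g101] [g110 g111] [g000 g001] [g010 g011]] := gam_explicit.
have cancel_e a b : ie * b = a -> b = e * a.
  by move=> <-; transitivity (e * ie * b); [rewrite eie mul1r|ring].
have cancel_t a b : it * b = a -> b = t * a.
  by move=> <-; transitivity (t * it * b); [rewrite tit mul1r|ring].
have e00 : d0 e = e * gam 0 0 0 + s * gam 1 0 0.
  by rewrite -(cancel_e _ _ (esym g000)); ring.
have e10 : d1 e = e * gam 0 1 0 + s * gam 1 1 0.
  by rewrite -(cancel_e _ _ (esym g010)); ring.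
have e01 : d0 s = e * gam 0 0 1 + s * gam 1 0 1 + om0 * t.
  by rewrite -(cancel_e _ _ (esym g001)); ring.
have e11 : d1 s = e * gam 0 1 1 + s * gam 1 1 1 + om1 * t.
  by rewrite -(cancel_e _ _ (esym g011)); ring.
have t01 : d0 t = t * gam 1 0 1 - om0 * s.
  by rewrite -(cancel_t _ _ (esym g101)); ring.
have t11 : d1 t = t * gam 1 1 1 - om1 * s.
  by rewrite -(cancel_t _ _ (esym g111)); ring.
(* Contracting with the first coframe form e dx + s dy turns the curvature
   into the exterior derivative of the connection form om0 dx + om1 dy. *)
have key : e * riem 0 1 0 1 + s * riem 1 1 0 1 = (d1 om0 - d0 om1) * t.
  have := congr1 (fun h => d1 h) e01; have := congr1 (fun h => d0 h) e11.
  rewrite /riem !sum2E; push_d; move: (d0 (d1 s)) => ss h1 h0.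
  apply: (eq_sub (congr2 (fun a b => b - a) h1 h0)).
  by rewrite e00 e10 e01 e11 t01 t11; ring.
rewrite sum2E !coframe_metricE.
have -> : e ^+ 2 * riem 0 1 0 1 + e * s * riem 1 1 0 1 =
  e * (e * riem 0 1 0 1 + s * riem 1 1 0 1) by ring.
rewrite key /om0 /om1; push_d.
have w1E : d1 e = d0 s - w1 * e * t.
  by rewrite /w1; transitivity (d0 s - (d0 s - d1 e) * (e * ie) * (t * it)); [rewrite eie tit|]; ring.
have w2E : d0 t = w2 * e * t.
  by rewrite /w2; transitivity (d0 t * (e * ie) * (t * it)); [rewrite eie tit|]; ring.
have a1 : e * E1 w2 = d0 w2.
  by rewrite /E1 /fr1; transitivity ((e * ie) * d0 w2); [|rewrite eie]; ring.
have a2 : e * t * E2 w1 = e * d1 w1 - s * d0 w1.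
  rewrite /E2 /fr2; transitivity (e * (t * it) * d1 w1 - (e * ie) * (t * it) * s * d0 w1); first by ring.
  by rewrite eie tit; ring.
transitivity (- (e * t ^+ 2 * (e * E1 w2) - e * t * (e * t * E2 w1) + (w1 ^+ 2 + w2 ^+ 2) * e ^+ 2 * t ^+ 2)); last by ring.
rewrite a1 a2 w1E w2E; ring.
Qed.
End Metric.

(** * Coordinate patches of minimal Lagrangian surfaces *)

Section Components.
Context (R : realType).

(** The two factors are indexed by a boolean, so that each statement on a
    component of the immersion is proved once. *)
Definition pr (b : bool) (w : ambient R) : 'rV[R]_3 := if b then w.1 else w.2.

Definition pr_coord (b : bool) (m : 'I_3) (w : ambient R) : R^o := pr b w 0 m.

Fact pr_coord_linear b m : linear (pr_coord b m).
Proof. by move=> a x y; rewrite /pr_coord /pr; case: b; rewrite !mxE. Qed.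
HB.instance Definition _ b m := GRing.isLinear.Build _ _ _ _ _ (pr_coord_linear b m).

Lemma pr_coord_continuous b m : continuous (pr_coord b m).
Proof.
move=> x; case: b; rewrite /pr_coord /pr.
  apply: (@continuous_comp _ _ _ (fst : ambient R -> _) (fun M : 'rV[R]_3 => M 0 m : R^o)).
    exact: cvg_fst.
  exact: coord_continuous.
apply: (@continuous_comp _ _ _ (snd : ambient R -> _) (fun M : 'rV[R]_3 => M 0 m : R^o)).
  exact: cvg_snd.
exact: coord_continuous.
Qed.

Lemma pr_coordZZ b m (a c : R) (x y : ambient R) :
  pr_coord b m (a *: x + c *: y) = a * pr_coord b m x + c * pr_coord b m y.
Proof. by case: b; rewrite /pr_coord /pr !mxE. Qed.

Lemma ambient_eq (v w : ambient R) : (forall b m, pr_coord b m v = pr_coord b m w) -> v = w.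
Proof.
move=> h; case: v w h => [v1 v2] [w1 w2] h; congr pair; apply/rowP => m.
  exact: (h true m).
exact: (h false m).
Qed.

Lemma dotE (v w : ambient R) : dot v w = lor (pr true v) (pr true w) + lor (pr false v) (pr false w).
Proof. by []. Qed.

Lemma lorE (v w : 'rV[R]_3) : lor v w = lorA (v 0) (w 0).
Proof. by []. Qed.

Lemma lcrossE (v w : 'rV[R]_3) m : lcross v w 0 m = crossA (v 0) (w 0) m.
Proof. by rewrite mxE. Qed.
End Components.

(** The data of the surface in one chart: f is the immersion composed with a
    parametrization. *)
Record is_patch (R : realType) (V : plane_open R) (f : 'rV[R]_2 -> ambient R) (K : R) : Prop := IsPatch {
  patch_smooth : smooth_on (plane_set V) f;
  patch_HH : forall u, plane_set V u -> HH (f u);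
  patch_immersed : forall u, plane_set V u -> injective ('d f u : 'rV[R]_2 -> ambient R);
  patch_lagrangian : forall u, plane_set V u -> forall v w : 'rV[R]_2,
    dot (J (f u) ('d f u v)) ('d f u w) = 0;
  patch_minimal : forall u, plane_set V u -> mean_curvature f u = 0;
  patch_curvature : forall u, plane_set V u -> gauss_curvature f u = K
}.

Lemma sum4_sqr_eq0 (R : realDomainType) (a b c d : R) :
  a ^+ 2 + b ^+ 2 + (c ^+ 2 + d ^+ 2) = 0 -> [/\ a = 0, b = 0, c = 0 & d = 0].
Proof.
move/eqP; rewrite !paddr_eq0 ?addr_ge0 ?sqr_ge0 // !sqrf_eq0.
by move=> /andP[/andP[/eqP ? /eqP ?] /andP[/eqP ? /eqP ?]].
Qed.

Section Patch.
Context (R : realType) (V : plane_open R) (f : 'rV[R]_2 -> ambient R) (K : R).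
Hypothesis H : is_patch V f K.
Local Notation oV := (@plane_open_open R V).

Fact coordinate_smooth b m : smooth_on (plane_set V) (pr_coord b m \o f : _ -> R^o).
Proof.
move=> k; apply: (@Ck_on_linear R k _ _ _ (pr_coord b m : {linear ambient R -> R^o})).
- exact: pr_coord_continuous.
- exact: oV.
- exact: patch_smooth H k.
Qed.

Definition coordinate b m : sm V := mk (coordinate_smooth b m).
Local Notation crd := coordinate.

Lemma coordinateE b m u : plane_set V u -> crd b m u = pr_coord b m (f u).
Proof. exact: mkE. Qed.

Lemma patch_differentiable u : plane_set V u -> differentiable f u.
Proof. by have [+ _] := patch_smooth H 1%N; apply. Qed.

Lemma pd_coordinateE b m i u : plane_set V u -> pd i (crd b m) u = pr_coord b m (partial i f u).
Proof.
move=> Vu; rewrite pd_mk // /partial.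
apply: (@derive_linear R _ _ _ (pr_coord b m : {linear ambient R -> R^o})).
  exact: pr_coord_continuous.
exact: patch_differentiable.
Qed.

Lemma pd_pd_coordinateE b m i j u : plane_set V u ->
  pd i (pd j (crd b m)) u = pr_coord b m (partial i (partial j f) u).
Proof.
move=> Vu; rewrite pdE //.
rewrite (@eq_partial R V R^o i _ (pr_coord b m \o partial j f : _ -> R^o)) //; last first.
  by move=> v Vv; exact: pd_coordinateE.
apply: (@derive_linear R _ _ _ (pr_coord b m : {linear ambient R -> R^o})).
  exact: pr_coord_continuous.
by have [_ /(_ (delta_mx 0 j))[+ _]] := patch_smooth H 2; apply.
Qed.

Lemma coordinate_lorA b : lorA (crd b) (crd b) = - 1.
Proof.
apply: smP => u Vu; rewrite /lorA; push_ev; rewrite !coordinateE //.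
have [[h1 _] [h2 _]] := patch_HH H Vu; rewrite invrN invr1 in h1 h2.
by case: b; [exact: h1|exact: h2].
Qed.

(** On the hyperboloid x_0 exceeds |x_1|: the height function of the upper half
    plane is defined. *)
Lemma coordinate_gt0 b u : plane_set V u -> 0 < crd b 0 u - crd b 1 u.
Proof.
move=> Vu; rewrite !coordinateE //.
have hx (x : 'rV[R]_3) : H2 (-1) x -> 0 < x 0 0 - x 0 1.
  case; rewrite /lor invrN invr1 => h x0.
  rewrite subr_gt0 ltNge; apply/negP => le01.
  have : x 0 0 * x 0 0 <= x 0 1 * x 0 1 by rewrite ler_pM // ltW.
  have := sqr_ge0 (x 0 2); rewrite expr2; lra.
have [h1 h2] := patch_HH H Vu.
by case: b; [exact: (hx _ h1)|exact: (hx _ h2)].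
Qed.

Lemma coordinate_inv b : exists Y : sm V, (crd b 0 - crd b 1) * Y = 1.
Proof.
by apply: sm_inv => u Vu; push_ev; rewrite gt_eqF // coordinate_gt0.
Qed.

Definition height b : sm V := sval (cid (coordinate_inv b)).
Lemma heightE b : (crd b 0 - crd b 1) * height b = 1.
Proof. by rewrite /height; case: cid. Qed.

(** Components of the differential of the b-th factor of f along the
    horospherical frame. *)
Definition coefP b i : sm V := hyp_P (@pd R V) (crd b) (height b) i.
Local Notation P := coefP.
Definition coefQ b i : sm V := hyp_Q (@pd R V) (crd b) (height b) i.
Local Notation Q := coefQ.
Definition tframe1 b m : sm V := hyp_M1 (crd b) (height b) m.
Local Notation M1 := tframe1.
Definition tframe2 b m : sm V := hyp_M2 (crd b) (height b) m.
Local Notation M2 := tframe2.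

Let reg2 (a : sm V) : 2%:R * a = 0 -> a = 0. Proof. exact: sm_torsion_free. Qed.

Lemma pd_coordinate b i m : pd i (crd b m) = P b i * M1 b m + Q b i * M2 b m.
Proof. exact: (hyp_dx (@pd_derivation R V) (coordinate_lorA b) (heightE b) reg2). Qed.
Lemma pd_tframe1 b i m : pd i (M1 b m) = - Q b i * M2 b m + P b i * crd b m.
Proof. exact: (hyp_dM1 (@pd_derivation R V) (coordinate_lorA b) (heightE b) reg2). Qed.
Lemma pd_tframe2 b i m : pd i (M2 b m) = Q b i * (M1 b m + crd b m).
Proof. exact: (hyp_dM2 (@pd_derivation R V) (heightE b)). Qed.
Lemma pd_coefP_comm b i j : pd i (P b j) = pd j (P b i).
Proof. exact: (hyp_dP (@pd_derivation R V) (@pdC R V) (heightE b)). Qed.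
Lemma pd_coefQ_comm b i j : pd i (Q b j) = pd j (Q b i) - Q b j * P b i + Q b i * P b j.
Proof. exact: (hyp_dQ (@pd_derivation R V) (@pdC R V) (heightE b)). Qed.
Lemma tframe_gram b : [/\ lorA (M1 b) (M1 b) = 1, lorA (M1 b) (M2 b) = 0, lorA (M2 b) (M2 b) = 1,
  lorA (M1 b) (crd b) = 0 & lorA (M2 b) (crd b) = 0].
Proof. exact: (hyp_gram (coordinate_lorA b) (heightE b)). Qed.
Lemma cross_tframe1 b m : crossA (crd b) (M1 b) m = M2 b m.
Proof. exact: (hyp_cross1 (heightE b)). Qed.
Lemma cross_tframe2 b m : crossA (crd b) (M2 b) m = - M1 b m.
Proof. exact: (hyp_cross2 (coordinate_lorA b) (heightE b)). Qed.

(** The pulled back metrics of the two factors, added. *)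
Definition coef_metric i j : sm V := P true i * P true j + Q true i * Q true j +
  (P false i * P false j + Q false i * Q false j).
Local Notation gg := coef_metric.

Lemma lorA_pd b i j :
  lorA (fun m => pd i (crd b m)) (fun m => pd j (crd b m)) = P b i * P b j + Q b i * Q b j.
Proof. exact: (hyp_gram_d (@pd_derivation R V) (coordinate_lorA b) (heightE b) reg2). Qed.

Lemma lor_cross_pd b i j :
  lorA (crossA (crd b) (fun m => pd i (crd b m))) (fun m => pd j (crd b m)) =
  P b i * Q b j - Q b i * P b j.
Proof. exact: (hyp_cross_d (@pd_derivation R V) (coordinate_lorA b) (heightE b) reg2). Qed.

Lemma lor_partial b i j u : plane_set V u ->
  lor (pr b (partial i f u)) (pr b (partial j f u)) = (P b i * P b j + Q b i * Q b j) u.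
Proof.
by move=> Vu; rewrite -lorA_pd /lorA; push_ev; rewrite !pd_coordinateE.
Qed.

Lemma first_formE i j u : plane_set V u -> first_form f u i j = gg i j u.
Proof. by move=> Vu; rewrite mxE dotE !lor_partial. Qed.

Lemma diff_partial u v : plane_set V u ->
  'd f u v = v 0 0 *: partial 0 f u + v 0 1 *: partial 1 f u :> ambient R.
Proof.
move=> Vu; have df := patch_differentiable Vu.
rewrite /partial !deriveE // -!linearZ -linearD; congr ('d f u _).
by rewrite [LHS]row_sum_delta sum2E.
Qed.

Lemma diff_coord u v b m : plane_set V u ->
  pr_coord b m ('d f u v) = v 0 0 * pd 0 (crd b m) u + v 0 1 * pd 1 (crd b m) u.
Proof.
move=> Vu; rewrite (pd_coordinateE b m 0 Vu) (pd_coordinateE b m 1 Vu) (diff_partial v Vu).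
exact: pr_coordZZ.
Qed.

(** Positive definiteness is the injectivity of the differential: its two
    components are combinations of the orthonormal tangent vectors. *)
Lemma coef_metric_gt0 u (v : 'rV[R]_2) : plane_set V u -> v != 0 ->
  0 < v 0 0 ^+ 2 * gg 0 0 u + 2 * v 0 0 * v 0 1 * gg 0 1 u + v 0 1 ^+ 2 * gg 1 1 u.
Proof.
move=> Vu v0.
pose p b := v 0 0 * P b 0 u + v 0 1 * P b 1 u.
pose q b := v 0 0 * Q b 0 u + v 0 1 * Q b 1 u.
have -> : v 0 0 ^+ 2 * gg 0 0 u + 2 * v 0 0 * v 0 1 * gg 0 1 u + v 0 1 ^+ 2 * gg 1 1 u
  = p true ^+ 2 + q true ^+ 2 + (p false ^+ 2 + q false ^+ 2).
  by rewrite /gg; push_ev; rewrite /p /q; gen_ev => *; ring.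
rewrite lt_neqAle; apply/andP; split; last by rewrite !addr_ge0 // sqr_ge0.
rewrite eq_sym; apply: contra v0 => /eqP /sum4_sqr_eq0 [pt qt pf qf].
apply/eqP; apply: (patch_immersed H Vu); rewrite linear0.
apply: ambient_eq => b m; rewrite diff_coord // (pd_coordinate b 0 m) (pd_coordinate b 1 m).
push_ev; rewrite [pr_coord b m 0](linear0 (pr_coord b m)).
have -> : v 0 0 * (P b 0 u * M1 b m u + Q b 0 u * M2 b m u) +
  v 0 1 * (P b 1 u * M1 b m u + Q b 1 u * M2 b m u) = p b * M1 b m u + q b * M2 b m u.
  by rewrite /p /q; gen_ev => *; ring.
by case: b; rewrite ?pt ?qt ?pf ?qf !mul0r addr0.
Qed.

Lemma coef_metric_pair_gt0 u (a c : R) : plane_set V u -> (a, c) != (0, 0) ->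
  0 < a ^+ 2 * gg 0 0 u + 2 * a * c * gg 0 1 u + c ^+ 2 * gg 1 1 u.
Proof.
move=> Vu ac; pose v : 'rV[R]_2 := \row_j (if j == 0 then a else c).
have va : v 0 0 = a by rewrite mxE.
have vc : v 0 1 = c by rewrite mxE.
rewrite -va -vc; apply: coef_metric_gt0 => //; apply: contra ac => /eqP v0.
by rewrite -va -vc v0 !mxE.
Qed.

(** Gram-Schmidt on the coordinate vector fields. *)
Lemma coframe_exists : exists c : sm V * sm V * sm V * sm V * sm V,
  let: (e, s, t, ie, it) := c in
  [/\ e * ie = 1, t * it = 1 & forall i j, gg i j = coframe_metric e s t i j].
Proof.
have g00 u : plane_set V u -> 0 < gg 0 0 u.
  move=> Vu; have := @coef_metric_pair_gt0 u 1 0 Vu; rewrite xpair_eqE oner_eq0 => /(_ isT).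
  have e (p q r : R) : 1 ^+ 2 * p + 2 * 1 * 0 * q + 0 ^+ 2 * r = p by ring.
  by rewrite e.
have [e [e2 e0]] := sm_sqrt g00.
have [ie eie] : exists ie, e * ie = 1 by apply: sm_inv => u /e0 /gt_eqF ->.
pose s := gg 0 1 * ie.
have g11 u : plane_set V u -> 0 < (gg 1 1 - s ^+ 2) u.
  move=> Vu; have := @coef_metric_pair_gt0 u (- (s u * ie u)) 1 Vu.
  rewrite xpair_eqE oner_eq0 andbF => /(_ isT).
  have := congr1 (fun h : sm V => h u) eie; rewrite -e2 /s; push_ev.
  move: (gg 0 1 u) (gg 1 1 u) (e u) (ie u) => F G x y xy.
  have -> : (- (F * y * y)) ^+ 2 * x ^+ 2 + 2 * - (F * y * y) * 1 * F + 1 ^+ 2 * G =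
     (F * y) ^+ 2 * (x * y) ^+ 2 - 2 * (F * y) ^+ 2 + G by ring.
  by rewrite xy; congr (_ < _); ring.
have [t [t2 t0]] := sm_sqrt g11.
have [it tit] : exists it, t * it = 1 by apply: sm_inv => u /t0 /gt_eqF ->.
exists (e, s, t, ie, it); split=> // i j.
have es : gg 0 1 = e * s by rewrite /s; transitivity (gg 0 1 * (e * ie)); [rewrite eie mulr1|ring].
have gC k l : gg k l = gg l k by rewrite /gg; ring.
have [-> | ->] := ord2_cases i; have [-> | ->] := ord2_cases j; rewrite /coframe_metric /=.
- by rewrite e2.
- exact: es.
- by rewrite gC.
by rewrite t2 addrC subrK.
Qed.

End Patch.

(** * The geometry of a patch in an orthonormal frame *)

Section PatchMetric.
Context (R : realType) (V : plane_open R) (f : 'rV[R]_2 -> ambient R) (K : R).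
Hypothesis H : is_patch V f K.
Context (e s t ie it : sm V).
Hypothesis eie : e * ie = 1.
Hypothesis tit : t * it = 1.
Hypothesis gm : forall i j, coef_metric H i j = coframe_metric e s t i j.
Local Notation P := (coefP H).
Local Notation Q := (coefQ H).
Local Notation M1 := (tframe1 H).
Local Notation M2 := (tframe2 H).
Local Notation crd := (coordinate H).
Local Notation met := (coframe_metric e s t).
Local Notation imet := (coframe_cometric s t ie it).
Local Notation gam := (coframe_christoffel e s t ie it).
Local Notation cov := (covariant e s t ie it).
Local Notation riem := (coframe_riemann e s t ie it).
Local Notation E1 := (frame_d1 ie).
Local Notation E2 := (frame_d2 s ie it).
Local Notation w1 := (frame_w1 e s ie it).
Local Notation w2 := (frame_w2 t ie it).

Let ev_eie u : plane_set V u -> e u * ie u = 1.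
Proof. by move=> Vu; have := congr1 (fun h : sm V => h u) eie; push_ev. Qed.
Let ev_tit u : plane_set V u -> t u * it u = 1.
Proof. by move=> Vu; have := congr1 (fun h : sm V => h u) tit; push_ev. Qed.

Lemma first_form_met i j u : plane_set V u -> first_form f u i j = met i j u.
Proof. by move=> Vu; rewrite (first_formE H i j Vu) gm. Qed.

(** The inverse of a Gram matrix with a triangular factorization. *)
Lemma invmx_first_form k l u : plane_set V u -> invmx (first_form f u) k l = imet k l u.
Proof.
move=> Vu; pose N : 'M[R]_2 := \matrix_(i, j) imet i j u.
have GN : first_form f u *m N = 1%:M.
  apply/matrixP => i j; rewrite !mxE sum2E (first_form_met i 0 Vu) (first_form_met i 1 Vu) /N !mxE.
  have I01 : (0 == 1 :> 'I_2) = false by []. have I10 : (1 == 0 :> 'I_2) = false by [].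
  have he := ev_eie Vu; have ht := ev_tit Vu.
  have [-> | ->] := ord2_cases i; have [-> | ->] := ord2_cases j;
    rewrite ?coframe_metricE ?coframe_cometricE ?eqxx ?I01 ?I10; push_ev; move: he ht;
    move: (e u) (s u) (t u) (ie u) (it u) => x y z p q xp zq; rewrite ?mulr1n ?mulr0n.
  - have := congr1 (fun a => a ^+ 2) zq; rewrite expr1n => zq2.
    transitivity ((x * p) ^+ 2 * (z * q) ^+ 2 + (x * p) * (x * p - 1) * (y * q) ^+ 2); [by ring|].
    by rewrite xp zq; ring.
  - by transitivity ((1 - x * p) * x * y * q ^+ 2); [ring|rewrite xp; ring].
  - by transitivity ((x * p - 1) * p * y * (y ^+ 2 + z ^+ 2) * q ^+ 2); [ring|rewrite xp; ring].
  - by transitivity ((1 - x * p) * y ^+ 2 * q ^+ 2 + (z * q) ^+ 2); [ring|rewrite xp zq; ring].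
have [Gu _] := mulmx1_unit GN.
have -> : invmx (first_form f u) = N by rewrite -[N]mul1mx -(mulVmx Gu) -mulmxA GN mulmx1.
by rewrite mxE.
Qed.

Lemma det_first_form u : plane_set V u -> \det (first_form f u) = (e ^+ 2 * t ^+ 2) u.
Proof.
move=> Vu; rewrite det2E !(first_form_met _ _ Vu) !coframe_metricE; push_ev.
by gen_ev => *; ring.
Qed.

(** The identification holds on an open set, so it can be differentiated. *)
Lemma partial_first_form i j l u : plane_set V u ->
  partial i (fun x => first_form f x j l : R^o) u = pd i (met j l) u.
Proof.
move=> Vu; rewrite pdE //; apply: (@eq_partial R V R^o) => // v Vv.
exact: first_form_met.
Qed.

Lemma christoffelE k i j u : plane_set V u -> christoffel f k i j u = gam k i j u.
Proof.
move=> Vu; rewrite /christoffel /coframe_christoffel !sum2E; push_ev.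
by rewrite !(invmx_first_form _ _ Vu) !(partial_first_form _ _ _ Vu).
Qed.

Lemma riemannE l k i j u : plane_set V u -> riemann f l k i j u = riem l k i j u.
Proof.
move=> Vu.
have pc m n p q : partial m (christoffel f n p q : _ -> R^o) u = pd m (gam n p q) u.
  by rewrite pdE //; apply: (@eq_partial R V R^o) => // v Vv; exact: christoffelE.
rewrite /riemann /coframe_riemann !sum2E; push_ev.
by rewrite !pc !(christoffelE _ _ _ Vu).
Qed.

(** Reads the Gauss curvature through Cartan's structure equation. *)
Lemma curvature_frame : E1 w2 - E2 w1 + w1 ^+ 2 + w2 ^+ 2 = - sm_cst V K.
Proof.
apply: smP => u Vu.
have := patch_curvature H Vu; rewrite /gauss_curvature.
have h := congr1 (fun h : sm V => h u) (frame_curvature s eie tit); move: h.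
rewrite !sum2E !(riemannE _ _ _ _ Vu) !(first_form_met _ _ Vu) (det_first_form Vu); push_ev.
move=> ->.
have e0 : e u != 0 by apply/eqP => e0; have /eqP := ev_eie Vu; rewrite e0 mul0r eq_sym oner_eq0.
have t0 : t u != 0 by apply/eqP => t0; have /eqP := ev_tit Vu; rewrite t0 mul0r eq_sym oner_eq0.
rewrite mulfK ?mulf_neq0 ?expf_neq0 // => <-.
by rewrite opprK.
Qed.

Lemma frame_is_orthonormal : orthonormal_frame E1 E2 w1 w2 (sm_cst V K).
Proof.
split.
- exact: frame_d1_derivation.
- exact: frame_d2_derivation.
- exact: frame_bracket.
exact: curvature_frame.
Qed.

(** Components along the horospherical frame of the second covariant derivative
    of the b-th factor, as a map into the hyperbolic plane. *)
Definition second_coefP b i j := cov (P b) i j + Q b i * Q b j.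
Local Notation TP := second_coefP.
Definition second_coefQ b i j := cov (Q b) i j - Q b i * P b j.
Local Notation TQ := second_coefQ.

Lemma pd_pd_coordinate b i j m : pd i (pd j (crd b m)) =
  (pd i (P b j) + Q b i * Q b j) * M1 b m + (pd i (Q b j) - Q b i * P b j) * M2 b m
  + (P b i * P b j + Q b i * Q b j) * crd b m.
Proof.
rewrite (pd_coordinate H b j m) (derD (pd_derivation V i)) !(derM (pd_derivation V i)) (pd_tframe1 H b i m) (pd_tframe2 H b i m).
ring.
Qed.

(** The second derivatives of a factor, projected to the tangent plane, minus the
    Levi-Civita correction: the second fundamental form of the immersion is the
    pair of the Hessians of its factors. *)
Lemma second_formE b i j m u : plane_set V u ->
  pr_coord b m (second_form f i j u) = (TP b i j * M1 b m + TQ b i j * M2 b m) u.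
Proof.
move=> Vu.
have -> : pr_coord b m (second_form f i j u) = (pd i (pd j (crd b m)) +
   lorA (fun n => pd i (pd j (crd b n))) (crd b) * crd b m
   - \sum_k gam k i j * pd k (crd b m)) u.
  rewrite /second_form !sum2E /lorA; push_ev.
  rewrite (pd_pd_coordinateE H b m i j Vu) (pd_pd_coordinateE H b 0 i j Vu) (pd_pd_coordinateE H b 1 i j Vu) (pd_pd_coordinateE H b 2 i j Vu).
  rewrite (pd_coordinateE H b m 0 Vu) (pd_coordinateE H b m 1 Vu) (coordinateE H b m Vu) (coordinateE H b 0 Vu) (coordinateE H b 1 Vu) (coordinateE H b 2 Vu).
  rewrite (christoffelE 0 i j Vu) (christoffelE 1 i j Vu).
  move: (gam 0 i j u) (gam 1 i j u) (partial 0 f u) (partial 1 f u) (f u) (partial i (partial j f) u).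
  move=> a c [x1 x2] [y1 y2] [z1 z2] [v1 v2].
  rewrite /pr_coord /pr /projHH /projH2; case: b => /=; rewrite !mxE /lor; ring.
have [_ _ _ g1 g2] := tframe_gram H b.
have -> : lorA (fun n => pd i (pd j (crd b n))) (crd b) = - (P b i * P b j + Q b i * Q b j).
  transitivity ((pd i (P b j) + Q b i * Q b j) * lorA (M1 b) (crd b)
    + (pd i (Q b j) - Q b i * P b j) * lorA (M2 b) (crd b)
    + (P b i * P b j + Q b i * Q b j) * lorA (crd b) (crd b)).
    by rewrite /lorA !pd_pd_coordinate; ring.
  by rewrite g1 g2 coordinate_lorA; ring.
congr (sm_val _ u).
rewrite pd_pd_coordinate !sum2E /TP /TQ /covariant !sum2E (pd_coordinate H b 0 m) (pd_coordinate H b 1 m).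
ring.
Qed.
End PatchMetric.

(** * Harmonicity of the two components *)

Lemma half_scale_eq0 (R : numFieldType) (W : lmodType R) (x : W) : 2^-1 *: x = 0 -> x = 0.
Proof. by move/eqP; rewrite scaler_eq0 invr_eq0 pnatr_eq0 => /eqP. Qed.

Lemma pr_coord_sum2 (R : realType) b m (c : 'I_2 -> 'I_2 -> R) (x : 'I_2 -> 'I_2 -> ambient R) :
  pr_coord b m (\sum_i \sum_j c i j *: x i j) = \sum_i \sum_j c i j * pr_coord b m (x i j).
Proof.
rewrite (linear_sum (pr_coord b m)); apply: eq_bigr => i _.
rewrite (linear_sum (pr_coord b m)); apply: eq_bigr => j _.
exact: (linearZ_LR (pr_coord b m)).
Qed.

Lemma ev_sum2 (R : realType) (V : plane_open R) (g : 'I_2 -> 'I_2 -> sm V) u :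
  (\sum_i \sum_j g i j) u = \sum_i \sum_j g i j u.
Proof. by rewrite !sum2E; push_ev. Qed.

Section PatchFrame.
Context (R : realType) (V : plane_open R) (f : 'rV[R]_2 -> ambient R) (K : R).
Hypothesis H : is_patch V f K.
Context (e s t ie it : sm V).
Hypothesis eie : e * ie = 1.
Hypothesis tit : t * it = 1.
Hypothesis gm : forall i j, coef_metric H i j = coframe_metric e s t i j.
Local Notation P := (coefP H).
Local Notation Q := (coefQ H).
Local Notation M1 := (tframe1 H).
Local Notation M2 := (tframe2 H).
Local Notation met := (coframe_metric e s t).
Local Notation imet := (coframe_cometric s t ie it).
Local Notation gam := (coframe_christoffel e s t ie it).
Local Notation cov := (covariant e s t ie it).
Local Notation E1 := (frame_d1 ie).
Local Notation E2 := (frame_d2 s ie it).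
Local Notation w1 := (frame_w1 e s ie it).
Local Notation w2 := (frame_w2 t ie it).
Local Notation fr1 := (frame_coef1 ie).
Local Notation fr2 := (frame_coef2 s ie it).
Local Notation TP := (second_coefP H e s t ie it).
Local Notation TQ := (second_coefQ H e s t ie it).

Definition frame_P1 b := fr1 (P b).
Local Notation P1 := frame_P1.
Definition frame_P2 b := fr2 (P b).
Local Notation P2 := frame_P2.
Definition frame_Q1 b := fr1 (Q b).
Local Notation Q1 := frame_Q1.
Definition frame_Q2 b := fr2 (Q b).
Local Notation Q2 := frame_Q2.
(** Defined by solving half of the equations of [frame_hessian]; the other half
    expresses symmetry and vanishing trace. *)
Definition hess_MP b := E1 (P1 b) + Q1 b ^+ 2 - w1 * P2 b.
Local Notation MP := hess_MP.
Definition hess_MQ b := E1 (Q1 b) - Q1 b * P1 b - w1 * Q2 b.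
Local Notation MQ := hess_MQ.
Definition hess_NP b := E1 (P2 b) + Q1 b * Q2 b + w1 * P1 b.
Local Notation NP := hess_NP.
Definition hess_NQ b := E1 (Q2 b) - Q1 b * P2 b + w1 * Q1 b.
Local Notation NQ := hess_NQ.
Definition jacobian b := P1 b * Q2 b - P2 b * Q1 b.

Lemma coframe_metric_sym i j : met i j = met j i.
Proof. by have [-> | ->] := ord2_cases i; have [-> | ->] := ord2_cases j; rewrite !coframe_metricE. Qed.

Lemma coframe_christoffel_sym k i j : gam k i j = gam k j i.
Proof.
rewrite /coframe_christoffel; congr (_ * _); apply: eq_bigr => l _; rewrite (coframe_metric_sym i j); congr (_ * _).
by ring.
Qed.

(** The Levi-Civita connection is torsion free. *)
Lemma covariant_antisym a i j : cov a i j - cov a j i = pd i (a j) - pd j (a i).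
Proof.
rewrite /covariant; under [X in _ - X - _]eq_bigr do rewrite coframe_christoffel_sym.
by ring.
Qed.

(** The mean curvature is the trace of the Hessians of the two factors, so it
    vanishes exactly when both are harmonic; the frame vectors M1 and M2 extract
    the components. *)
Lemma harmonic b : \sum_i \sum_j imet i j * TP b i j = 0 /\ \sum_i \sum_j imet i j * TQ b i j = 0.
Proof.
set tp := \sum_i _; set tq := \sum_i _.
have tpq m : tp * M1 b m + tq * M2 b m = 0.
  apply: smP => u Vu.
  have h : \sum_i \sum_j invmx (first_form f u) i j * pr_coord b m (second_form f i j u) = 0.
    rewrite -pr_coord_sum2; exact: etrans (congr1 (pr_coord b m) (half_scale_eq0 (patch_minimal H Vu))) (linear0 (pr_coord b m)).
  have -> : tp * M1 b m + tq * M2 b m =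
      \sum_i \sum_j imet i j * (TP b i j * M1 b m + TQ b i j * M2 b m).
    rewrite /tp /tq !mulr_suml -big_split; apply: eq_bigr => i _.
    rewrite !mulr_suml -big_split; apply: eq_bigr => j _.
    by rewrite (mulrDr (imet i j) (TP b i j * M1 b m) (TQ b i j * M2 b m)) !mulrA.
  have hE i j : (imet i j * (TP b i j * M1 b m + TQ b i j * M2 b m)) u =
      invmx (first_form f u) i j * pr_coord b m (second_form f i j u).
    by rewrite evM (invmx_first_form eie tit gm i j Vu) (second_formE eie tit gm b i j m Vu).
  rewrite ev_sum2 [RHS]ev0 -[RHS]h.
  by apply: eq_bigr => i _; apply: eq_bigr => j _; exact: hE.
have [g11 g12 g22 _ _] := tframe_gram H b.
split.
  transitivity (lorA (fun m => tp * M1 b m + tq * M2 b m) (M1 b)).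
    transitivity (tp * lorA (M1 b) (M1 b) + tq * lorA (M1 b) (M2 b)); first by rewrite g11 g12; ring.
    by rewrite /lorA; ring.
  by rewrite /lorA !tpq; ring.
transitivity (lorA (fun m => tp * M1 b m + tq * M2 b m) (M2 b)).
  transitivity (tp * lorA (M1 b) (M2 b) + tq * lorA (M2 b) (M2 b)); first by rewrite g12 g22; ring.
  by rewrite /lorA; ring.
by rewrite /lorA !tpq; ring.
Qed.

(** Traces with respect to the metric are sums over the orthonormal frame. *)
Lemma cometric_contract a b : \sum_i \sum_j imet i j * (a i * b j) = fr1 a * fr1 b + fr2 a * fr2 b.
Proof.
rewrite !sum2E !coframe_cometricE /frame_coef1 /frame_coef2.
transitivity (ie ^+ 2 * a 0 * b 0 * (t * it) ^+ 2 + it ^+ 2 * (a 1 - s * ie * a 0) * (b 1 - s * ie * b 0)).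
  by ring.
by rewrite tit; ring.
Qed.

(** Symmetry of the Hessian comes from closedness of P and the structure equation
    of Q, vanishing of its trace from minimality. *)
Lemma hessian_frame b : frame_hessian E1 E2 w1 w2 (P1 b) (P2 b) (Q1 b) (Q2 b) (MP b) (MQ b) (NP b) (NQ b).
Proof.
have [hP hQ] := harmonic b.
have cP : ie * it * (cov (P b) 0 1 - s * ie * cov (P b) 0 0) = ie * it * (cov (P b) 1 0 - s * ie * cov (P b) 0 0).
  have h := covariant_antisym (P b) 0 1; rewrite (pd_coefP_comm H b 0 1) subrr in h.
  by move/eqP: h; rewrite subr_eq0 => /eqP ->.
have cQ : ie * it * (cov (Q b) 0 1 - s * ie * cov (Q b) 0 0) =
  ie * it * (cov (Q b) 1 0 - s * ie * cov (Q b) 0 0) + Q1 b * P2 b - Q2 b * P1 b.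
  have h := covariant_antisym (Q b) 0 1; rewrite (pd_coefQ_comm H b 0 1) in h.
  have {}h : cov (Q b) 0 1 = cov (Q b) 1 0 - Q b 1 * P b 0 + Q b 0 * P b 1.
    by apply: (eq_sub h); ring.
  by rewrite h /Q1 /Q2 /P1 /P2 /frame_coef1 /frame_coef2; ring.
rewrite (covariant12 s eie tit) (covariant21 s eie tit) in cP.
rewrite (covariant12 s eie tit) (covariant21 s eie tit) in cQ.
have tr (a : 'I_2 -> sm V) (h k : 'I_2 -> sm V) (T : 'I_2 -> 'I_2 -> sm V) (sg : sm V) :
    (forall i j, T i j = cov a i j + sg * (h i * k j)) ->
  \sum_i \sum_j imet i j * T i j = \sum_i \sum_j imet i j * cov a i j + sg * \sum_i \sum_j imet i j * (h i * k j).
  by move=> TE; rewrite !sum2E !TE; ring.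
have {}hP : (E1 (P1 b) - w1 * P2 b) + (E2 (P2 b) + w2 * P1 b) + (Q1 b * Q1 b + Q2 b * Q2 b) = 0.
  rewrite -[RHS]hP (tr (P b) (Q b) (Q b) _ 1); last by move=> i j; rewrite mul1r.
  by rewrite (covariant_trace s eie tit) cometric_contract mul1r.
have {}hQ : (E1 (Q1 b) - w1 * Q2 b) + (E2 (Q2 b) + w2 * Q1 b) - (Q1 b * P1 b + Q2 b * P2 b) = 0.
  rewrite -[RHS]hQ (tr (Q b) (Q b) (P b) _ (-1)); last by move=> i j; rewrite mulN1r.
  by rewrite (covariant_trace s eie tit) cometric_contract mulN1r.
rewrite -/(P1 b) -/(P2 b) in cP; rewrite -/(Q1 b) -/(Q2 b) in cQ.
exact: frame_hessian_intro cP cQ hP hQ.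
Qed.

End PatchFrame.

(** * The Jacobian is constant and the patch is totally geodesic *)

Lemma crossAE (A : comPzRingType) (a b : 'I_3 -> A) :
  (crossA a b 0 = a 2 * b 1 - a 1 * b 2) * (crossA a b 1 = a 2 * b 0 - a 0 * b 2) *
  (crossA a b 2 = a 0 * b 1 - a 1 * b 0).
Proof. by []. Qed.

(** The Gram matrices of the two factors are G and 1 - G with equal determinants,
    and det (1 - G) = 1 - tr G + det G. *)
Lemma unit_energy (A : comPzRingType) (p1 p2 q1 q2 r1 r2 s1 s2 : A) :
  p1 ^+ 2 + q1 ^+ 2 + (r1 ^+ 2 + s1 ^+ 2) = 1 ->
  p1 * p2 + q1 * q2 + (r1 * r2 + s1 * s2) = 0 ->
  p2 ^+ 2 + q2 ^+ 2 + (r2 ^+ 2 + s2 ^+ 2) = 1 ->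
  p1 * q2 - p2 * q1 = r1 * s2 - r2 * s1 ->
  p1 ^+ 2 + p2 ^+ 2 + q1 ^+ 2 + q2 ^+ 2 = 1 /\ r1 ^+ 2 + r2 ^+ 2 + s1 ^+ 2 + s2 ^+ 2 = 1.
Proof.
move=> h1 h2 h3 hj.
have en : p1 ^+ 2 + p2 ^+ 2 + q1 ^+ 2 + q2 ^+ 2 = 1.
  (* The entries of the Gram matrix of the first component. *)
  pose p := p1 ^+ 2 + q1 ^+ 2; pose q := p2 ^+ 2 + q2 ^+ 2; pose r := p1 * p2 + q1 * q2.
  have jt : (p1 * q2 - p2 * q1) ^+ 2 = p * q - r ^+ 2 by rewrite /p /q /r; ring.
  have jf : (r1 * s2 - r2 * s1) ^+ 2 = (1 - p) * (1 - q) - r ^+ 2.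
    have -> : 1 - p = r1 ^+ 2 + s1 ^+ 2 by rewrite -h1 /p; ring.
    have -> : 1 - q = r2 ^+ 2 + s2 ^+ 2 by rewrite -h3 /q; ring.
    have -> : r = - (r1 * r2 + s1 * s2) by apply: (eq_sub h2); rewrite /r; ring.
    by ring.
  rewrite hj jf in jt.
  by apply: (eq_sub (esym jt)); rewrite /p /q; ring.
split=> //.
by apply: (eq_sub (congr2 (fun a b => a - b) (congr2 +%R h1 h3) en)); ring.
Qed.

Section PatchRigidity.
Context (R : realType) (V : plane_open R) (f : 'rV[R]_2 -> ambient R) (K : R).
Hypothesis H : is_patch V f K.
Context (e s t ie it : sm V).
Hypothesis eie : e * ie = 1.
Hypothesis tit : t * it = 1.
Hypothesis gm : forall i j, coef_metric H i j = coframe_metric e s t i j.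
Local Notation P := (coefP H).
Local Notation Q := (coefQ H).
Local Notation cov := (covariant e s t ie it).
Local Notation E1 := (frame_d1 ie).
Local Notation E2 := (frame_d2 s ie it).
Local Notation w1 := (frame_w1 e s ie it).
Local Notation w2 := (frame_w2 t ie it).
Local Notation TP := (second_coefP H e s t ie it).
Local Notation TQ := (second_coefQ H e s t ie it).
Local Notation P1 := (frame_P1 H ie).
Local Notation P2 := (frame_P2 H s ie it).
Local Notation Q1 := (frame_Q1 H ie).
Local Notation Q2 := (frame_Q2 H s ie it).
Local Notation MP := (hess_MP H e s ie it).
Local Notation MQ := (hess_MQ H e s ie it).
Local Notation NP := (hess_NP H e s ie it).
Local Notation NQ := (hess_NQ H e s ie it).
Local Notation jac := (jacobian H s ie it).

(** The pulled back metrics of the two factors add up to the identity matrix in an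
    orthonormal frame. *)
Lemma frame_gram :
  [/\ P1 true ^+ 2 + Q1 true ^+ 2 + (P1 false ^+ 2 + Q1 false ^+ 2) = 1,
      P1 true * P2 true + Q1 true * Q2 true + (P1 false * P2 false + Q1 false * Q2 false) = 0
    & P2 true ^+ 2 + Q2 true ^+ 2 + (P2 false ^+ 2 + Q2 false ^+ 2) = 1].
Proof.
exact: (coframe_gram eie tit (a := P true) (b := Q true) (c := P false) (d := Q false)
  (gm 0 0) (gm 0 1) (gm 1 1)).
Qed.

Lemma lor_cross_partial b i j u : plane_set V u ->
  lor (lcross (pr b (f u)) (pr b (partial i f u))) (pr b (partial j f u)) =
  (P b i * Q b j - Q b i * P b j) u.
Proof.
move=> Vu; rewrite -(lor_cross_pd H b i j) /lorA !crossAE; push_ev.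
rewrite (pd_coordinateE H b 0 i Vu) (pd_coordinateE H b 1 i Vu) (pd_coordinateE H b 2 i Vu).
rewrite (pd_coordinateE H b 0 j Vu) (pd_coordinateE H b 1 j Vu) (pd_coordinateE H b 2 j Vu).
rewrite (coordinateE H b 0 Vu) (coordinateE H b 1 Vu) (coordinateE H b 2 Vu).
by rewrite lorE /lorA !lcrossE.
Qed.

(** The complex structure has opposite signs on the two factors, so the vanishing
    of the symplectic form equates the two pulled back area forms. *)
Lemma jacobian_eq : jac true = jac false.
Proof.
have h : P true 0 * Q true 1 - Q true 0 * P true 1 = P false 0 * Q false 1 - Q false 0 * P false 1.
  apply: smP => u Vu; rewrite -!(lor_cross_partial _ _ _ Vu).
  have df := patch_differentiable H Vu.
  have := patch_lagrangian H Vu (delta_mx 0 0) (delta_mx 0 1).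
  rewrite -!deriveE // -/(partial 0 f u) -/(partial 1 f u) /dot /J /JH2 /= opprK sqrtr1 !scale1r.
  have lN (a b : 'rV[R]_3) : lor (- a) b = - lor a b by rewrite /lor !mxE; ring.
  by rewrite lN => /eqP; rewrite subr_eq0 => /eqP.
rewrite /jacobian /frame_P1 /frame_P2 /frame_Q1 /frame_Q2 /frame_coef1 /frame_coef2.
by apply: (eq_sub (congr1 (fun z => ie * it * z) h)); ring.
Qed.

Lemma energy b : P1 b ^+ 2 + P2 b ^+ 2 + Q1 b ^+ 2 + Q2 b ^+ 2 = 1.
Proof.
have [h1 h2 h3] := frame_gram; have hj := jacobian_eq.
have [ht hf] := unit_energy h1 h2 h3 hj.
by case: b.
Qed.

Lemma sm_reduced (h : sm V) : h * h = 0 -> h = 0.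
Proof.
move=> hh; apply: smP => u Vu; have := congr1 (fun k : sm V => k u) hh.
by push_ev => /eqP; rewrite mulf_eq0 => /orP[] /eqP.
Qed.

Let K0 i : pd i (sm_cst V K) = 0. Proof. exact: pd_cst. Qed.

Let Kc1 : E1 (sm_cst V K) = 0.
Proof. by rewrite /frame_d1 /frame_coef1 K0; ring. Qed.
Let Kc2 : E2 (sm_cst V K) = 0.
Proof. by rewrite /frame_d2 /frame_coef2 !K0; ring. Qed.

Let F := frame_is_orthonormal eie tit gm.

(** Both |grad c|^2 and Lap c are polynomials in c. *)
Lemma jacobian_gradient0 b : E1 (jac b) ^+ 2 + E2 (jac b) ^+ 2 = 0.
Proof.
have hf := hessian_frame eie tit gm b.
have hG := jacobian_gradient F hf (@sm_torsion_free R V) (energy b).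
have hL := jacobian_laplacian F hf (@sm_torsion_free R V) (energy b).
exact: (isoparametric_gradient0 F (@sm_torsion_free R V) Kc1 Kc2 hG hL sm_reduced).
Qed.

(** Since grad c = 0, both the gradient and the Laplacian formulas are algebraic
    equations for c and K. *)
Lemma jacobian_rigid b u : plane_set V u ->
  K + 2 * jac b u ^+ 2 = 0 /\ jac b u * (1 - 4 * jac b u ^+ 2) = 0.
Proof.
move=> Vu.
have hf := hessian_frame eie tit gm b.
have hG := jacobian_gradient F hf (@sm_torsion_free R V) (energy b).
have hL := jacobian_laplacian F hf (@sm_torsion_free R V) (energy b).
have h0 := jacobian_gradient0 b.
rewrite -/(jac b) h0 in hG.
have [e1 e2] : E1 (jac b) = 0 /\ E2 (jac b) = 0.
  have sq v : plane_set V v -> E1 (jac b) v = 0 /\ E2 (jac b) v = 0.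
    move=> Vv; have := congr1 (fun h : sm V => h v) h0; push_ev => /eqP.
    by rewrite paddr_eq0 ?sqr_ge0 // !sqrf_eq0 => /andP[/eqP -> /eqP ->].
  by split; apply: smP => v /sq [].
rewrite -/(jac b) /laplacian e1 e2 (der0 (frame_d1_derivation ie)) (der0 (frame_d2_derivation s ie it)) in hL.
have := congr1 (fun h : sm V => h u) hG; have := congr1 (fun h : sm V => h u) hL.
push_ev; move: (jac b u) (w1 u) (w2 u) => c a1 a2.
rewrite !mulr0 !addr0 subr0 => /esym/eqP hL' /esym/eqP hG'.
have {}hG' : (1 - 4 * c ^+ 2) * (K + 2 * c ^+ 2) == 0 by move: hG'; rewrite oppr_eq0.
(* Where 4 c^2 = 1, the Laplacian forces K = - 1/2 = - 2 c^2 as well. *)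
have kc : K + 2 * c ^+ 2 = 0.
  move: hG'; rewrite mulf_eq0 => /orP[/eqP c4|/eqP //].
  have c0 : c != 0 by apply/eqP => c0; move/eqP: c4; rewrite c0 expr0n /= mulr0 subr0 oner_eq0.
  by move: hL'; rewrite mulf_eq0 (negbTE c0) /= => /eqP; lra.
split=> //; move/eqP: hL' => <-.
have -> : K = - (2 * c ^+ 2) by apply: (eq_sub kc); ring.
by ring.
Qed.

(** By [hessian_norm] the squared norm of the Hessian is - (K + 2 c^2) = 0. *)
Lemma hessian_zero b : [/\ MP b = 0, MQ b = 0, NP b = 0 & NQ b = 0].
Proof.
have hf := hessian_frame eie tit gm b.
have hn := hessian_norm F hf (@sm_torsion_free R V) (energy b).
have z u : plane_set V u -> [/\ MP b u = 0, MQ b u = 0, NP b u = 0 & NQ b u = 0].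
  move=> Vu; have := congr1 (fun h : sm V => h u) hn; rewrite -/(jac b); push_ev.
  rewrite (jacobian_rigid b Vu).1 oppr0 => /eqP; rewrite mulf_eq0 pnatr_eq0 /= -!addrA addrA => /eqP.
  exact: sum4_sqr_eq0.
by split; apply: smP => u /z [h1 h2 h3 h4]; rewrite ev0 //.
Qed.

(** The vanishing of the Hessian on the frame vectors, carried back to coordinates. *)
Lemma second_coef0 b i j : TP b i j = 0 /\ TQ b i j = 0.
Proof.
have [mp mq np nq] := hessian_zero b.
have := hessian_frame eie tit gm b; rewrite mp mq np nq.
move=> /frame_hessian0 [[a1 a2 a3 a4] [b1 b2 b3 b4]].
have gen := coframe_tensor_eq0 (s := s) eie tit.
split.
  apply: (gen (TP b) (cov (P b)) (Q b) (Q b) 1) i j => [i j||||].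
  - by rewrite mul1r.
  - by rewrite (covariant11 s eie tit); exact: a1.
  - by rewrite (covariant12 s eie tit); exact: a2.
  - by rewrite (covariant21 s eie tit); exact: a3.
  - by rewrite (covariant22 s eie tit); exact: a4.
apply: (gen (TQ b) (cov (Q b)) (Q b) (P b) (-1)) i j => [i j||||].
- by rewrite mulN1r.
- by rewrite (covariant11 s eie tit); exact: b1.
- by rewrite (covariant12 s eie tit); exact: b2.
- by rewrite (covariant21 s eie tit); exact: b3.
- by rewrite (covariant22 s eie tit); exact: b4.
Qed.

Lemma second_form0 i j u : plane_set V u -> second_form f i j u = 0.
Proof.
move=> Vu; apply: ambient_eq => b m.
rewrite (second_formE eie tit gm b i j m Vu) (second_coef0 b i j).1 (second_coef0 b i j).2.
by rewrite (linear0 (pr_coord b m)); push_ev; rewrite !mul0r addr0.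
Qed.

End PatchRigidity.

(** * Lorentz frames and Lorentz matrices *)

Section Lorentz.
Context (R : realType).
Implicit Types x y z w : 'rV[R]_3.

Lemma lcrossE' x y : (lcross x y 0 0 = x 0 2 * y 0 1 - x 0 1 * y 0 2) *
  (lcross x y 0 1 = x 0 2 * y 0 0 - x 0 0 * y 0 2) * (lcross x y 0 2 = x 0 0 * y 0 1 - x 0 1 * y 0 0).
Proof. by rewrite !mxE. Qed.

Lemma lorC x y : lor x y = lor y x.
Proof. by rewrite /lor; ring. Qed.

Lemma lor_crossl x y : lor (lcross x y) x = 0.
Proof. by rewrite /lor !lcrossE'; ring. Qed.
Lemma lor_crossr x y : lor (lcross x y) y = 0.
Proof. by rewrite /lor !lcrossE'; ring. Qed.

Lemma lor_cross_cross x y : lor (lcross x y) (lcross x y) = lor x y ^+ 2 - lor x x * lor y y.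
Proof. by rewrite /lor !lcrossE'; ring. Qed.

(** The matrix of the Lorentzian scalar product. *)
Definition eta : 'M[R]_3 := diag_mx (\row_j (if j == 0 then -1 else 1)).

Lemma etaK : eta *m eta = 1%:M.
Proof.
apply/matrixP => i j; rewrite /eta mul_diag_mx !mxE.
by case: (i == j); rewrite ?mulr0n ?mulr1n ?mulr0 //; case: ifP => _; ring.
Qed.

Lemma lor_eta x y : lor x y = (x *m eta *m y^T) 0 0.
Proof.
rewrite mxE sum3E /eta !mul_mx_diag !mxE /=.
by rewrite /lor; ring.
Qed.

(** Rows are used because matrices act on row vectors from the right. *)
Definition frame_mx x y z : 'M[R]_3 := \matrix_(i, j) nth 0 [:: x; y; z] i 0 j.

(** A point of the hyperboloid (up to sign) and a unit tangent vector; the third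
    vector of the frame is their cross product. *)
Definition lorentz_frame x y : Prop := [/\ lor x x = -1, lor y y = 1 & lor x y = 0].

Lemma frame_mx_row x y z : (row 0 (frame_mx x y z) = x) * (row 1 (frame_mx x y z) = y) * (row 2 (frame_mx x y z) = z).
Proof. by do !split; apply/rowP => j; rewrite !mxE. Qed.

Lemma frame_mx_eta x y : lorentz_frame x y -> let N := frame_mx x y (lcross x y) in
  N *m eta *m N^T = eta.
Proof.
move=> [xx yy xy] N.
have zz : lor (lcross x y) (lcross x y) = 1 by rewrite lor_cross_cross xx yy xy; ring.
have zx := lor_crossl x y; have zy := lor_crossr x y.
have NE (i j : 'I_3) : (N *m eta *m N^T) i j = lor (row i N) (row j N).
  by rewrite lor_eta !mxE; apply: eq_bigr => k _; rewrite -row_mul !mxE.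
apply/matrixP => i j; rewrite NE /eta !mxE.
have yx : lor y x = 0 by rewrite lorC.
have xz : lor x (lcross x y) = 0 by rewrite lorC.
have yz : lor y (lcross x y) = 0 by rewrite lorC.
by case: (ord3_cases i) => ->; case: (ord3_cases j) => ->; rewrite !frame_mx_row ?(xx, yy, zz, xy, yx, zx, zy, xz, yz).
Qed.

Lemma det3E (N : 'M[R]_3) : \det N = lor (lcross (row 0 N) (row 1 N)) (row 2 N).
Proof.
have l00 : lift (0 : 'I_3) (0 : 'I_2) = 1 by exact: val_inj.
have l01 : lift (0 : 'I_3) (1 : 'I_2) = 2 by exact: val_inj.
have l10 : lift (1 : 'I_3) (0 : 'I_2) = 0 by exact: val_inj.
have l11 : lift (1 : 'I_3) (1 : 'I_2) = 2 by exact: val_inj.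
have l20 : lift (2 : 'I_3) (0 : 'I_2) = 0 by exact: val_inj.
have l21 : lift (2 : 'I_3) (1 : 'I_2) = 1 by exact: val_inj.
rewrite (expand_det_row _ 0) sum3E /cofactor !det2E !mxE l00 l01 l10 l11 l20 l21.
rewrite /lor !lcrossE' !mxE !add0n expr0 expr1 expr2.
ring.
Qed.

Lemma frame_mx_det x y : lorentz_frame x y -> \det (frame_mx x y (lcross x y)) = 1.
Proof.
move=> [xx yy xy]; rewrite det3E !frame_mx_row lor_cross_cross xx yy xy; ring.
Qed.

(** The determinant condition makes the matrix compatible with the cross product,
    hence with the complex structure of the hyperbolic plane. *)
Definition special_lorentz (A : 'M[R]_3) : Prop := A *m eta *m A^T = eta /\ \det A = 1.

Lemma special_lorentz_lor A x y : special_lorentz A -> lor (x *m A) (y *m A) = lor x y.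
Proof.
move=> [h _]; rewrite !lor_eta trmx_mul.
have -> : x *m A *m eta *m (A^T *m y^T) = x *m (A *m eta *m A^T) *m y^T by rewrite !mulmxA.
by rewrite h.
Qed.

Lemma lor_cross_mulmx (A : 'M[R]_3) x y w :
  lor (lcross (x *m A) (y *m A)) (w *m A) = \det A * lor (lcross x y) w.
Proof.
rewrite det3E /lor !lcrossE' !mxE !sum3E ?mxE.
ring.
Qed.

Lemma lor_nondeg x : (forall y, lor x y = 0) -> x = 0.
Proof.
move=> h; apply/rowP => j; rewrite mxE.
have := h (delta_mx 0 j); rewrite /lor !mxE.
by case: (ord3_cases j) => -> /=; rewrite ?mulr0 ?mulr1 ?oppr0 ?add0r ?addr0 // => /eqP; rewrite oppr_eq0 => /eqP.
Qed.

(** The inverse of a Lorentz matrix, as a transpose with respect to the Lorentzian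
    scalar product. *)
Definition lorentz_inv (A : 'M[R]_3) : 'M[R]_3 := eta *m A^T *m eta.

Lemma lorentz_invr A : special_lorentz A -> A *m lorentz_inv A = 1%:M.
Proof. by move=> [h _]; rewrite /lorentz_inv !mulmxA h etaK. Qed.

Lemma lorentz_invl A : special_lorentz A -> lorentz_inv A *m A = 1%:M.
Proof. by move=> /lorentz_invr /mulmx1C. Qed.

(** The cross product is determined by the scalar product and the determinant. *)
Lemma special_lorentz_cross A x y : special_lorentz A ->
  lcross (x *m A) (y *m A) = lcross x y *m A.
Proof.
move=> hA; apply/eqP; rewrite -subr_eq0; apply/eqP/lor_nondeg => w.
have lB (a b c : 'rV[R]_3) : lor (a - b) c = lor a c - lor b c by rewrite /lor !mxE; ring.
have <- : w *m lorentz_inv A *m A = w by rewrite -mulmxA lorentz_invl // mulmx1.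
rewrite lB lor_cross_mulmx hA.2 (special_lorentz_lor _ _ hA); ring.
Qed.

Lemma tr_eta : eta^T = eta.
Proof. exact: tr_diag_mx. Qed.

Lemma lorentz_inv_special A : special_lorentz A -> special_lorentz (lorentz_inv A).
Proof.
move=> hA; have h := lorentz_invl hA; split.
  rewrite /lorentz_inv !trmx_mul !trmxK tr_eta.
  transitivity (eta *m A^T *m (eta *m eta) *m eta *m A *m eta); first by rewrite ?mulmxA.
  rewrite etaK mulmx1; transitivity (lorentz_inv A *m A *m eta); last by rewrite h mul1mx.
  by rewrite /lorentz_inv ?mulmxA.
have := congr1 (fun M => \det M) h; rewrite det_mulmx hA.2 mulr1 det1 //.
Qed.

(** With N and N' the matrices of the two frames, which are themselves Lorentz
    matrices of determinant 1, take the product of the inverse of N with N'. *)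
Lemma lorentz_frame_map x y x' y' : lorentz_frame x y -> lorentz_frame x' y' ->
  let A := lorentz_inv (frame_mx x y (lcross x y)) *m frame_mx x' y' (lcross x' y') in
  [/\ special_lorentz A, x *m A = x', y *m A = y' & lcross x y *m A = lcross x' y'].
Proof.
move=> F F' A; pose N := frame_mx x y (lcross x y); pose N' := frame_mx x' y' (lcross x' y').
have hN : special_lorentz N by split; [exact: frame_mx_eta|exact: frame_mx_det].
have hN' : special_lorentz N' by split; [exact: frame_mx_eta|exact: frame_mx_det].
have NA : N *m A = N' by rewrite /A mulmxA lorentz_invr // mul1mx.
split.
- have [e d] := lorentz_inv_special hN; have [e' d'] := hN'.
  split; last by rewrite det_mulmx d d' mulr1.
  rewrite /A trmx_mul; transitivity (lorentz_inv N *m (N' *m eta *m N'^T) *m (lorentz_inv N)^T).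
    by rewrite !mulmxA.
  by rewrite e'.
- by have := congr1 (row 0) NA; rewrite row_mul !frame_mx_row.
- by have := congr1 (row 1) NA; rewrite row_mul !frame_mx_row.
by have := congr1 (row 2) NA; rewrite row_mul !frame_mx_row.
Qed.

(** An expression of this matrix that can be differentiated when the frames move. *)
Lemma lorentz_frame_mapE x y x' y' (n m : 'I_3) :
  (lorentz_inv (frame_mx x y (lcross x y)) *m frame_mx x' y' (lcross x' y')) n m =
  (if n == 0 then -1 else 1) * (- (x 0 n * x' 0 m) + y 0 n * y' 0 m + lcross x y 0 n * lcross x' y' 0 m).
Proof.
have E (k : 'I_3) : lorentz_inv (frame_mx x y (lcross x y)) n k =
   (if n == 0 then -1 else 1) * frame_mx x y (lcross x y) k n * (if k == 0 then -1 else 1).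
  by rewrite /lorentz_inv /eta mul_mx_diag mul_diag_mx !mxE.
rewrite mxE sum3E !E !mxE /=; case: ifP => _; ring.
Qed.

Lemma lorentz_frame_decomp x y w : lorentz_frame x y ->
  w = - lor w x *: x + lor w y *: y + lor w (lcross x y) *: lcross x y.
Proof.
move=> F; have [_ hx hy hz] := lorentz_frame_map F F.
rewrite -[LHS]mulmx1 -(lorentz_invl (A := frame_mx x y (lcross x y))); last first.
  by split; [exact: frame_mx_eta|exact: frame_mx_det].
apply/rowP => m; rewrite [LHS]mxE sum3E !lorentz_frame_mapE !mxE /lor ?lcrossE' /=; ring.
Qed.

(** Reversed Cauchy-Schwarz inequality for future pointing time-like vectors. *)
Lemma H2_lor_lt0 x y : H2 (-1) x -> H2 (-1) y -> lor x y < 0.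
Proof.
rewrite /H2 /= invrN invr1 /lor => -[hx x0] [hy y0].
rewrite ltNge; apply/negP => h.
have h1 : 0 < x 0 0 * y 0 0 by rewrite mulr_gt0.
have h2 : (x 0 0 * y 0 0) ^+ 2 <= (x 0 1 * y 0 1 + x 0 2 * y 0 2) ^+ 2.
  by rewrite ler_pXn2r // ?nnegrE; lra.
have h3 : 0 <= (x 0 1 * y 0 2 - x 0 2 * y 0 1) ^+ 2 by exact: sqr_ge0.
have h4 : x 0 0 ^+ 2 = 1 + x 0 1 ^+ 2 + x 0 2 ^+ 2 by rewrite !expr2; lra.
have h5 : y 0 0 ^+ 2 = 1 + y 0 1 ^+ 2 + y 0 2 ^+ 2 by rewrite !expr2; lra.
rewrite exprMn h4 h5 in h2.
have := sqr_ge0 (x 0 1); have := sqr_ge0 (x 0 2); have := sqr_ge0 (y 0 1); have := sqr_ge0 (y 0 2).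
nra.
Qed.

Lemma lor_lt0_H2 x y : lor x x = -1 -> H2 (-1) y -> lor x y < 0 -> H2 (-1) x.
Proof.
move=> hx hy xy; rewrite /H2 /= invrN invr1; split=> //.
rewrite ltNge; apply/negP => x0.
have x00 : x 0 0 != 0.
  apply/eqP => x00; move: hx; rewrite /lor x00.
  by have := sqr_ge0 (x 0 1); have := sqr_ge0 (x 0 2); rewrite !expr2; lra.
have : lor (- x) y < 0.
  apply: H2_lor_lt0 => //; rewrite /H2 /= invrN invr1; split.
    by rewrite -hx /lor !mxE; ring.
  by rewrite mxE oppr_gt0 lt_neqAle x00.
have -> : lor (- x) y = - lor x y by rewrite /lor !mxE; ring.
by rewrite oppr_lt0 ltNge (ltW xy).
Qed.

(** A Lorentz matrix preserves or exchanges the two sheets of the hyperboloid; one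
    point decides which. *)
Lemma special_lorentz_H2 A x0 : special_lorentz A -> H2 (-1) x0 -> H2 (-1) (x0 *m A) ->
  forall x, H2 (-1) x -> H2 (-1) (x *m A).
Proof.
move=> hA h0 h0A x hx; apply: (@lor_lt0_H2 _ (x0 *m A)) => //.
  by rewrite special_lorentz_lor //; case: hx; rewrite invrN invr1.
by rewrite special_lorentz_lor //; exact: H2_lor_lt0.
Qed.

End Lorentz.

(** * Images of the tangent frame under the two components *)

Section Rows.
Context (R : realType) (V : plane_open R).
Definition row_at (g : 'I_3 -> sm V) (u : 'rV[R]_2) : 'rV[R]_3 := \row_m g m u.
Lemma lor_row_at g h u : lor (row_at g u) (row_at h u) = lorA g h u.
Proof. by rewrite /lor /lorA !mxE; push_ev. Qed.
Lemma cross_row_at g h u : lcross (row_at g u) (row_at h u) = row_at (crossA g h) u.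
Proof.
by apply/rowP => m; case: (ord3_cases m) => ->; rewrite lcrossE' !mxE !crossAE; push_ev.
Qed.
Lemma row_at_near_cst (g : 'I_3 -> sm V) u : plane_set V u -> (forall i m, pd i (g m) = 0) ->
  \forall v \near u, row_at g v = row_at g u.
Proof.
move=> Vu g0.
have : nbhs u [set v | forall m, g m v = g m u].
  have h m : nbhs u [set v | g m v = g m u] := @pd0_locally_cst _ _ (g m) u Vu (fun i => g0 i m).
  exact: (@filter_forall _ 'I_3 (fun m => [set v | g m v = g m u]) (nbhs u) (nbhs_filter u) h).
by apply: filterS => v h; apply/rowP => m; rewrite !mxE h.
Qed.
End Rows.

Section PatchFrames.
Context (R : realType) (V : plane_open R) (f : 'rV[R]_2 -> ambient R) (K : R).
Hypothesis H : is_patch V f K.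
Context (e s t ie it : sm V).
Hypothesis eie : e * ie = 1.
Hypothesis tit : t * it = 1.
Hypothesis gm : forall i j, coef_metric H i j = coframe_metric e s t i j.
Local Notation M1 := (tframe1 H).
Local Notation M2 := (tframe2 H).
Local Notation crd := (coordinate H).
Local Notation E1 := (frame_d1 ie).
Local Notation E2 := (frame_d2 s ie it).
Local Notation w1 := (frame_w1 e s ie it).
Local Notation w2 := (frame_w2 t ie it).
Local Notation P1 := (frame_P1 H ie).
Local Notation P2 := (frame_P2 H s ie it).
Local Notation Q1 := (frame_Q1 H ie).
Local Notation Q2 := (frame_Q2 H s ie it).
Local Notation jac := (jacobian H s ie it).

(** The image of the first frame vector under the b-th factor. *)
Definition tangent1 b m := P1 b * M1 b m + Q1 b * M2 b m.
Local Notation p1 := tangent1.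
Definition tangent2 b m := P2 b * M1 b m + Q2 b * M2 b m.
Local Notation p2 := tangent2.
(** The cross product of the position vector with the image of the frame vector. *)
Definition normal1 b m := P1 b * M2 b m - Q1 b * M1 b m.
Local Notation n1 := normal1.
Definition normal2 b m := P2 b * M2 b m - Q2 b * M1 b m.
Local Notation n2 := normal2.

Lemma frame_d1_coordinate b m : E1 (crd b m) = p1 b m.
Proof. by rewrite /frame_d1 /frame_coef1 pd_coordinate /p1 /frame_P1 /frame_Q1 /frame_coef1; ring. Qed.
Lemma frame_d2_coordinate b m : E2 (crd b m) = p2 b m.
Proof. by rewrite /frame_d2 /frame_coef2 !pd_coordinate /p2 /frame_P2 /frame_Q2 /frame_coef2; ring. Qed.
Let E1_M1 b m : E1 (M1 b m) = - Q1 b * M2 b m + P1 b * crd b m.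
Proof. by rewrite /frame_d1 /frame_coef1 pd_tframe1 /frame_P1 /frame_Q1 /frame_coef1; ring. Qed.
Let E2_M1 b m : E2 (M1 b m) = - Q2 b * M2 b m + P2 b * crd b m.
Proof. by rewrite /frame_d2 /frame_coef2 !pd_tframe1 /frame_P2 /frame_Q2 /frame_coef2; ring. Qed.
Let E1_M2 b m : E1 (M2 b m) = Q1 b * (M1 b m + crd b m).
Proof. by rewrite /frame_d1 /frame_coef1 pd_tframe2 /frame_P1 /frame_Q1 /frame_coef1; ring. Qed.
Let E2_M2 b m : E2 (M2 b m) = Q2 b * (M1 b m + crd b m).
Proof. by rewrite /frame_d2 /frame_coef2 !pd_tframe2 /frame_P2 /frame_Q2 /frame_coef2; ring. Qed.

Let F := frame_is_orthonormal eie tit gm.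

Let parallel b : frame_hessian E1 E2 w1 w2 (P1 b) (P2 b) (Q1 b) (Q2 b) 0 0 0 0.
Proof.
have [mp mq np nq] := hessian_zero eie tit gm b.
by have := hessian_frame eie tit gm b; rewrite mp mq np nq.
Qed.

Lemma tangent_derivatives b m :
  (E1 (p1 b m) = w1 * p2 b m + (P1 b ^+ 2 + Q1 b ^+ 2) * crd b m) *
  (E2 (p1 b m) = w2 * p2 b m + (P1 b * P2 b + Q1 b * Q2 b) * crd b m) *
  (E1 (p2 b m) = - w1 * p1 b m + (P1 b * P2 b + Q1 b * Q2 b) * crd b m) *
  (E2 (p2 b m) = - w2 * p1 b m + (P2 b ^+ 2 + Q2 b ^+ 2) * crd b m).
Proof.
exact: (parallel_tangents F (parallel b) (E1_M1 b m) (E2_M1 b m) (E1_M2 b m) (E2_M2 b m)).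
Qed.

Lemma normal_derivatives b m : jac b = 0 ->
  (E1 (n1 b m) = w1 * n2 b m) * (E2 (n1 b m) = w2 * n2 b m) *
  (E1 (n2 b m) = - w1 * n1 b m) * (E2 (n2 b m) = - w2 * n1 b m).
Proof.
exact: (parallel_normals F (parallel b) (E1_M1 b m) (E2_M1 b m) (E1_M2 b m) (E2_M2 b m)).
Qed.

End PatchFrames.

(** * Curvature - 1/2: the components differ by a Lorentz matrix *)

(** (p1, p2) is a pair of orthogonal vectors of squared norm 1/2 in the plane of
    (m1, m2), so the rotation of p1 is p2 up to the sign 2 (P1 Q2 - P2 Q1). *)
Lemma homothety_frame (A : comPzRingType) (x m1 m2 : 'I_3 -> A) (P1 P2 Q1 Q2 : A) :
  [/\ lorA m1 m1 = 1, lorA m1 m2 = 0, lorA m2 m2 = 1, lorA m1 x = 0 & lorA m2 x = 0] ->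
  (forall m, crossA x m1 m = m2 m) -> (forall m, crossA x m2 m = - m1 m) ->
  [/\ 2 * (P1 ^+ 2 + Q1 ^+ 2) = 1, 2 * (P2 ^+ 2 + Q2 ^+ 2) = 1 & P1 * P2 + Q1 * Q2 = 0] ->
  let p1 m := P1 * m1 m + Q1 * m2 m in let p2 m := P2 * m1 m + Q2 * m2 m in
  [/\ lorA x p1 = 0, 2 * lorA p1 p1 = 1
    & forall m, crossA x p1 m = 2 * (P1 * Q2 - P2 * Q1) * p2 m].
Proof.
move=> [g11 g12 g22 g1 g2] c1 c2 [h1 h2 h3] p1 p2; split.
- transitivity (P1 * lorA m1 x + Q1 * lorA m2 x); first by rewrite /lorA /p1; ring.
  by rewrite g1 g2; ring.
- rewrite -[RHS]h1; congr (2 * _).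
  transitivity (P1 ^+ 2 * lorA m1 m1 + 2 * P1 * Q1 * lorA m1 m2 + Q1 ^+ 2 * lorA m2 m2).
    by rewrite /lorA /p1; ring.
  by rewrite g11 g12 g22; ring.
move=> m; have -> : crossA x p1 m = P1 * m2 m - Q1 * m1 m.
  transitivity (P1 * crossA x m1 m + Q1 * crossA x m2 m); last by rewrite c1 c2; ring.
  by case: (ord3_cases m) => ->; rewrite !crossAE /p1; ring.
have k1 : 2 * (P1 * Q2 - P2 * Q1) * P2 = - Q1.
  transitivity (- Q1 * (2 * (P2 ^+ 2 + Q2 ^+ 2)) + 2 * Q2 * (P1 * P2 + Q1 * Q2)); first by ring.
  by rewrite h2 h3; ring.
have k2 : 2 * (P1 * Q2 - P2 * Q1) * Q2 = P1.
  transitivity (P1 * (2 * (P2 ^+ 2 + Q2 ^+ 2)) - 2 * P2 * (P1 * P2 + Q1 * Q2)); first by ring.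
  by rewrite h2 h3; ring.
by rewrite /p2 mulrDr !mulrA k1 k2; ring.
Qed.

Section PatchLocal.
Context (R : realType) (V : plane_open R) (f : 'rV[R]_2 -> ambient R) (K : R).
Hypothesis H : is_patch V f K.
Context (e s t ie it : sm V).
Hypothesis eie : e * ie = 1.
Hypothesis tit : t * it = 1.
Hypothesis gm : forall i j, coef_metric H i j = coframe_metric e s t i j.
Local Notation M1 := (tframe1 H).
Local Notation M2 := (tframe2 H).
Local Notation crd := (coordinate H).
Local Notation E1 := (frame_d1 ie).
Local Notation E2 := (frame_d2 s ie it).
Local Notation P1 := (frame_P1 H ie).
Local Notation P2 := (frame_P2 H s ie it).
Local Notation Q1 := (frame_Q1 H ie).
Local Notation Q2 := (frame_Q2 H s ie it).
Local Notation jac := (jacobian H s ie it).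
Local Notation p1 := (tangent1 H ie).
Local Notation p2 := (tangent2 H s ie it).

Let d1 := frame_d1_derivation ie.
Let d2 := frame_d2_derivation s ie it.

(** The frame vectors span the tangent plane. *)
Lemma pd_frame_d0 (h : sm V) : E1 h = 0 -> E2 h = 0 -> forall i, pd i h = 0.
Proof.
move=> h1 h2.
have p0 : pd 0 h = 0.
  transitivity (e * E1 h); last by rewrite h1 mulr0.
  by rewrite /frame_d1 /frame_coef1; transitivity ((e * ie) * pd 0 h); [rewrite eie mul1r|ring].
move=> i; have [-> // | ->] := ord2_cases i.
transitivity (t * E2 h); last by rewrite h2 mulr0.
rewrite /frame_d2 /frame_coef2 p0; transitivity ((t * it) * pd 1 h); first by rewrite tit mul1r.
ring.
Qed.

Lemma pr_row_at b u : plane_set V u -> pr b (f u) = row_at (crd b) u.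
Proof. by move=> Vu; apply/rowP => m; rewrite mxE (coordinateE H b m Vu). Qed.

Lemma coordinate_tframe_lorentz b u : plane_set V u -> lorentz_frame (row_at (crd b) u) (row_at (M1 b) u).
Proof.
move=> Vu; have [g11 _ _ g1 _] := tframe_gram H b.
have g1' : lorA (crd b) (M1 b) = 0 by rewrite -g1 /lorA; ring.
split; rewrite lor_row_at ?coordinate_lorA ?g11 ?g1'; push_ev => //.
Qed.

Lemma cross_coordinate_tframe b u : lcross (row_at (crd b) u) (row_at (M1 b) u) = row_at (M2 b) u.
Proof. by rewrite cross_row_at; apply/rowP => m; rewrite !mxE cross_tframe1. Qed.

(** Used for uniqueness: a relation valid on an open set yields, at a point,
    relations for all the vectors of a frame. *)
Lemma linear_relation (al be : 'I_3 -> R) :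
  (forall u, plane_set V u -> \sum_n al n * crd true n u + \sum_n be n * crd false n u = 0) ->
  forall u, plane_set V u ->
  \sum_n al n * p1 true n u + \sum_n be n * p1 false n u = 0 /\
  \sum_n al n * p2 true n u + \sum_n be n * p2 false n u = 0.
Proof.
move=> h.
pose rel (g : bool -> 'I_3 -> sm V) : sm V := \sum_n sm_cst V (al n) * g true n + \sum_n sm_cst V (be n) * g false n.
have relE g u : plane_set V u -> rel g u = \sum_n al n * g true n u + \sum_n be n * g false n u.
  by move=> Vu; rewrite /rel !sum3E; push_ev.
have r0 : rel crd = 0 by apply: smP => u Vu; rewrite relE // h.
have rel_pd i : rel (fun b n => pd i (crd b n)) = 0.
  have := congr1 (pd i) r0; rewrite (der0 (pd_derivation V i)) => <-.
  by rewrite /rel !sum3E !(derD (pd_derivation V i)) !(derM (pd_derivation V i)) !pd_cst; ring.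
have r1 : rel p1 = 0.
  rewrite -[RHS](mulr0 ie) -(rel_pd 0) /rel !sum3E -!frame_d1_coordinate /frame_d1 /frame_coef1; ring.
have r2 : rel p2 = 0.
  transitivity (it * (rel (fun b n => pd 1 (crd b n)) - s * ie * rel (fun b n => pd 0 (crd b n)))).
    by rewrite /rel !sum3E -!frame_d2_coordinate /frame_d2 /frame_coef2; ring.
  by rewrite !rel_pd; ring.
by move=> u Vu; rewrite -!(relE _ _ Vu) r1 r2.
Qed.

Section Diagonal.
Hypothesis hK : K = - 2^-1.

(** With p, q, r the entries of the Gram matrix, p + q = 1 and p q - r^2 = c^2 =
    1/4 force p = q = 1/2 and r = 0: the factor is a homothety. *)
Lemma half_conformal b :
  [/\ 2 * (P1 b ^+ 2 + Q1 b ^+ 2) = 1, 2 * (P2 b ^+ 2 + Q2 b ^+ 2) = 1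
    & P1 b * P2 b + Q1 b * Q2 b = 0].
Proof.
have en := energy eie tit gm b.
suff h u : plane_set V u -> [/\ (2 * (P1 b ^+ 2 + Q1 b ^+ 2)) u = 1,
   (2 * (P2 b ^+ 2 + Q2 b ^+ 2)) u = 1 & (P1 b * P2 b + Q1 b * Q2 b) u = 0].
  by split; apply: smP => u Vu; have [h1 h2 h3] := h u Vu; rewrite ?ev1.
move=> Vu.
have [kc _] := jacobian_rigid eie tit gm b Vu.
have : - 2^-1 + 2 * jac b u ^+ 2 = 0 by rewrite -hK.
have := congr1 (fun h : sm V => h u) en; rewrite /jacobian; push_ev.
move: (P1 b u) (P2 b u) (Q1 b u) (Q2 b u) => x y z w E c.
have hx : x ^+ 2 + z ^+ 2 + (y ^+ 2 + w ^+ 2) = 1 by rewrite -E; ring.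
have id1 : ((x * w - y * z) ^+ 2 = (x ^+ 2 + z ^+ 2) * (y ^+ 2 + w ^+ 2) - (x * y + z * w) ^+ 2) by ring.
rewrite id1 in c.
set A := x ^+ 2 + z ^+ 2 in hx c *; set B := y ^+ 2 + w ^+ 2 in hx c *; set C := x * y + z * w in c *.
have BA : B = 1 - A by rewrite -hx addrC addKr.
rewrite BA in c *.
have sq : (A - 2^-1) ^+ 2 + C ^+ 2 = 0 by apply: (eq_sub (congr1 (fun z => - z / 2) c)); field.
move/eqP: sq; rewrite paddr_eq0 ?sqr_ge0 // !sqrf_eq0 => /andP[/eqP hA /eqP hC].
have -> : A = 2^-1 by rewrite -[A](subrK 2^-1) hA add0r.
by rewrite hC; split => //; field.
Qed.

Definition lor_sign (n : 'I_3) : R := if n == 0 then -1 else 1.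

(** The entries of the matrix carrying the Lorentz frame formed by the position
    and sqrt 2 times the images of E1 and E2 under the first factor to that under
    the second one. *)
Definition comparison_entry (n m : 'I_3) : sm V := sm_cst V (lor_sign n) *
  (- (crd true n * crd false m) + 2 * (p1 true n * p1 false m) + 2 * (p2 true n * p2 false m)).

(** The moving frames of the two factors satisfy the same differential equations,
    since both are homotheties with the same ratio and vanishing Hessian. *)
Lemma comparison_entry_cst n m i : pd i (comparison_entry n m) = 0.
Proof.
have [t1 t2 t3] := half_conformal true; have [f1 f2 f3] := half_conformal false.
have Et m' := tangent_derivatives eie tit gm true m'; have Ef m' := tangent_derivatives eie tit gm false m'.
have lin D (hD : derivation D) (k a a' b b' c c' : sm V) : D k = 0 ->
   D (k * (- (a * a') + 2 * (b * b') + 2 * (c * c'))) =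
   k * (- (D a * a' + a * D a') + 2 * (D b * b' + b * D b') + 2 * (D c * c' + c * D c')).
  by move=> k0; rewrite !(derM hD) !(derD hD) !(derN hD) !(derM hD) (der_nat hD) k0; ring.
have k1 : E1 (sm_cst V (lor_sign n)) = 0 by rewrite /frame_d1 /frame_coef1 pd_cst; ring.
have k2 : E2 (sm_cst V (lor_sign n)) = 0 by rewrite /frame_d2 /frame_coef2 !pd_cst; ring.
set k := sm_cst V (lor_sign n) in k1 k2.
apply: pd_frame_d0; rewrite /comparison_entry -/k.
  rewrite (lin _ d1 _ _ _ _ _ _ _ k1) !frame_d1_coordinate !Et !Ef.
  transitivity (k * ((2 * (P1 true ^+ 2 + Q1 true ^+ 2) - 1) * (crd true n * p1 false m)
    + (2 * (P1 false ^+ 2 + Q1 false ^+ 2) - 1) * (p1 true n * crd false m)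
    + 2 * (P1 true * P2 true + Q1 true * Q2 true) * (crd true n * p2 false m)
    + 2 * (P1 false * P2 false + Q1 false * Q2 false) * (p2 true n * crd false m))).
    by ring.
  by rewrite t1 f1 t3 f3; ring.
rewrite (lin _ d2 _ _ _ _ _ _ _ k2) !frame_d2_coordinate !Et !Ef.
transitivity (k * ((2 * (P2 true ^+ 2 + Q2 true ^+ 2) - 1) * (crd true n * p2 false m)
  + (2 * (P2 false ^+ 2 + Q2 false ^+ 2) - 1) * (p2 true n * crd false m)
  + 2 * (P1 true * P2 true + Q1 true * Q2 true) * (crd true n * p1 false m)
  + 2 * (P1 false * P2 false + Q1 false * Q2 false) * (p1 true n * crd false m))).
  by ring.
by rewrite t2 f2 t3 f3; ring.
Qed.

Local Notation sq2 := (Num.sqrt 2 : R).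
Let sq22 : sq2 * sq2 = 2. Proof. by rewrite -expr2 sqr_sqrtr. Qed.

(** The images of the frame vectors have squared norm 1/2; their orientation is
    the sign of c, which is why 2 c appears in the third vector. *)
Lemma coordinate_tangent_lorentz b u : plane_set V u ->
  lorentz_frame (row_at (crd b) u) (sq2 *: row_at (p1 b) u) /\
  lcross (row_at (crd b) u) (sq2 *: row_at (p1 b) u) = (2 * jac b u * sq2) *: row_at (p2 b) u.
Proof.
move=> Vu; have lZ (a c : R) (x y : 'rV[R]_3) : lor (a *: x) (c *: y) = a * c * lor x y.
  by rewrite /lor !mxE; ring.
have [xp pp cr] : [/\ lorA (crd b) (p1 b) = 0, 2 * lorA (p1 b) (p1 b) = 1
    & forall m, crossA (crd b) (p1 b) m = 2 * jac b * p2 b m] :=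
  homothety_frame (tframe_gram H b) (cross_tframe1 H b) (cross_tframe2 H b) (half_conformal b).
split; last first.
  have -> : lcross (row_at (crd b) u) (sq2 *: row_at (p1 b) u) = sq2 *: lcross (row_at (crd b) u) (row_at (p1 b) u).
    by apply/rowP => m; case: (ord3_cases m) => ->; rewrite !mxE /=; ring.
  rewrite cross_row_at; apply/rowP => m; rewrite [LHS]mxE [in LHS]mxE cr [RHS]mxE [in RHS]mxE; push_ev.
  by gen_ev => *; ring.
have lZr (c : R) (x y : 'rV[R]_3) : lor x (c *: y) = c * lor x y by rewrite /lor !mxE; ring.
split.
- by rewrite lor_row_at coordinate_lorA; push_ev.
- rewrite lZ sq22 lor_row_at; have := congr1 (fun h : sm V => h u) pp; by push_ev.
- by rewrite lZr lor_row_at xp; push_ev; rewrite mulr0.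
Qed.

Definition comparison_mx u : 'M[R]_3 := \matrix_(n, m) comparison_entry n m u.

(** The factors 4 c^2 = 1 coming from the two third vectors cancel, because both
    factors have the same c. *)
Lemma comparison_mxP u : plane_set V u -> special_lorentz (comparison_mx u) /\
  pr true (f u) *m comparison_mx u = pr false (f u).
Proof.
move=> Vu; have [Ft ct] := coordinate_tangent_lorentz true Vu; have [Ff cf] := coordinate_tangent_lorentz false Vu.
have [A1 A2 A3 A4] := lorentz_frame_map Ft Ff.
set A := _ *m frame_mx _ _ _ in A1 A2 A3 A4.
suff -> : comparison_mx u = A by split=> //; rewrite !pr_row_at.
apply/matrixP => n m; rewrite /A lorentz_frame_mapE mxE ct cf.
have jj : jac true u = jac false u by rewrite (jacobian_eq H s ie it).
have [kc' _] := jacobian_rigid eie tit gm false Vu.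
have kc : - 2^-1 + 2 * jac false u ^+ 2 = 0 by rewrite -hK.
rewrite jj [(_ *: _ : 'rV_3) 0 n]mxE [(_ *: _ : 'rV_3) 0 m]mxE [(_ *: _ : 'rV_3) 0 n]mxE [(_ *: _ : 'rV_3) 0 m]mxE.
rewrite !(mxE _ (fun _ => _)) /comparison_entry; push_ev; rewrite -/(lor_sign n); congr (_ * _).
move: sq22 kc; move: sq2 => q q2; gen_ev => a1 a2 a3 a4 a5 c a6 kc.
have c2 : 4 * a6 ^+ 2 = 1 by apply: (eq_sub (congr1 (fun z => 2 * z) kc)); field.
transitivity (- (c * a5) + (q * q) * (a4 * a3) + (4 * a6 ^+ 2) * (q * q) * (a2 * a1)); last by ring.
by rewrite c2 q2; ring.
Qed.

Lemma local_isometry u : plane_set V u -> exists A : 'M[R]_3, special_lorentz A /\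
  \forall v \near u, pr true (f v) *m A = pr false (f v).
Proof.
move=> Vu; exists (comparison_mx u); split; first by have [] := comparison_mxP Vu.
have h n : \forall v \near u, row_at (comparison_entry n) v = row_at (comparison_entry n) u.
  by apply: row_at_near_cst => // i m; exact: comparison_entry_cst.
have h3 : \forall v \near u, [/\ row_at (comparison_entry 0) v = row_at (comparison_entry 0) u, row_at (comparison_entry 1) v = row_at (comparison_entry 1) u
   & row_at (comparison_entry 2) v = row_at (comparison_entry 2) u].
  by apply: filterS3 (h 0) (h 1) (h 2) => v; split.
have hV := open_near (@plane_open_open R V) Vu.
apply: filterS2 h3 hV => v [r0 r1 r2] Vv.
rewrite -(comparison_mxP Vv).2; congr (_ *m _); apply/matrixP => n m; rewrite !mxE.
by case: (ord3_cases n) => ->; [move/rowP/(_ m): r0|move/rowP/(_ m): r1|move/rowP/(_ m): r2]; rewrite !mxE.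
Qed.

(** Differentiating the equation, two such matrices agree on a Lorentz frame. *)
Lemma local_isometry_unique (A B : 'M[R]_3) u : plane_set V u ->
  (forall v, plane_set V v -> pr true (f v) *m A = pr false (f v)) ->
  (forall v, plane_set V v -> pr true (f v) *m B = pr false (f v)) -> A = B.
Proof.
move=> Vu hA hB.
pose D := A - B.
have lin (x : 'rV[R]_3) m : (x *m D) 0 m = \sum_n D n m * x 0 n.
  by rewrite mxE; apply: eq_bigr => n _; rewrite mulrC.
have rel m v : plane_set V v -> \sum_n D n m * crd true n v + \sum_n (0 : R) * crd false n v = 0.
  move=> Vv; have -> : \sum_n (0 : R) * crd false n v = 0 by rewrite big1 // => n _; rewrite mul0r.
  rewrite addr0; transitivity ((pr true (f v) *m D) 0 m).
    by rewrite lin (pr_row_at true Vv); apply: eq_bigr => n _; rewrite [X in _ = _ * X]mxE.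
  by rewrite mulmxBr hA // hB // subrr mxE.
have xD : row_at (crd true) u *m D = 0.
  by rewrite -(pr_row_at true Vu) mulmxBr hA // hB // subrr.
have p1D : row_at (p1 true) u *m D = 0.
  apply/rowP => m; rewrite lin [RHS]mxE; have [h _] := linear_relation (rel m) Vu.
  rewrite -[RHS]h [X in _ = _ + X]big1 ?addr0 => [|n _]; last by rewrite mul0r.
  by apply: eq_bigr => n _; rewrite [X in _ * X]mxE.
have p2D : row_at (p2 true) u *m D = 0.
  apply/rowP => m; rewrite lin [RHS]mxE; have [_ h] := linear_relation (rel m) Vu.
  rewrite -[RHS]h [X in _ = _ + X]big1 ?addr0 => [|n _]; last by rewrite mul0r.
  by apply: eq_bigr => n _; rewrite [X in _ * X]mxE.
have [F c] := coordinate_tangent_lorentz true Vu.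
apply/eqP; rewrite -subr_eq0 -/D; apply/eqP/row_matrixP => i; rewrite row0 rowE.
rewrite (lorentz_frame_decomp (delta_mx 0 i) F) c !mulmxDl -!scalemxAl xD p1D p2D.
by rewrite !scaler0 !addr0.
Qed.

End Diagonal.

End PatchLocal.

(** * Curvature 0: each component lies on a geodesic *)

Lemma lor_signE (R : realType) : (lor_sign R 0 = -1) * (lor_sign R 1 = 1) * (lor_sign R 2 = 1).
Proof. by []. Qed.

Section PatchLocal.
Context (R : realType) (V : plane_open R) (f : 'rV[R]_2 -> ambient R) (K : R).
Hypothesis H : is_patch V f K.
Context (e s t ie it : sm V).
Hypothesis eie : e * ie = 1.
Hypothesis tit : t * it = 1.
Hypothesis gm : forall i j, coef_metric H i j = coframe_metric e s t i j.
Local Notation M1 := (tframe1 H).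
Local Notation M2 := (tframe2 H).
Local Notation crd := (coordinate H).
Local Notation P1 := (frame_P1 H ie).
Local Notation P2 := (frame_P2 H s ie it).
Local Notation Q1 := (frame_Q1 H ie).
Local Notation Q2 := (frame_Q2 H s ie it).
Local Notation jac := (jacobian H s ie it).
Local Notation p1 := (tangent1 H ie).
Local Notation p2 := (tangent2 H s ie it).
Local Notation n1 := (normal1 H ie).
Local Notation n2 := (normal2 H s ie it).

Let d1 := frame_d1_derivation ie.
Let d2 := frame_d2_derivation s ie it.

Section Geodesics.
Hypothesis hK : K = 0.

Lemma jacobian0 b : jac b = 0.
Proof.
apply: smP => u Vu; have [kc _] := jacobian_rigid eie tit gm b Vu.
have : 2 * jac b u ^+ 2 = 0 by rewrite -[LHS]add0r -{1}hK.
by push_ev => /eqP; rewrite mulf_eq0 pnatr_eq0 sqrf_eq0 /= => /eqP.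
Qed.

(** The normals themselves rotate with the frame, but this sum of tensor squares
    does not see the rotation. *)
Definition normal_tensor b (n m : 'I_3) : sm V := n1 b n * n1 b m + n2 b n * n2 b m.

Lemma normal_tensor_cst b n m i : pd i (normal_tensor b n m) = 0.
Proof.
have En m' := normal_derivatives eie tit gm m' (jacobian0 b).
have lin D (hD : derivation D) (a c a' c' : sm V) :
   D (a * c + a' * c') = D a * c + a * D c + (D a' * c' + a' * D c').
  by rewrite (derD hD) !(derM hD).
apply: (pd_frame_d0 (s := s) eie tit); rewrite /normal_tensor.
  by rewrite (lin _ d1) !En; ring.
by rewrite (lin _ d2) !En; ring.
Qed.

Lemma normal_products b : [/\ lorA (n1 b) (crd b) = 0, lorA (n2 b) (crd b) = 0
  & lorA (n1 b) (n1 b) + lorA (n2 b) (n2 b) = 1].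
Proof.
have [g11 g12 g22 g1 g2] := tframe_gram H b.
split.
- transitivity (P1 b * lorA (M2 b) (crd b) - Q1 b * lorA (M1 b) (crd b)); first by rewrite /lorA /normal1; ring.
  by rewrite g1 g2; ring.
- transitivity (P2 b * lorA (M2 b) (crd b) - Q2 b * lorA (M1 b) (crd b)); first by rewrite /lorA /normal2; ring.
  by rewrite g1 g2; ring.
rewrite -[RHS](energy eie tit gm b).
transitivity ((P1 b ^+ 2 + P2 b ^+ 2) * lorA (M2 b) (M2 b) + (Q1 b ^+ 2 + Q2 b ^+ 2) * lorA (M1 b) (M1 b)
  - 2 * (P1 b * Q1 b + P2 b * Q2 b) * lorA (M1 b) (M2 b)); first by rewrite /lorA /normal1 /normal2; ring.
by rewrite g11 g12 g22; ring.
Qed.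

(** The quadratic form of the normal tensor is constant and vanishes on the
    position vector; being a sum of two squares of linear forms at u, both forms
    vanish on nearby positions. *)
Lemma local_geodesic b u : plane_set V u -> exists n : 'rV[R]_3, lor n n = 1 /\
  \forall v \near u, lor n (pr b (f v)) = 0.
Proof.
move=> Vu; have [x1 x2 nn] := normal_products b.
have h n : \forall v \near u, row_at (normal_tensor b n) v = row_at (normal_tensor b n) u.
  by apply: row_at_near_cst => // i m; exact: normal_tensor_cst.
have h3 : \forall v \near u, [/\ row_at (normal_tensor b 0) v = row_at (normal_tensor b 0) u, row_at (normal_tensor b 1) v = row_at (normal_tensor b 1) u
   & row_at (normal_tensor b 2) v = row_at (normal_tensor b 2) u].
  by apply: filterS3 (h 0) (h 1) (h 2) => v; split.
have quad v (x : 'rV[R]_3) : lor (row_at (n1 b) v) x ^+ 2 + lor (row_at (n2 b) v) x ^+ 2 =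
  \sum_n \sum_m lor_sign R n * lor_sign R m * normal_tensor b n m v * x 0 n * x 0 m.
  by rewrite !sum3E /lor !mxE /normal_tensor !lor_signE; push_ev; gen_ev => *; ring.
have near0 : \forall v \near u, lor (row_at (n1 b) u) (pr b (f v)) = 0 /\ lor (row_at (n2 b) u) (pr b (f v)) = 0.
  have hV := open_near (@plane_open_open R V) Vu.
  apply: filterS2 h3 hV => v [r0 r1 r2] Vv.
  have q0 : lor (row_at (n1 b) u) (pr b (f v)) ^+ 2 + lor (row_at (n2 b) u) (pr b (f v)) ^+ 2 = 0.
    transitivity (lor (row_at (n1 b) v) (pr b (f v)) ^+ 2 + lor (row_at (n2 b) v) (pr b (f v)) ^+ 2).
      rewrite !quad; apply: eq_bigr => n _; apply: eq_bigr => m _; congr (_ * _ * _ * _).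
      by case: (ord3_cases n) => ->; [move/rowP/(_ m): r0|move/rowP/(_ m): r1|move/rowP/(_ m): r2]; rewrite !mxE.
    by rewrite (pr_row_at H b Vv) !lor_row_at x1 x2; push_ev; rewrite expr0n addr0.
  by move/eqP: q0; rewrite paddr_eq0 ?sqr_ge0 // !sqrf_eq0 => /andP[/eqP -> /eqP ->].
have norm (n : 'rV[R]_3) : 0 < lor n n -> (\forall v \near u, lor n (pr b (f v)) = 0) ->
    exists n : 'rV[R]_3, lor n n = 1 /\ \forall v \near u, lor n (pr b (f v)) = 0.
  move=> n0 hn; exists ((Num.sqrt (lor n n))^-1 *: n).
  have lZ (a c : R) (x y : 'rV[R]_3) : lor (a *: x) (c *: y) = a * c * lor x y by rewrite /lor !mxE; ring.
  have lZl (a : R) (x y : 'rV[R]_3) : lor (a *: x) y = a * lor x y by rewrite /lor !mxE; ring.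
  split; last by apply: filterS hn => v hv; rewrite lZl hv mulr0.
  rewrite lZ -expr2 exprVn sqr_sqrtr ?ltW // mulVf // gt_eqF //.
have sum1 : lor (row_at (n1 b) u) (row_at (n1 b) u) + lor (row_at (n2 b) u) (row_at (n2 b) u) = 1.
  rewrite !lor_row_at; have := congr1 (fun h : sm V => h u) nn; by push_ev.
(* One of the two normals is nonzero, since their squared norms add up to 1. *)
have [l1|l1] := ltP 0 (lor (row_at (n1 b) u) (row_at (n1 b) u)).
  by apply: norm l1 _; apply: filterS near0 => v [].
have l2 : 0 < lor (row_at (n2 b) u) (row_at (n2 b) u).
  by move: sum1 l1; move: (lor _ _) (lor _ _) => p q; lra.
by apply: norm l2 _; apply: filterS near0 => v [].
Qed.

(** The normal vector of a geodesic is unique up to sign, because the energy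
    being 1 keeps the factor from being constant; its orthogonal plane is what
    matters for the propagation along the surface. *)
Lemma local_geodesic_unique b (n n' : 'rV[R]_3) u : plane_set V u ->
  lor n n = 1 -> lor n' n' = 1 ->
  (forall v, plane_set V v -> lor n (pr b (f v)) = 0) ->
  (forall v, plane_set V v -> lor n' (pr b (f v)) = 0) ->
  forall w, lor n' w = 0 -> lor n w = 0.
Proof.
move=> Vu n1' n1'' hn hn' w nw.
have F := coordinate_tframe_lorentz H b Vu; have c := cross_coordinate_tframe H b u.
have rel (k : 'rV[R]_3) : (forall v, plane_set V v -> lor k (pr b (f v)) = 0) ->
    lor k (row_at (p1 b) u) = 0 /\ lor k (row_at (p2 b) u) = 0.
  move=> hk.
  pose al n := if b then lor_sign R n * k 0 n else 0; pose be n := if b then 0 else lor_sign R n * k 0 n.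
  have lsum (x : 'rV[R]_3) : lor k x = \sum_n lor_sign R n * k 0 n * x 0 n by rewrite sum3E /lor !lor_signE; ring.
  have gsum (g : bool -> 'I_3 -> sm V) v :
      \sum_n al n * g true n v + \sum_n be n * g false n v = lor k (row_at (g b) v).
    rewrite lsum /al /be !sum3E; case: (b); rewrite !mxE; ring.
  have r v : plane_set V v -> \sum_n al n * crd true n v + \sum_n be n * crd false n v = 0.
    by move=> Vv; rewrite (gsum (fun b => crd b)) -(pr_row_at H b Vv) hk.
  by have := linear_relation s ie it r Vu; rewrite (gsum (fun b => p1 b)) (gsum (fun b => p2 b)).
have lD (x y z : 'rV[R]_3) (a c' d : R) : lor x (a *: y + c' *: z) = a * lor x y + c' * lor x z.
  by rewrite /lor !mxE; ring.
have lDl (x y z : 'rV[R]_3) (a c' d : R) : lor (a *: y + c' *: z) x = a * lor y x + c' * lor z x.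
  by rewrite /lor !mxE; ring.
have p1E : row_at (p1 b) u = P1 b u *: row_at (M1 b) u + Q1 b u *: row_at (M2 b) u.
  by apply/rowP => m; rewrite !mxE /tangent1; push_ev.
have p2E : row_at (p2 b) u = P2 b u *: row_at (M1 b) u + Q2 b u *: row_at (M2 b) u.
  by apply/rowP => m; rewrite !mxE /tangent2; push_ev.
have [g11 g12 g22 _ _] := tframe_gram H b.
have m11 : lor (row_at (M1 b) u) (row_at (M1 b) u) = 1 by rewrite lor_row_at g11; push_ev.
have m12 : lor (row_at (M1 b) u) (row_at (M2 b) u) = 0 by rewrite lor_row_at g12; push_ev.
have m22 : lor (row_at (M2 b) u) (row_at (M2 b) u) = 1 by rewrite lor_row_at g22; push_ev.
have dec (k : 'rV[R]_3) : lor k (pr b (f u)) = 0 -> lor k k = 1 ->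
    k = lor k (row_at (M1 b) u) *: row_at (M1 b) u + lor k (row_at (M2 b) u) *: row_at (M2 b) u /\
    lor k (row_at (M1 b) u) ^+ 2 + lor k (row_at (M2 b) u) ^+ 2 = 1.
  rewrite (pr_row_at H b Vu) => kx kk.
  have kE : k = lor k (row_at (M1 b) u) *: row_at (M1 b) u + lor k (row_at (M2 b) u) *: row_at (M2 b) u.
    by rewrite {1}(lorentz_frame_decomp k F) c kx oppr0 scale0r add0r.
  split=> //; rewrite -kk [in RHS]kE lDl // !lD //; move: (lor k _) (lor k _) => x y.
  rewrite m11 m22 m12 (lorC (row_at (M2 b) u)) m12; ring.
have [r1 r2] := rel _ hn; have [r1' r2'] := rel _ hn'.
have [nE nn] := dec _ (hn _ Vu) n1'; have [nE' nn'] := dec _ (hn' _ Vu) n1''.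
have en : P1 b u ^+ 2 + P2 b u ^+ 2 + Q1 b u ^+ 2 + Q2 b u ^+ 2 = 1.
  by have := congr1 (fun h : sm V => h u) (energy eie tit gm b); push_ev.
rewrite p1E lD // in r1; rewrite p1E lD // in r1'.
rewrite p2E lD // in r2; rewrite p2E lD // in r2'.
rewrite nE lDl //; rewrite nE' lDl // in nw.
move: r1 r2 r1' r2' nn nn' nw en {nE nE'}.
move: (lor n (row_at (M1 b) u)) (lor n (row_at (M2 b) u)) (lor n' (row_at (M1 b) u)) (lor n' (row_at (M2 b) u)).
move: (lor (row_at (M1 b) u) w) (lor (row_at (M2 b) u) w) (P1 b u) (P2 b u) (Q1 b u) (Q2 b u).
move=> x y a1 a2 b1 b2 mu nu mu' nu' r1 r2 r1' r2' nn nn' nw en.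
(* Both unit vectors are orthogonal to the nonzero image of the differential,
   inside a tangent plane: they are proportional. *)
have z : mu * nu' = mu' * nu.
  set d := mu * nu' - mu' * nu.
  have da1 : a1 * d = 0 by transitivity (nu' * (a1 * mu + b1 * nu) - nu * (a1 * mu' + b1 * nu')); [rewrite /d; ring|rewrite r1 r1'; ring].
  have db1 : b1 * d = 0 by transitivity (mu * (a1 * mu' + b1 * nu') - mu' * (a1 * mu + b1 * nu)); [rewrite /d; ring|rewrite r1 r1'; ring].
  have da2 : a2 * d = 0 by transitivity (nu' * (a2 * mu + b2 * nu) - nu * (a2 * mu' + b2 * nu')); [rewrite /d; ring|rewrite r2 r2'; ring].
  have db2 : b2 * d = 0 by transitivity (mu * (a2 * mu' + b2 * nu') - mu' * (a2 * mu + b2 * nu)); [rewrite /d; ring|rewrite r2 r2'; ring].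
  apply/eqP; rewrite -subr_eq0 -/d; apply/eqP.
  transitivity ((a1 ^+ 2 + a2 ^+ 2 + b1 ^+ 2 + b2 ^+ 2) * d); first by rewrite en mul1r.
  transitivity (a1 * (a1 * d) + a2 * (a2 * d) + b1 * (b1 * d) + b2 * (b2 * d)); first by ring.
  by rewrite da1 da2 db1 db2; ring.
transitivity ((mu' ^+ 2 + nu' ^+ 2) * (mu * x + nu * y)); first by rewrite nn' mul1r.
transitivity ((mu * mu' + nu * nu') * (mu' * x + nu' * y) + (mu * nu' - mu' * nu) * (nu' * x - mu' * y)); first by ring.
by rewrite nw z; ring.
Qed.

End Geodesics.
End PatchLocal.

(** * From patches to the surface *)

Section PatchSummary.
Context (R : realType) (V : plane_open R) (f : 'rV[R]_2 -> ambient R) (K : R).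
Hypothesis H : is_patch V f K.

Lemma patch_totally_geodesic i j u : plane_set V u -> second_form f i j u = 0.
Proof.
move=> Vu; have [[[[[e s] t] ie] it] [eie tit gm]] := coframe_exists H.
exact: second_form0 eie tit gm i j u Vu.
Qed.

Lemma patch_curvature_values u : plane_set V u -> K = 0 \/ K = - 2^-1.
Proof.
move=> Vu; have [[[[[e s] t] ie] it] [eie tit gm]] := coframe_exists H.
have [] := jacobian_rigid eie tit gm true Vu; move: (jacobian _ _ _ _ _ _) => c kc /eqP.
rewrite mulf_eq0 => /orP[/eqP c0|/eqP c1].
  by left; move: kc; rewrite c0 expr0n mulr0 addr0.
right; lra.
Qed.

Lemma patch_isometry u : K = - 2^-1 -> plane_set V u -> exists A : 'M[R]_3,
  special_lorentz A /\ \forall v \near u, pr true (f v) *m A = pr false (f v).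
Proof.
move=> hK Vu; have [[[[[e s] t] ie] it] [eie tit gm]] := coframe_exists H.
exact: local_isometry eie tit gm hK u Vu.
Qed.

Lemma patch_isometry_unique (A B : 'M[R]_3) u : K = - 2^-1 -> plane_set V u ->
  (forall v, plane_set V v -> pr true (f v) *m A = pr false (f v)) ->
  (forall v, plane_set V v -> pr true (f v) *m B = pr false (f v)) -> A = B.
Proof.
move=> hK Vu; have [[[[[e s] t] ie] it] [eie tit gm]] := coframe_exists H.
exact: local_isometry_unique eie tit gm hK A B u Vu.
Qed.

Lemma patch_geodesic b u : K = 0 -> plane_set V u -> exists n : 'rV[R]_3, lor n n = 1 /\
  \forall v \near u, lor n (pr b (f v)) = 0.
Proof.
move=> hK Vu; have [[[[[e s] t] ie] it] [eie tit gm]] := coframe_exists H.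
exact: local_geodesic eie tit gm hK b u Vu.
Qed.

Lemma patch_geodesic_unique b (n n' : 'rV[R]_3) u : K = 0 -> plane_set V u ->
  lor n n = 1 -> lor n' n' = 1 ->
  (forall v, plane_set V v -> lor n (pr b (f v)) = 0) ->
  (forall v, plane_set V v -> lor n' (pr b (f v)) = 0) ->
  forall w, lor n' w = 0 -> lor n w = 0.
Proof.
move=> hK Vu; have [[[[[e s] t] ie] it] [eie tit gm]] := coframe_exists H.
exact: local_geodesic_unique eie tit gm b n n' u Vu.
Qed.

End PatchSummary.

Lemma patch_sub (R : realType) (V V' : plane_open R) f (K : R) :
  plane_set V' `<=` plane_set V -> is_patch V f K -> is_patch V' f K.
Proof.
move=> VV [sf hf imm lag mn cv].
by split=> [k|u /VV|u /VV|u /VV|u /VV|u /VV]; [exact: Ck_on_sub VV (sf k)|exact: hf|exact: imm|exact: lag|exact: mn|exact: cv].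
Qed.

Lemma patch_near (R : realType) (V : plane_open R) f (K : R) u (G : set 'rV[R]_2) :
  is_patch V f K -> plane_set V u -> (\forall v \near u, G v) ->
  exists V' : plane_open R, [/\ is_patch V' f K, plane_set V' u & plane_set V' `<=` G].
Proof.
move=> H Vu nG.
have oV' : open (plane_set V `&` G°) by apply: openI; [exact: plane_open_open|exact: open_interior].
exists (PlaneOpen oV'); split.
- by apply: patch_sub H => v [].
- by split.
by move=> v [_ /interior_subset].
Qed.

(** Analytic continuation without monodromy: a property with a locally existing
    witness, any two witnesses being interchangeable as soon as they agree near
    one point, has a global witness on a connected space. *)
Lemma connected_propagation (S : topologicalType) (X : Type) (good : X -> S -> Prop) (p0 : S) :
  connected [set: S] ->
  (forall p : S, exists x, \forall q \near p, good x q) ->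
  (forall (p : S) x y, (\forall q \near p, good x q) -> (\forall q \near p, good y q) ->
     forall q, good y q -> good x q) ->
  exists x, forall p : S, good x p.
Proof.
move=> cS ex un; have [x0 hx0] := ex p0; exists x0.
(* B is open and closed: at a point of its closure, a local solution agrees
   with x0 somewhere nearby, hence everywhere nearby. *)
pose B : set S := fun p : S => \forall q \near p, good x0 q.
have BT : B = [set: S].
  apply: cS.
  - by exists p0.
  - exists B; last by rewrite setTI.
    exact: (@open_interior S (good x0)).
  - exists B; last by rewrite setTI.
    move=> p clp; have [y hy] := ex p.
    have hy' : nbhs p (good y)° by exact: nbhs_interior.
    have [q [Bq hq]] := clp _ hy'.
    by apply: filterS hy; exact: un Bq hq.
move=> p; have Bp : B p by rewrite BT.
exact: nbhs_singleton Bp.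
Qed.

Section Charts.
Context (R : realType) (S : surface R) (c : local_param R S) (p : S).
Hypothesis cp : img c p.

Lemma near_chart (G : S -> Prop) : (\forall q \near p, G q) ->
  \forall u \near coords c p, G (param c u).
Proof.
move=> nG; have := param_continuous (coords_dom cp); rewrite /prop_for /continuous_at.
by rewrite (coordsK cp); apply.
Qed.

Lemma near_unchart (G : S -> Prop) : (\forall u \near coords c p, G (param c u)) ->
  \forall q \near p, G q.
Proof.
move=> nG; have h : \forall q \near p, G (param c (coords c q)) := coords_continuous cp nG.
have hi : \forall q \near p, img c q by apply: open_nbhs_nbhs; split=> //; exact: open_img.
by apply: filterS2 h hi => q Gq iq; rewrite coordsK in Gq.
Qed.
End Charts.

Section Global.
Context (R : realType) (S : surface R) (Phi : S -> ambient R) (K : R).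
Hypothesis cS : connected [set: S].
Hypothesis lagr : lagrangian_surface Phi.
Hypothesis mini : minimal Phi.
Hypothesis curv : has_constant_curvature Phi K.
Context (p0 : S).

Definition chart_open (c : local_param R S) : plane_open R := PlaneOpen (@open_dom _ _ c).

Lemma chart_patch c : atlas c -> is_patch (chart_open c) (Phi \o param c) K.
Proof.
move=> ac; have [hH imm lag] := lagr; have [sm inj] := imm _ ac.
split.
- exact: sm.
- by move=> u _; exact: hH.
- by move=> u du; exact: inj.
- by move=> u du v w; exact: lag.
- by move=> u du; exact: mini.
- by move=> u du; exact: curv.
Qed.

Lemma global_isometry : K = - 2^-1 -> exists A : 'M[R]_3, special_lorentz A /\
  forall p, pr true (Phi p) *m A = pr false (Phi p).
Proof.
move=> hK.
have [A hA] : exists A, forall p, special_lorentz A /\ pr true (Phi p) *m A = pr false (Phi p).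
  apply: (connected_propagation p0 cS).
    move=> p; have [c ac cp] := atlas_cover p.
    have [A [sA hA]] := patch_isometry (chart_patch ac) hK (coords_dom cp).
    by exists A; apply: (near_unchart cp); apply: filterS hA.
  move=> p A B hA hB.
  have [c ac cp] := atlas_cover p.
  have hAB := filterI (near_chart cp hA) (near_chart cp hB).
  have [V' [H' Vu sub]] := patch_near (chart_patch ac) (coords_dom cp) (hAB _).
  suff -> : A = B by [].
  by apply: (patch_isometry_unique H' hK Vu) => v /sub [[_ h1] [_ h2]].
by exists A; split=> [|p]; [have [] := hA p0|have [] := hA p].
Qed.

(** Uniqueness up to sign suffices: orthogonality to n does not change if n is
    replaced by its opposite. *)
Lemma global_geodesic b : K = 0 -> exists n : 'rV[R]_3, lor n n = 1 /\
  forall p, lor n (pr b (Phi p)) = 0.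
Proof.
move=> hK.
have [n hn] : exists n, forall p, lor n n = 1 /\ lor n (pr b (Phi p)) = 0.
  apply: (connected_propagation p0 cS).
    move=> p; have [c ac cp] := atlas_cover p.
    have [n [sn hn]] := patch_geodesic (chart_patch ac) b hK (coords_dom cp).
    by exists n; apply: (near_unchart cp); apply: filterS hn.
  move=> p n m hn hm.
  have [c ac cp] := atlas_cover p.
  have hnm := filterI (near_chart cp hn) (near_chart cp hm).
  have [V' [H' Vu sub]] := patch_near (chart_patch ac) (coords_dom cp) (hnm _).
  move=> q [m1 mq]; have [n1 _] := nbhs_singleton hn; split=> //.
  by apply: (patch_geodesic_unique (b := b) H' hK Vu n1 m1 _ _ mq) => v /sub [[_ h1] [_ h2]].
by exists n; split=> [|p]; [have [] := hn p0|have [] := hn p].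
Qed.

Lemma global_totally_geodesic : totally_geodesic Phi.
Proof.
by move=> c ac u du i j; exact: (patch_totally_geodesic (chart_patch ac)).
Qed.

Lemma global_curvature : K = 0 \/ K = - 2^-1.
Proof.
have [c ac cp] := atlas_cover p0.
exact: (patch_curvature_values (chart_patch ac) (coords_dom cp)).
Qed.
End Global.

(** * Lorentz matrices acting on the first factor *)

Section FactorMap.
Context (R : realType).
Implicit Type A : 'M[R]_3.

Definition factor_map A (x : ambient R) : ambient R := (x.1 *m A, x.2).

Fact factor_map_linear A : linear (factor_map A).
Proof. by move=> a x y; rewrite /factor_map /= mulmxDl -scalemxAl. Qed.
HB.instance Definition _ A := GRing.isLinear.Build _ _ _ _ _ (factor_map_linear A).

Lemma factor_map_smooth A : smooth_on setT (factor_map A).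
Proof.
move=> k; have o : open [set: ambient R] by exact: openT.
have ci := @Ck_on_id R k (ambient R) setT.
apply: Ck_on_pair => //; last exact: Ck_on_snd ci.
apply: Ck_on_mx => // i j.
apply: (@Ck_on_eq R k _ _ _ (fun x : ambient R => \sum_(m < 3) (x.1 0 m * A m j : R^o))) => //.
  by move=> x _; rewrite (ord1 i) mxE.
apply: Ck_on_sum => // m.
apply: Ck_onM => //; last exact: Ck_on_cst.
by apply: Ck_on_coord => //; exact: Ck_on_fst ci.
Qed.

Lemma factor_map_continuous A : continuous (factor_map A).
Proof. by move=> x; exact: (factor_map_smooth A 0%N). Qed.

Lemma factor_map_diff A x : 'd (factor_map A) x = factor_map A :> (ambient R -> ambient R).
Proof. exact: diff_lin (@factor_map_continuous A). Qed.

Lemma factor_map_self A x0 : special_lorentz A -> H2 (-1) x0 -> H2 (-1) (x0 *m A) ->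
  smooth_self_map (factor_map A).
Proof.
move=> sA h0 h1; split; last by exists setT; split=> //; [exact: openT|exact: factor_map_smooth].
by move=> x [x1 x2]; split=> //=; exact: special_lorentz_H2 sA h0 h1 _ x1.
Qed.

(** The point x0 shows that A preserves the sheet x_0 > 0 of the hyperboloid. *)
Lemma factor_map_isometry A x0 : special_lorentz A -> H2 (-1) x0 -> H2 (-1) (x0 *m A) ->
  isometryHH (factor_map A).
Proof.
move=> sA h0 h1; split; first exact: factor_map_self sA h0 h1.
  exists (factor_map (lorentz_inv A)); split.
  - apply: (factor_map_self (lorentz_inv_special sA) h1).
    by rewrite -mulmxA lorentz_invr // mulmx1.
  - by move=> [x y] _; rewrite /factor_map /= -mulmxA lorentz_invr // mulmx1.
  - by move=> [x y] _; rewrite /factor_map /= -mulmxA lorentz_invl // mulmx1.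
move=> x _ v w _ _; rewrite factor_map_diff /dot /=.
by rewrite special_lorentz_lor.
Qed.

Lemma factor_map_J A x v : special_lorentz A ->
  'd (factor_map A) x (J x v) = J (factor_map A x) ('d (factor_map A) x v).
Proof.
move=> sA; rewrite factor_map_diff /factor_map /J /JH2 /=.
by rewrite special_lorentz_cross // scalemxAl.
Qed.

End FactorMap.

(** * Local surjectivity of maps of the plane with nonzero Jacobian *)

Section LocalSurjection.
Context (R : realType).
Implicit Types (u v w y : 'rV[R]_2).

Lemma mx_entry_le m n (M : 'M[R]_(m.+1, n.+1)) i j : `|M i j| <= `|M|.
Proof.
have -> : `|M| = mx_norm M by [].
by rewrite mx_normrE; exact: (le_bigmax _ (fun k : _ * _ => `|M k.1 k.2|) (i, j)).
Qed.

Lemma rV2_norm_cases w : `|w| = `|w 0 0| \/ `|w| = `|w 0 1|.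
Proof.
have [w0|w0] := eqVneq `|w| 0.
  by left; move/normr0_eq0: (w0) => ->; rewrite mxE !normr0.
have [[i j] /= hw] := mx_norm_neq0 w0.
have {}hw : `|w| = `|w i j| := hw.
by rewrite hw (ord1 i); case: (ord2_cases j) => ->; [left|right].
Qed.

Lemma rV2_normsq w : `|w| ^+ 2 <= w 0 0 ^+ 2 + w 0 1 ^+ 2 <= 2 * `|w| ^+ 2.
Proof.
have sq j : w 0 j ^+ 2 <= `|w| ^+ 2.
  by rewrite -real_normK ?num_real // lerXn2r ?nnegrE // mx_entry_le.
apply/andP; split; last by rewrite mulr_natl mulr2n lerD.
by case: (rV2_norm_cases w) => ->; rewrite real_normK ?num_real // ?lerDl ?lerDr sqr_ge0.
Qed.

(** Continuity of linear maps, with an explicit constant. *)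
Lemma mulmx2_bounded (N : 'M[R]_2) : exists2 C, 0 < C & forall w, `|w *m N| <= C * `|w|.
Proof.
exists (2 * `|N| + 1) => [|w]; first by rewrite ltr_wpDl // mulr_ge0.
have b j : `|(w *m N) 0 j| <= (2 * `|N| + 1) * `|w|.
  rewrite mxE sum2E (le_trans (ler_normD _ _)) // !normrM.
  have h k : `|w 0 k| * `|N k j| <= `|N| * `|w|.
    by rewrite mulrC ler_pM // mx_entry_le.
  rewrite (le_trans (lerD (h 0) (h 1))) // -mulrDl ler_wpM2r //.
  by rewrite mulr_natl mulr2n lerDl.
by case: (rV2_norm_cases (w *m N)) => ->.
Qed.

Variables (U : set 'rV[R]_2) (h : 'rV[R]_2 -> 'rV[R]_2).
Hypotheses (oU : open U) (ch : Ck_on 1 U h).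

Definition jacobian_mx u : 'M[R]_2 := \matrix_(i, j) (partial i h u : 'rV[R]_2) 0 j.

Lemma diff_jacobian u v : U u -> 'd h u v = v *m jacobian_mx u.
Proof.
move=> Uu; have dh := ch.1 u Uu.
rewrite {1}(_ : v = v 0 0 *: delta_mx 0 0 + v 0 1 *: delta_mx 0 1); last first.
  by rewrite {1}(row_sum_delta v) sum2E.
rewrite linearD !linearZ /=.
by apply/rowP => j; rewrite !mxE sum2E !mxE /partial !deriveE.
Qed.

Lemma derive_entry u v j : U u -> 'D_v (fun x => h x 0 j : R^o) u = (v *m jacobian_mx u) 0 j.
Proof.
move=> Uu; have dh := ch.1 u Uu.
have lin : linear (fun M : 'rV[R]_2 => M 0 j : R^o) by move=> a x y; rewrite !mxE.
pose L : {linear 'rV[R]_2 -> R^o} :=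
  HB.pack (fun M : 'rV[R]_2 => M 0 j : R^o) (GRing.isLinear.Build _ _ _ _ _ lin).
have := @derive_linear R _ _ _ L h u v (@coord_continuous R _ _ 0 j) dh.
by rewrite /= (deriveE v dh) -(diff_jacobian v Uu).
Qed.

Lemma jacobian_near u : U u -> \det (jacobian_mx u) != 0 ->
  \forall x \near u, \det (jacobian_mx x) != 0.
Proof.
move=> Uu J0.
have ce i j : Ck_on 0 U (fun x => jacobian_mx x i j : R^o).
  apply: (@Ck_on_eq R 0 _ _ _ (fun x => (partial i h x : 'rV[R]_2) 0 j)) => //.
    by move=> x _; rewrite mxE.
  by apply: Ck_on_coord => //; exact: ch.2.
have cJ : Ck_on 0 U (fun x => \det (jacobian_mx x) : R^o).
  apply: (@Ck_on_eq R 0 _ _ _ (fun x => (jacobian_mx x 0 0 * jacobian_mx x 1 1 : R^o) +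
      (-1) * (jacobian_mx x 0 1 * jacobian_mx x 1 0 : R^o) : R^o)) => //.
    by move=> x _; rewrite det2E mulN1r.
  by apply: Ck_onD => //; [exact: Ck_onM|apply: Ck_onM => //; [exact: Ck_on_cst|exact: Ck_onM]].
exact: cvgr_neq0 (cJ u Uu) J0.
Qed.

(** At a point with invertible differential, a map expands small distances at
    least by some factor: compare with its linear approximation. *)
Lemma local_expansion u : U u -> \det (jacobian_mx u) != 0 ->
  exists2 c, 0 < c & \forall v \near (0 : 'rV[R]_2), c * `|v| <= `|h (u + v) - h u|.
Proof.
move=> Uu J0; set M := jacobian_mx u in J0.
have [C C0 hC] := mulmx2_bounded (invmx M).
have MV : M *m invmx M = 1%:M by rewrite mulmxV // unitmxE unitfE.
have lb v : `|v| <= C * `|v *m M|.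
  by have := hC (v *m M); rewrite -mulmxA MV mulmx1.
exists (2 * C)^-1; first by rewrite invr_gt0 mulr_gt0.
have dh := ch.1 u Uu.
have /eqaddoP hh := diff_locally dh.
have e0 : 0 < (2 * C)^-1 by rewrite invr_gt0 mulr_gt0.
have {}hh := hh _ e0.
apply: filterS hh => v hv.
have {}hv : `|h (u + v) - (h u + v *m M)| <= (2 * C)^-1 * `|v|.
  by rewrite -(diff_jacobian v Uu) (addrC u v); exact: hv.
have h1 : `|v *m M| <= `|h (u + v) - h u| + (2 * C)^-1 * `|v|.
  rewrite -[v *m M](subKr (h (u + v) - h u)) (le_trans (ler_normB _ _)) // lerD2l.
  by rewrite -addrA -opprD.
have h2 : C^-1 * `|v| <= `|v *m M| by rewrite ler_pdivrMl.
have -> : (2 * C)^-1 * `|v| = C^-1 * `|v| - (2 * C)^-1 * `|v|.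
  by field; rewrite gt_eqF.
by rewrite lerBlDr (le_trans h2).
Qed.

Lemma remaining_distance (a b s d : R) : 4 * d <= s -> s <= a + b -> b < d -> 3 * d <= a.
Proof. lra. Qed.

Definition sqdist y x : R := (h x 0 0 - y 0 0) ^+ 2 + (h x 0 1 - y 0 1) ^+ 2.

Lemma sqdist_is_derive y x v (t : R) : U (x + t *: v) ->
  is_derive t 1 (fun s : R => sqdist y (x + s *: v))
    (2 * (\sum_j (h (x + t *: v) 0 j - y 0 j) * (v *m jacobian_mx (x + t *: v)) 0 j)).
Proof.
move=> Ux.
have d j : is_derive t 1 (fun s : R => h (x + s *: v) 0 j : R)
    ((v *m jacobian_mx (x + t *: v)) 0 j).
  rewrite -(derive_entry _ _ Ux).
  apply: (is_derive_line (f := fun z => h z 0 j : R^o)).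
  by have [+ _] := Ck_on_coord 0 j oU ch; apply.
have d0 := d 0; have d1 := d 1; rewrite /sqdist.
apply: is_derive_eq; rewrite sum2E /GRing.scale /=.
by ring.
Qed.

(** The gradient of the squared distance to y is the residual h x - y multiplied
    by the Jacobian matrix. *)
Lemma sqdist_critical y x (e : R) : U x -> 0 < e -> \det (jacobian_mx x) != 0 ->
  (forall z, `|z - x| < e -> U z /\ sqdist y x <= sqdist y z) -> h x = y.
Proof.
move=> Ux e0 J0 hmin.
have dir v : \sum_j (h x 0 j - y 0 j) * (v *m jacobian_mx x) 0 j = 0.
  pose d := e / (`|v| + 1); have v1 : 0 < `|v| + 1 by rewrite ltr_wpDl.
  have d0 : 0 < d by rewrite divr_gt0.
  have near t : t \in `](- d), d[%R -> `|x + t *: v - x| < e.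
    rewrite in_itv /= -ltr_norml addrAC subrr add0r normrZ => td.
    rewrite (@le_lt_trans _ _ (`|t| * (`|v| + 1))) ?ler_wpM2l ?lerDl //.
    by rewrite -ltr_pdivlMr.
  have D0 : is_derive (0 : R) 1 (fun t : R => sqdist y (x + t *: v)) 0.
    apply: (@derive1_at_min _ _ (- d) d).
    - by rewrite ge0_cp // ltW.
    - by move=> t /near ht; have [Ut _] := hmin _ ht; have [] := sqdist_is_derive y Ut.
    - by rewrite in_itv /= oppr_lt0 d0.
    move=> t /near ht; rewrite scale0r addr0; by have [] := hmin _ ht.
  have := @derive_val _ _ _ _ _ _ _ D0.
  have Ux0 : U (x + 0 *: v) by rewrite scale0r addr0.
  rewrite (@derive_val _ _ _ _ _ _ _ (sqdist_is_derive y Ux0)) scale0r addr0 => /eqP.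
  by rewrite mulf_eq0 pnatr_eq0 /= => /eqP.
have hJ : (h x - y) *m (jacobian_mx x)^T = 0.
  apply/rowP => i; rewrite !mxE -[RHS](dir (delta_mx 0 i)).
  by apply: eq_bigr => j _; rewrite -rowE !mxE.
apply/eqP; rewrite -subr_eq0; apply/eqP.
have JT : (jacobian_mx x)^T \in unitmx by rewrite unitmxE det_tr unitfE.
by rewrite -(mulmxK JT (h x - y)) hJ mul0mx.
Qed.

Lemma sqdist_continuous y x : U x -> {for x, continuous (sqdist y)}.
Proof.
have cj j : Ck_on 0 U (fun z => h z 0 j - y 0 j : R^o).
  apply: Ck_onD => //; last exact: Ck_on_cst.
  exact: Ck_on_coord (Ck_on_le ch).
have cs : Ck_on 0 U (sqdist y : _ -> R^o).
  by apply: Ck_onD => //; apply: Ck_onM.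
exact: cs.
Qed.

(** Every y near h u is a value: minimize the squared distance from h to y on a
    small closed ball around u.  By the expansion of distances the minimum is not
    attained on the boundary, so it is a critical point, hence a solution of
    h x = y. *)
Lemma local_surjection u : U u -> \det (jacobian_mx u) != 0 ->
  nbhs (h u) (h @` U).
Proof.
move=> Uu J0.
have [c c0 exp] := local_expansion Uu J0.
have [r1 /= r10 hr1] := (nbhs_ballP _ _).1 exp.
have [r2 /= r20 hr2] := (nbhs_ballP _ _).1 (filterI (open_near oU Uu) (jacobian_near Uu J0)).
pose r := Num.min r1 r2 / 2.
have r0 : 0 < r by rewrite divr_gt0 // lt_min r10 r20.
have rlt : r < r1 /\ r < r2.
  have m0 : 0 < Num.min r1 r2 by rewrite lt_min r10 r20.
  have rm : r < Num.min r1 r2 by rewrite /r ltr_pdivrMr // mulr_natr mulr2n ltrDl.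
  by move: rm; rewrite lt_min => /andP[].
have hB x : `|x - u| <= r ->
    [/\ U x, \det (jacobian_mx x) != 0 & c * `|x - u| <= `|h x - h u|].
  move=> xr.
  have xr1 : ball (0 : 'rV[R]_2) r1 (x - u).
    by rewrite -ball_normE /= sub0r normrN (le_lt_trans xr) // rlt.1.
  have xr2 : ball u r2 x.
    by rewrite -ball_normE /= distrC (le_lt_trans xr) // rlt.2.
  have [Ux Jx] := hr2 _ xr2; split=> //.
  by have := hr1 _ xr1; rewrite [u + _]addrC subrK.
pose B := [set x : 'rV[R]_2 | `|x - u| <= r].
have cB : compact B.
  apply: bounded_closed_compact.
    exists (r + `|u|); split=> [|M /ltW rM x Bx]; first exact: num_real.
    apply: le_trans rM.
    have := ler_normD (x - u) u; rewrite subrK => /le_trans; apply; by rewrite lerD2r.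
  have -> : B = closed_ball u r.
    by rewrite closed_ballE //; apply/seteqP; split=> x; rewrite /B /closed_ball_ /= distrC.
  exact: closed_ball_closed.
have d0 : 0 < c * r / 4 by rewrite divr_gt0 // mulr_gt0.
apply/nbhs_ballP; exists (c * r / 4) => //= y; rewrite -ball_normE /= => hy.
have B0 : B !=set0 by exists u; rewrite /B /= subrr normr0 ltW.
have cq : {within B, continuous (sqdist y)}.
  apply: continuous_in_subspaceT => x; rewrite inE => /hB [Ux _ _].
  exact: sqdist_continuous.
(* On the boundary sqdist is at least 9 d^2 with d = c r / 4, at u at most 2 d^2. *)
have [x] := EVT_min_rV B0 cB cq; rewrite inE => Bx xmin.
have [Ux Jx xe] := hB x Bx.
exists x => //.
have xr : `|x - u| < r.
  rewrite lt_neqAle Bx andbT; apply/eqP => xr; rewrite xr in xe.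
  have := xmin u; rewrite inE /B /= subrr normr0 => /(_ (ltW r0)).
  apply/negP; rewrite -ltNge.
  have /andP[_ q1] := rV2_normsq (h u - y).
  have /andP[q2 _] := rV2_normsq (h x - y).
  have hxy : 3 * (c * r / 4) <= `|h x - y|.
    have := ler_distD y (h x) (h u); rewrite (distrC y) => tri.
    apply: (remaining_distance _ tri hy); apply: le_trans xe.
    by rewrite mulrC divfK.
  have s1 : sqdist y u <= 2 * `|h u - y| ^+ 2 by move: q1; rewrite !mxE.
  have s2 : `|h x - y| ^+ 2 <= sqdist y x by move: q2; rewrite !mxE.
  have n1 : `|h u - y| ^+ 2 <= (c * r / 4) ^+ 2 by rewrite lerXn2r ?nnegrE // ltW.
  have n2 : (3 * (c * r / 4)) ^+ 2 <= `|h x - y| ^+ 2.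
    by rewrite lerXn2r ?nnegrE // mulr_ge0 // ltW.
  have n3 : 0 < (c * r / 4) ^+ 2 by rewrite exprn_gt0.
  apply: le_lt_trans s1 _; apply: lt_le_trans s2; apply: lt_le_trans n2.
  apply: (@le_lt_trans _ _ (2 * (c * r / 4) ^+ 2)); first by rewrite ler_wpM2l.
  by rewrite [ltRHS]exprMn ltr_pM2r // -natrX ltr_nat.
apply: (@sqdist_critical y x (r - `|x - u|)) => //; first by rewrite subr_gt0.
move=> z hz.
have Bz : B z.
  by apply: le_trans (ler_distD x z u) _; rewrite -lerBrDr ltW.
by have [Uz _ _] := hB z Bz; split=> //; apply: xmin; rewrite inE.
Qed.

End LocalSurjection.

(** * Congruence with the diagonal surface *)

Section PatchDifferential.
Context (R : realType) (V : plane_open R) (f : 'rV[R]_2 -> ambient R) (K : R).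
Hypothesis H : is_patch V f K.

Lemma patch_tangent b u v : plane_set V u -> lor (pr b ('d f u v)) (pr b (f u)) = 0.
Proof.
move=> Vu; have [_ _ _ g1 g2] := tframe_gram H b.
have E m : pr b ('d f u v) 0 m = (v 0 0 * coefP H b 0 u + v 0 1 * coefP H b 1 u) * tframe1 H b m u +
    (v 0 0 * coefQ H b 0 u + v 0 1 * coefQ H b 1 u) * tframe2 H b m u.
  have := diff_coord H v b m Vu; rewrite (pd_coordinate H b 0 m) (pd_coordinate H b 1 m) => h.
  by transitivity (pr_coord b m ('d f u v)) => //; rewrite h; push_ev; move: (v 0 0) (v 0 1); gen_ev => *; ring.
have F m : pr b (f u) 0 m = coordinate H b m u by rewrite coordinateE.
have G1 : (lorA (tframe1 H b) (coordinate H b) : sm V) u = 0 by rewrite g1; push_ev.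
have G2 : (lorA (tframe2 H b) (coordinate H b) : sm V) u = 0 by rewrite g2; push_ev.
move: G1 G2; rewrite /lorA; push_ev => G1 G2.
rewrite /lor !E !F.
transitivity ((v 0 0 * coefP H b 0 u + v 0 1 * coefP H b 1 u) * 0 +
    (v 0 0 * coefQ H b 0 u + v 0 1 * coefQ H b 1 u) * 0); last by rewrite !mulr0 addr0.
rewrite -{1}G1 -G2; move: (v 0 0) (v 0 1); gen_ev => *; ring.
Qed.

(** The equation relating the two factors is linear and can be differentiated. *)
Lemma patch_diff_factor (A : 'M[R]_3) u v : plane_set V u ->
  (forall x, plane_set V x -> pr true (f x) *m A = pr false (f x)) ->
  pr true ('d f u v) *m A = pr false ('d f u v).
Proof.
move=> Vu hA; have df := patch_differentiable H Vu.
apply/rowP => m.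
have dF : differentiable (factor_map A \o f) u.
  by apply: differentiable_comp => //; apply: linear_differentiable; exact: factor_map_continuous.
have e1 := @derive_linear R _ _ _ (pr_coord true m : {linear ambient R -> R^o}) (factor_map A \o f) u v
  (@pr_coord_continuous R true m) dF.
have e2 := @derive_linear R _ _ _ (pr_coord false m : {linear ambient R -> R^o}) f u v
  (@pr_coord_continuous R false m) df.
have e3 := @derive_linear R _ _ _ (factor_map A : {linear ambient R -> ambient R}) f u v
  (@factor_map_continuous R A) df.
have e4 : 'D_v (pr_coord true m \o (factor_map A \o f)) u = 'D_v (pr_coord false m \o f) u.
  apply: near_eq_derive; apply: (near_open_eq (@plane_open_open _ V)) Vu => x Vx.
  by transitivity ((pr true (f x) *m A) 0 m) => //; rewrite (hA x Vx).
move: e4; rewrite e1 e2 e3 deriveE //.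
Qed.

End PatchDifferential.

Section Shadow.
Context (R : realType).
Implicit Types x y : 'rV[R]_3.

(** The chart of the hyperboloid given by the two space-like coordinates. *)
Definition shadow x : 'rV[R]_2 := \row_j x 0 (lift 0 j).

Lemma shadowE x : (shadow x 0 0 = x 0 1) * (shadow x 0 1 = x 0 2).
Proof. by rewrite !mxE; split; congr (x 0 _); exact: val_inj. Qed.

Lemma H2_shadow_inj x y : H2 (-1) x -> H2 (-1) y -> shadow x = shadow y -> x = y.
Proof.
move=> [hx x0] [hy y0] xy.
have e1 : x 0 1 = y 0 1 by rewrite -!shadowE xy.
have e2 : x 0 2 = y 0 2 by rewrite -!shadowE xy.
have e0 : x 0 0 = y 0 0.
  apply/eqP; rewrite -(@eqrXn2 _ 2) ?ltW //; apply/eqP.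
  by move: hx; rewrite -hy /lor e1 e2; lra.
by apply/rowP => j; case: (ord3_cases j) => ->.
Qed.

(** As x_0 > 0, the tangency equation can be solved for the time-like component. *)
Lemma tangent_shadow0 x w : H2 (-1) x -> lor w x = 0 -> shadow w = 0 -> w = 0.
Proof.
move=> [_ x0] + hw.
have e1 : w 0 1 = 0 by rewrite -shadowE hw mxE.
have e2 : w 0 2 = 0 by rewrite -shadowE hw mxE.
rewrite /lor e1 e2 !mul0r !addr0 => /eqP; rewrite oppr_eq0 mulf_eq0 (gt_eqF x0) orbF => /eqP e0.
by apply/rowP => j; rewrite mxE; case: (ord3_cases j) => ->.
Qed.

Lemma Ck_on_shadow k (V : normedModType R) (U : set V) (g : V -> 'rV[R]_3) : open U ->
  Ck_on k U g -> Ck_on k U (fun x : V => shadow (g x)).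
Proof.
move=> oU cg; apply: Ck_on_mx => // i j; rewrite (ord1 i).
have -> : (fun y : V => shadow (g y) 0 j) = (fun y : V => g y 0 (lift 0 j)).
  by apply/funext => y; rewrite mxE.
exact: Ck_on_coord.
Qed.

End Shadow.

Section DiagonalCase.
Context (R : realType) (S : surface R) (Phi : S -> ambient R) (K : R).
Hypothesis lagr : lagrangian_surface Phi.
Hypothesis mini : minimal Phi.
Hypothesis curv : has_constant_curvature Phi K.
Context (A : 'M[R]_3) (p0 : S).
Hypothesis sA : special_lorentz A.
Hypothesis hA : forall p, pr true (Phi p) *m A = pr false (Phi p).

Let W := range (fun p => shadow (pr false (Phi p))).

(** The second factor is an immersion, because both factors have the same kernel
    (A is invertible) and the pair is an immersion; local surjectivity applies to
    its composition with the chart of the hyperboloid. *)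
Lemma shadow_open : open W.
Proof.
rewrite openE => _ [p _ <-].
have [c ac cp] := atlas_cover p; have H := chart_patch lagr mini curv ac.
pose f := Phi \o param c; pose u := coords c p.
have du : dom c u := coords_dom cp.
have fu : f u = Phi p by rewrite /f /= coordsK.
pose h x := shadow (pr false (f x)).
have ch : Ck_on 1 (dom c) h.
  apply: Ck_on_shadow; first exact: open_dom.
  apply: Ck_on_snd; first exact: open_dom.
  exact: patch_smooth H 1%N.
have J0 : \det (jacobian_mx h u) != 0.
  apply/negP => /det0P [v v0 vJ]; move/negP: v0; apply.
  have hv : 'd h u v = 0 by rewrite (diff_jacobian ch v du).
  have E j : 'd h u v 0 j = pr false ('d f u v) 0 (lift 0 j).
    have e1 := @derive_entry R _ _ ch u v j du.
    have e2 := @derive_linear R _ _ _ (pr_coord false (lift 0 j) : {linear ambient R -> R^o}) f u v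
      (@pr_coord_continuous R false (lift 0 j)) (patch_differentiable H du).
    rewrite (diff_jacobian ch v du) -e1.
    transitivity (pr_coord false (lift 0 j) ('D_v f u)); last by rewrite deriveE //; exact: (patch_differentiable H du).
    rewrite -e2; congr ('D_v _ u).
    by apply/funext => x; rewrite /h /= mxE.
  have s0 : shadow (pr false ('d f u v)) = 0.
    by apply/rowP => j; rewrite mxE -E hv mxE.
  have [_ HHu] := patch_HH H du.
  have d2 : pr false ('d f u v) = 0.
    exact: tangent_shadow0 HHu (patch_tangent H false v du) s0.
  have d1 : pr true ('d f u v) = 0.
    have := patch_diff_factor H v du (A := A); rewrite d2 => h0.
    rewrite -[LHS]mulmx1 -(lorentz_invr sA) mulmxA h0 ?mul0mx // => x _; exact: hA.
  have inj := patch_immersed H du.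
  apply/eqP/inj; rewrite linear0.
  by apply: ambient_eq => -[] m; rewrite /pr_coord ?d1 ?d2 /pr !mxE.
have := local_surjection (@open_dom _ _ c) ch du J0.
have -> : h u = shadow (pr false (Phi p)) by rewrite /h /= -/(f u) fu.
by apply: filterS => _ [x _ <-]; exists (param c x).
Qed.

(** The image consists of the points (psi, psi), which the diagonal immersion
    reaches from sqrt 2 psi.  A point of the hyperboloid is determined by its
    shadow, so the condition of lying over the image of psi is open. *)
Lemma diagonal_image : open_part_of_diagonal (factor_map A @` range Phi).
Proof.
have [hH _ _] := lagr.
have s0 : 0 < Num.sqrt 2 :> R by rewrite sqrtr_gt0.
have s2 : Num.sqrt 2 ^+ 2 = 2 :> R by rewrite sqr_sqrtr.
set s := Num.sqrt 2 in s0 s2.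
have lorZ (a : R) x : lor (a *: x) (a *: x) = a ^+ 2 * lor x x.
  by rewrite /lor !mxE; ring.
exists [set x | W (shadow (s^-1 *: x))]; split.
  apply: open_comp; last exact: shadow_open.
  move=> x _.
  have cs : Ck_on 0 setT (fun y : 'rV[R]_3 => s^-1 *: y).
    by move=> y _; exact: scaler_continuous.
  exact: (@Ck_on_shadow R 0 'rV[R]_3 setT (fun y : 'rV[R]_3 => s^-1 *: y) openT cs x I).
rewrite /diagonal_immersion -/s; apply/seteqP; split.
  move=> _ [_ [p _ <-] <-]; have [hp1 hp2] := hH p; have := hA p.
  rewrite /pr => hAp.
  have sK : s^-1 *: (s *: (Phi p).2) = (Phi p).2.
    by rewrite scalerA mulVf ?scale1r // gt_eqF.
  exists (s *: (Phi p).2); last by rewrite sK /factor_map hAp.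
  split; last by rewrite /= sK; exists p.
  case: hp2 => q1 q2; split; last by rewrite mxE mulr_gt0.
  by rewrite lorZ s2 q1 !invrN invr1 invrK mulrN1.
move=> _ [x [[x1 x0] [p _ xp]] <-]; have [hp1 hp2] := hH p; have := hA p.
rewrite /pr => hAp.
have hx : H2 (-1) (s^-1 *: x).
  split; last by rewrite mxE mulr_gt0 // invr_gt0.
  by rewrite lorZ x1 exprVn s2 !invrN invr1 invrK mulrN mulVf.
have -> : s^-1 *: x = (Phi p).2 by apply: H2_shadow_inj hx hp2 (esym xp).
by exists (Phi p); [exists p|rewrite /factor_map hAp].
Qed.

Lemma congruent_to_diagonal : exists2 B : set (ambient R), open_part_of_diagonal B &
  holomorphically_congruent (range Phi) B.
Proof.
have [hH _ _] := lagr; have [h1 h2] := hH p0.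
exists (factor_map A @` range Phi); first exact: diagonal_image.
exists (factor_map A); split=> //.
  by apply: (factor_map_isometry sA h1); have := hA p0; rewrite /pr => ->.
by move=> x _ v _; exact: factor_map_J.
Qed.

End DiagonalCase.

(** * Geodesics of the hyperbolic plane *)

Section HyperbolicFunctions.
Context (R : realType).
Implicit Types s m : R.

Definition cosh s : R := (expR s + expR (- s)) / 2.
Definition sinh s : R := (expR s - expR (- s)) / 2.
(** The logarithmic form gives smoothness directly. *)
Definition asinh m : R := ln (m + Num.sqrt (1 + m ^+ 2)).

Lemma cosh_sinh s : cosh s ^+ 2 - sinh s ^+ 2 = 1.
Proof.
have e : expR s * expR (- s) = 1 by rewrite -expRD subrr expR0.
by rewrite /cosh /sinh -[RHS]e; field.
Qed.

Lemma cosh_gt0 s : 0 < cosh s.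
Proof. by rewrite divr_gt0 // addr_gt0 // expR_gt0. Qed.

Lemma asinh_arg_gt0 m : 0 < m + Num.sqrt (1 + m ^+ 2).
Proof.
have h : 0 <= 1 + m ^+ 2 by rewrite addr_ge0 // sqr_ge0.
have : `|m| < Num.sqrt (1 + m ^+ 2).
  by rewrite -sqrtr_sqr ltr_sqrt ?ltrDr // ltr_pwDl // sqr_ge0.
by rewrite ltr_norml => /andP[+ _]; rewrite -subr_gt0 opprK.
Qed.

Lemma expR_asinhN m : expR (- asinh m) = Num.sqrt (1 + m ^+ 2) - m.
Proof.
have p := asinh_arg_gt0 m.
rewrite /asinh expRN lnK ?posrE //.
have h : 0 <= 1 + m ^+ 2 by rewrite addr_ge0 // sqr_ge0.
apply: (mulfI (lt0r_neq0 p)); rewrite mulfV ?gt_eqF //.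
have := sqr_sqrtr h; move: (Num.sqrt _) => q hq.
transitivity (q ^+ 2 - m ^+ 2); first by rewrite hq; ring.
ring.
Qed.

Lemma asinhK m : sinh (asinh m) = m.
Proof.
by rewrite /sinh expR_asinhN /asinh lnK ?posrE ?asinh_arg_gt0 //; field.
Qed.

Lemma cosh_asinh m : cosh (asinh m) = Num.sqrt (1 + m ^+ 2).
Proof.
by rewrite /cosh expR_asinhN /asinh lnK ?posrE ?asinh_arg_gt0 //; field.
Qed.

Lemma is_derive_cosh s : is_derive s 1 cosh (sinh s).
Proof.
rewrite /cosh /sinh; apply: is_derive_eq; rewrite /GRing.scale /=; ring.
Qed.

Lemma is_derive_sinh s : is_derive s 1 sinh (cosh s).
Proof.
rewrite /cosh /sinh; apply: is_derive_eq; rewrite /GRing.scale /=; ring.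
Qed.

Lemma Ck_on_cosh_sinh k : Ck_on k setT (cosh : R^o -> R^o) /\ Ck_on k setT (sinh : R^o -> R^o).
Proof.
have o : open [set: R^o] by exact: openT.
have ce : Ck_on k setT (fun s : R^o => expR s : R^o) by apply: Ck_on_exp => //; exact: Ck_on_id.
have ci : Ck_on k setT (fun s : R^o => - s : R^o).
  apply: (Ck_on_eq o _ (Ck_onM o (Ck_on_cst k setT (-1 : R^o)) (Ck_on_id k setT))) => s _.
  exact: mulN1r.
have cn : Ck_on k setT (fun s : R^o => expR (- s) : R^o) by apply: Ck_on_exp.
have cm : Ck_on k setT (fun s : R^o => - expR (- s) : R^o).
  apply: (Ck_on_eq o _ (Ck_onM o (Ck_on_cst k setT (-1 : R^o)) cn)) => s _.
  exact: mulN1r.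
split.
  exact: (Ck_onM o (Ck_onD o ce cn) (Ck_on_cst k setT (2^-1 : R^o))).
exact: (Ck_onM o (Ck_onD o ce cm) (Ck_on_cst k setT (2^-1 : R^o))).
Qed.

Lemma Ck_on_asinh k (V : normedModType R) (U : set V) (g : V -> R^o) : open U ->
  Ck_on k U g -> Ck_on k U (fun x : V => asinh (g x) : R^o).
Proof.
move=> oU cg; apply: Ck_on_ln => // [x _|]; first exact: asinh_arg_gt0.
apply: Ck_onD => //; apply: Ck_on_sqrt => // [x _|].
  by rewrite ltr_pwDl // sqr_ge0.
by apply: Ck_onD => //; [exact: Ck_on_cst|exact: Ck_onM].
Qed.

End HyperbolicFunctions.

Section GeodesicCurve.
Context (R : realType) (x z : 'rV[R]_3).
Hypotheses (Hx : H2 (-1) x) (zz : lor z z = 1) (xz : lor x z = 0).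

(** The geodesic through x with unit velocity z. *)
Definition geodesic_curve (s : R) : 'rV[R]_3 := cosh s *: x + sinh s *: z.

Lemma lor_comb (a b c d : R) :
  lor (a *: x + b *: z) (c *: x + d *: z) = - (a * c) + b * d.
Proof.
have xx : lor x x = -1 by case: Hx => -> _; rewrite invrN invr1.
transitivity (a * c * lor x x + (a * d + b * c) * lor x z + b * d * lor z z).
  by rewrite /lor !mxE; ring.
rewrite xx xz zz; ring.
Qed.

Lemma geodesic_curve_smooth : smooth_on (setT : set R^o) (geodesic_curve : R^o -> 'rV[R]_3).
Proof.
move=> k; have o : open [set: R^o] by exact: openT.
have [cc cs] := Ck_on_cosh_sinh R k.
by apply: Ck_onD => //; apply: Ck_on_scalel.
Qed.

Lemma geodesic_curve_H2 s : H2 (-1) (geodesic_curve s).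
Proof.
apply: (@lor_lt0_H2 _ _ x) => //.
  by rewrite lor_comb; move: (cosh_sinh s); lra.
rewrite (_ : x = 1 *: x + 0 *: z); last by rewrite scale1r scale0r addr0.
rewrite /geodesic_curve scale1r scale0r addr0.
have := lor_comb (cosh s) (sinh s) 1 0; rewrite scale1r scale0r addr0 => ->.
by rewrite mulr1 mulr0 addr0 oppr_lt0 cosh_gt0.
Qed.

Lemma curve_derive1 (F G dF dG : R -> R) (s : R) :
  is_derive s 1 F (dF s) -> is_derive s 1 G (dG s) ->
  derive1 (fun t => F t *: x + G t *: z) s = dF s *: x + dG s *: z.
Proof.
move=> hF hG; rewrite derive1E.
have dd (E : R -> R) dE (w : 'rV[R]_3) : is_derive s 1 E dE ->
    is_derive (s : R^o) 1 (fun t : R^o => E t *: w) (dE *: w).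
  move=> [ex e]; have dE' : differentiable E s by apply/derivable1_diffP.
  have := differentiableZl w dE' => dw.
  split; first exact: diff_derivable.
  by rewrite deriveE // diffZl // -deriveE // e.
have h1 := dd _ _ x hF; have h2 := dd _ _ z hG.
by have h := is_deriveD h1 h2; rewrite derive_val.
Qed.

Lemma geodesic_curve_unit_speed : unit_speed_geodesic setT geodesic_curve.
Proof.
have d1 : derive1 geodesic_curve = fun s => sinh s *: x + cosh s *: z.
  apply/funext => s.
  by rewrite /geodesic_curve (curve_derive1 (is_derive_cosh s) (is_derive_sinh s)).
have d2 : derive1 (derive1 geodesic_curve) = geodesic_curve.
  apply/funext => s.
  by rewrite d1 (curve_derive1 (is_derive_sinh s) (is_derive_cosh s)).
split=> [||s _|s _].
- exact: geodesic_curve_smooth.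
- by move=> s _; exact: geodesic_curve_H2.
- by rewrite d1 lor_comb; move: (cosh_sinh s); lra.
have [h _] := geodesic_curve_H2 s.
by rewrite d2 /projH2 h invrN invr1 mulrNN mulr1 scale1r subrr.
Qed.

(** Expand w in the Lorentz frame (x, y, z): the y-component vanishes and the
    other two satisfy the equation of a hyperbola. *)
Lemma geodesic_curve_asinh y w : lorentz_frame x y -> z = lcross x y -> H2 (-1) w ->
  lor y w = 0 -> w = geodesic_curve (asinh (lor w z)).
Proof.
move=> Fxy zE Hw yw; have xw := H2_lor_lt0 Hw Hx.
have := lorentz_frame_decomp w Fxy; rewrite (lorC w y) yw scale0r addr0 -zE => wE.
have ww : lor w w = -1 by case: Hw => -> _; rewrite invrN invr1.
have e : lor w x ^+ 2 = 1 + lor w z ^+ 2.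
  move: ww; rewrite {1 2}wE lor_comb; lra.
rewrite /geodesic_curve asinhK cosh_asinh -e sqrtr_sqr ltr0_norm //.
Qed.

End GeodesicCurve.

(** * The product of geodesics and the classification *)

Section FlatCase.
Context (R : realType) (S : surface R) (Phi : S -> ambient R) (K : R).
Hypothesis lagr : lagrangian_surface Phi.
Hypothesis mini : minimal Phi.
Hypothesis curv : has_constant_curvature Phi K.
Context (p0 : S).
Variable n : bool -> 'rV[R]_3.
Hypothesis nn : forall b, lor (n b) (n b) = 1.
Hypothesis hn : forall b p, lor (n b) (pr b (Phi p)) = 0.

Let x b := pr b (Phi p0).
Let z b := lcross (x b) (n b).

Let HP b p : H2 (-1) (pr b (Phi p)).
Proof. by have [h _ _] := lagr; have [] := h p; case: b. Qed.

Let F b : lorentz_frame (x b) (n b).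
Proof.
split; last by rewrite lorC hn.
  by have [-> _] := HP b p0; rewrite invrN invr1.
exact: nn.
Qed.

Let zz b : lor (z b) (z b) = 1.
Proof. by have [a1 a2 a3] := F b; rewrite lor_cross_cross a1 a2 a3 expr0n /= sub0r mulr1 opprK. Qed.

Let xz b : lor (x b) (z b) = 0.
Proof. by rewrite lorC lor_crossl. Qed.

(** The signed distance from the base point along the geodesic, recovered from
    the component along the initial velocity. *)
Definition arc_length b p : R := asinh (lor (pr b (Phi p)) (z b)).

Definition arc_lengths p : 'rV[R]_2 := \row_j arc_length (j == 0) p.

Lemma on_geodesic b p : pr b (Phi p) = geodesic_curve (x b) (z b) (arc_length b p).
Proof. exact: geodesic_curve_asinh (HP b p0) (zz b) (xz b) (n b) _ (F b) erefl (HP b p) (hn b p). Qed.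

Section InChart.
Variables (c : local_param R S) (ac : atlas c).
Let f := Phi \o param c.
Let H := chart_patch lagr mini curv ac.

Lemma arc_length_smooth b : smooth_on (dom c) (fun u => arc_length b (param c u) : R^o).
Proof.
move=> k; have o := @open_dom _ _ c.
apply: Ck_on_asinh => //.
have cf : Ck_on k (dom c) (fun u => pr b (f u)).
  by case: b; [apply: Ck_on_fst|apply: Ck_on_snd] => //; exact: patch_smooth H k.
have cm a m : Ck_on k (dom c) (fun u => a * pr b (f u) 0 m : R^o).
  by apply: Ck_onM => //; [exact: Ck_on_cst|exact: Ck_on_coord].
apply: (Ck_on_eq o _ (Ck_onD o (Ck_onD o (cm (- z b 0 0) 0) (cm (z b 0 1) 1)) (cm (z b 0 2) 2))).
by move=> u _; rewrite /lor /f /=; ring.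
Qed.

Lemma arc_lengths_smooth : smooth_on (dom c) (arc_lengths \o param c).
Proof.
move=> k; apply: Ck_on_mx => [|i j]; first exact: open_dom.
have -> : (fun u : 'rV[R]_2 => (arc_lengths \o param c) u i j : R^o) =
   (fun u => arc_length (j == 0) (param c u) : R^o) by apply/funext => u; rewrite !mxE.
exact: arc_length_smooth.
Qed.

(** The factor is a function of its arc length, by the chain rule. *)
Lemma arc_length_derive0 b u v : dom c u ->
  'D_v (fun u => arc_length b (param c u) : R^o) u = 0 -> pr b ('d f u v) = 0.
Proof.
move=> du d0; apply/rowP => m; rewrite mxE.
have da : differentiable (fun u => arc_length b (param c u) : R^o) u.
  by have [+ _] := arc_length_smooth b 1%N; apply.
have hd (s : R) : is_derive s 1 (fun s : R => cosh s * x b 0 m + sinh s * z b 0 m)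
    (sinh s * x b 0 m + cosh s * z b 0 m).
  have h1 := is_derive_cosh s; have h2 := is_derive_sinh s.
  by apply: is_derive_eq; rewrite /GRing.scale /=; ring.
have [_ e] := derive_comp1 v (hd _) da.
have e2 := @derive_linear R _ _ _ (pr_coord b m : {linear ambient R -> R^o}) f u v
  (@pr_coord_continuous R b m) (patch_differentiable H du).
transitivity (pr_coord b m ('D_v f u)); first by rewrite deriveE //; exact: (patch_differentiable H du).
rewrite d0 mulr0 in e; rewrite -e2 -e; congr ('D_v _ u); apply/funext => y.
by transitivity (pr b (Phi (param c y)) 0 m) => //; rewrite on_geodesic !mxE.
Qed.

(** If both arc lengths have zero derivative, so have both factors, and the
    immersion is injective on tangent vectors. *)
Lemma arc_lengths_immersed u : dom c u ->
  injective ('d (arc_lengths \o param c) u : 'rV[R]_2 -> 'rV[R]_2).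
Proof.
move=> du.
have ch := arc_lengths_smooth 1%N.
suff ker v : 'd (arc_lengths \o param c) u v = 0 -> v = 0.
  by move=> v w vw; apply/eqP; rewrite -subr_eq0; apply/eqP/ker; rewrite linearB /= vw subrr.
move=> dv.
have D (j : 'I_2) : 'D_v (fun u => arc_length (j == 0) (param c u) : R^o) u = 0.
  have := @derive_entry R _ _ ch u v j du; rewrite -(diff_jacobian ch v du) dv mxE => <-.
  by congr ('D_v _ u); apply/funext => y; rewrite mxE.
have d1 := arc_length_derive0 du (D 0).
have d2 := arc_length_derive0 du (D 1).
apply: (patch_immersed H du); rewrite linear0.
by apply: ambient_eq => -[] m; rewrite /pr_coord ?d1 ?d2 /pr !mxE.
Qed.
End InChart.

Lemma flat_product_of_geodesics : product_of_geodesics Phi.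
Proof.
have oT : open_interval [set: R].
  by split; [exact: openT|move=> ? ? _ _ ? _|exists 0].
exists setT, setT, (geodesic_curve (x true) (z true)), (geodesic_curve (x false) (z false)), arc_lengths.
split=> //.
- exact: geodesic_curve_unit_speed (HP true p0) (zz true) (xz true).
- exact: geodesic_curve_unit_speed (HP false p0) (zz false) (xz false).
- by move=> c ac; split; [exact: arc_lengths_smooth|exact: arc_lengths_immersed].
move=> p; split=> //; rewrite !mxE /=.
have h1 := on_geodesic true p; have h2 := on_geodesic false p.
by rewrite -h1 -h2 /pr; case: (Phi p).
Qed.

End FlatCase.

Theorem theorem5p4 (R : realType) (Sigma : surface R)
    (Phi : Sigma -> ambient R) (K : R) :
  [set: Sigma] !=set0 ->
  connected [set: Sigma] ->
  lagrangian_surface Phi ->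
  minimal Phi ->
  has_constant_curvature Phi K ->
  [/\ totally_geodesic Phi,
      product_of_geodesics Phi \/
      (exists2 B : set (ambient R), open_part_of_diagonal B &
         holomorphically_congruent (range Phi) B \/
         antiholomorphically_congruent (range Phi) B)
    & K = 0 \/ K = - 2^-1].
Proof.
move=> [p0 _] cS lagr mini curv.
have hK := global_curvature lagr mini curv p0.
split=> //; first exact: global_totally_geodesic lagr mini curv.
case: hK => hK.
  left; have G b := global_geodesic cS lagr mini curv p0 b hK.
  have [n hn] := choice G.
  by apply: (flat_product_of_geodesics lagr mini curv p0 (n := n)) => b; have [] := hn b.
right; have [A [sA hA]] := global_isometry cS lagr mini curv p0 hK.
have [B dB hB] := congruent_to_diagonal lagr mini curv p0 sA hA.
by exists B => //; left.
Qed.
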